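(* Let $P$ be a set of $m$ points in $\mathbb{R}^3$, and let $L$ be a set of $n$ lines in $\mathbb{R}^3$, such that the set $\tilde L$ of the Plücker images of the lines of $L$ is contained in some two-dimensional, non-planar, irreducible subvariety $T$, of constant degree, of the Klein quadric $Q$. Then $I(P,L)=O(m+n)$, where the implied constant depends only on $\deg(T)$.
   Context: Plücker space: a line in complex projective 3-space $\mathbb{P}^3$ through distinct points $x=(x_0:x_1:x_2:x_3)$ and $y=(y_0:y_1:y_2:y_3)$ is represented by the point $(\pi_{0,1},\pi_{0,2},\pi_{0,3},\pi_{2,3},\pi_{3,1},\pi_{1,2})\in\mathbb{P}^5$, $\pi_{i,j}=x_iy_j-x_jy_i$. This is a bijection between lines in $\mathbb{P}^3$ and points of the Klein quadric $Q\subset\mathbb{P}^5$, given by $\pi_{0,1}\pi_{2,3}+\pi_{0,2}\pi_{3,1}+\pi_{0,3}\pi_{1,2}=0$. The Plücker image of a line $\ell$ is denoted $\tilde\ell$; for a set $L$ of lines, $\tilde L=\{\tilde\ell\mid \ell\in L\}$. Lines in $\mathbb{R}^3$ are regarded as lines in complex projective 3-space, and varieties are taken over $\mathbb{C}$. ''Non-planar'' means that $T$ is not a 2-flat (a two-dimensional linear subspace of $\mathbb{P}^5$). $I(P,L)$ is the number of incidences, i.e., of pairs $(p,\ell)\in P\times L$ with $p\in\ell$. *)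

(* Defs.v *)
From HB Require Import structures.
From mathcomp Require Import all_boot all_order all_algebra.
From mathcomp Require Import finmap boolp classical_sets reals complex.
From mathcomp Require Import mpoly.

Set Implicit Arguments.
Unset Strict Implicit.
Unset Printing Implicit Defensive.

Import Order.TTheory GRing.Theory Num.Theory.

Local Open Scope ring_scope.
Local Open Scope classical_set_scope.

(* A subset of the projective space P^n over K is encoded as the set of all   *)
(* its (nonzero) vectors of homogeneous coordinates, in 'rV[K]_n.+1.          *)

Definition zero_locus (K : closedFieldType) (n : nat)
    (S : set {mpoly K[n.+1]}) : set 'rV[K]_n.+1 :=
  [set v : 'rV[K]_n.+1 | v != 0 /\ forall f, S f -> meval (v ord0) f = 0].

Definition proj_closed (K : closedFieldType) (n : nat)
    (T : set 'rV[K]_n.+1) : Prop :=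
  exists S : set {mpoly K[n.+1]},
    (forall f, S f -> exists d : nat, f \is d.-homog) /\ T = zero_locus S.

Definition irreducible_variety (K : closedFieldType) (n : nat)
    (T : set 'rV[K]_n.+1) : Prop :=
  [/\ proj_closed T, T !=set0 &
      forall A B : set 'rV[K]_n.+1, proj_closed A -> proj_closed B ->
        T `<=` A `|` B -> T `<=` A \/ T `<=` B].

Definition irreducible_chain (K : closedFieldType) (n : nat)
    (T : set 'rV[K]_n.+1) (d : nat) : Prop :=
  exists Z : nat -> set 'rV[K]_n.+1,
    (forall i, (i <= d)%N -> irreducible_variety (Z i) /\ Z i `<=` T) /\
    (forall i, (i < d)%N -> Z i `<` Z i.+1).

(* Krull dimension. *)
Definition variety_dim (K : closedFieldType) (n : nat)
    (T : set 'rV[K]_n.+1) (d : nat) : Prop :=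
  irreducible_chain T d /\ ~ irreducible_chain T d.+1.

(* N is the dimension of the degree k part of the homogeneous coordinate ring *)
(* of T; U is the degree k part of the homogeneous ideal of T.                *)
Definition hilbert_function (K : closedFieldType) (n : nat)
    (T : set 'rV[K]_n.+1) (k N : nat) : Prop :=
  exists U : {vspace dhomog n.+1 K k},
    (forall f : dhomog n.+1 K k,
        f \in U <-> forall v, T v -> meval (v ord0) (mpoly_of_dhomog f) = 0) /\
    (N + \dim U = \dim {: dhomog n.+1 K k})%N.

(* The degree of a projective variety of dimension d is d! times the leading  *)
(* coefficient of its Hilbert polynomial q, which has degree d. By the        *)
(* Hilbert-Serre theorem q exists for every projective variety.               *)
Definition variety_degree (K : closedFieldType) (n : nat)
    (T : set 'rV[K]_n.+1) (D : nat) : Prop :=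
  exists q : {poly rat},
    (exists k0 : nat, forall k : nat, (k0 <= k)%N ->
        exists N : nat, hilbert_function T k N /\ N%:R = q.[k%:R]) /\
    D%:R = ((size q).-1)`!%:R * lead_coef q.

Definition flat (K : closedFieldType) (n : nat)
    (d : nat) (T : set 'rV[K]_n.+1) : Prop :=
  exists W : 'M[K]_(d.+1, n.+1),
    row_free W /\ T = [set v : 'rV[K]_n.+1 | v != 0 /\ (v <= W)%MS].

(* The coordinates on P^5 are (pi_01, pi_02, pi_03, pi_23, pi_31, pi_12).     *)
Definition klein_quadric (K : closedFieldType) : set 'rV[K]_6 :=
  [set v : 'rV[K]_6 | v != 0 /\
    v ord0 0 * v ord0 3 + v ord0 1 * v ord0 4 + v ord0 2 * v ord0 5 = 0].

Definition plucker (K : closedFieldType) (x y : 'rV[K]_4) : 'rV[K]_6 :=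
  let pi (i j : 'I_4) := x ord0 i * y ord0 j - x ord0 j * y ord0 i in
  \row_k [:: pi 0 1; pi 0 2; pi 0 3; pi 2 3; pi 3 1; pi 1 2]`_k.

Definition is_line (R : realType) (l : set 'rV[R]_3) : Prop :=
  exists a u : 'rV[R]_3, u != 0 /\ l = [set a + t *: u | t in [set: R]].

Definition to_proj (R : realType) (p : 'rV[R]_3) : 'rV[R[i]]_4 :=
  row_mx 1 (map_mx (real_complex R) p) : 'rV[R[i]]_(1 + 3).

(* A single point of P^5 when l is a line. *)
Definition plucker_image (R : realType) (l : set 'rV[R]_3) : set 'rV[R[i]]_6 :=
  [set v | exists (c : R[i]) (x y : 'rV[R]_3),
    [/\ c != 0, l x, l y, x != y & v = c *: plucker (to_proj x) (to_proj y)]].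

Definition plucker_images (R : realType) (L : {fset set 'rV[R]_3}) :
    set 'rV[R[i]]_6 :=
  \bigcup_(l in [set` L]) plucker_image l.

Definition incidences (R : realType) (P : {fset 'rV[R]_3})
    (L : {fset set 'rV[R]_3}) : nat :=
  #|` [fset z in (P `*` L)%fset | z.1 \in z.2]%fset |.

(* Main.v *)
Require Import Defs.
From HB Require Import structures.
From mathcomp Require Import all_boot all_order all_algebra.
From mathcomp Require Import finmap boolp classical_sets reals complex.
From mathcomp Require Import mpoly.
From mathcomp Require Import ring lra zify.

Set Implicit Arguments.
Unset Strict Implicit.
Unset Printing Implicit Defensive.

Import Order.TTheory GRing.Theory Num.Theory.

Local Open Scope ring_scope.
Local Open Scope classical_set_scope.

(** Let T be a nonplanar irreducible surface in the Klein quadric: a family of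
lines v with two parameters. Split the given lines into three classes, according
to a coordinate axis to which the line is not orthogonal, and normalise the
direction so that the corresponding coordinate D is 1. A line of the class is
then x = A z - B, y = C z + E, with A, B, C, E the remaining Plücker coordinates
but one, and its points are (1, x, y, z).

The incidence bound comes from two polynomial relations, one for M = A and one
for M = C, of the form Phi(1, x, y, z, M) = 0, valid for all lines of T and all
points on them. Over a point where neither relation is trivial, A and C are roots
of polynomials of degree at most deg Phi, and with the point they determine the
line: there are O(1) lines through the point. The points over which a relation is
trivial are few on each line, at most deg Phi, except on the exceptional lines,
over which Phi vanishes whatever the value of M. Along an exceptional line the
derivative of Phi in M vanishes as well; as Phi is irreducible the two equations
have no common factor, and Bezout's inequality leaves at most O(deg Phi ^ 2)
exceptional lines (lines_on_surface). They contribute O(m) incidences, and the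
other lines O(n), in all O(m + n) (class_incidences).

The relation Phi exists for a reason of dimension: (1, x, y, z, M) depends on
three parameters, two for the line and one on the line. The ideal of all
relations is prime. It contains no relation between x, y, z alone, because the
lines of T fill the space (point_dominant). Since polynomial rings are factorial,
pseudo-division in M then shows that it is generated by one element
(principal_of_elimination). The Hilbert function of the ideal is at most k + 1
times that of T, because a form in the moving point is a polynomial of degree k
in z (hf_rel_le); comparing this with the Hilbert function of a hypersurface
bounds deg Phi by 48 (deg T + 1) (coordinate_relation).

Why the lines of T fill the space: suppose that the points satisfy an equation g,
of least degree. Differentiating it along a line gives a relation between the
point and the slopes A, C of the line. If A were also algebraic over the point,
then so would be C; but the point, A and C together depend on three parameters,
as they determine the line (not_quad_growth_rel6), whereas the point runs over a
surface. Hence A is transcendental over the point, so that what holds along the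
lines of T through a general point holds along all the tangents of the surface
there, and g vanishes on its tangent planes (tangent_plane). By minimality g is
linear, all the lines of T lie in one plane, and T is the 2-flat of the lines of
that plane, which is excluded (no_linear_relation).

Dimensions are handled through Hilbert functions only. Three facts connect them
with the definitions: a chain of three irreducible subvarieties makes the Hilbert
function of T grow at least quadratically (hf_van_lower); the absence of longer
chains bounds the degree of the Hilbert polynomial (grows_of_dim), whose leading
coefficient is then given by the degree of T (hf_van_upper); and the
Nullstellensatz, which is proved here over uncountable algebraically closed fields
by Noetherian induction and a count of dimensions, turns prime ideals into
irreducible varieties. *)

(** * Factorial polynomial rings *)

Definition ideal (R : comNzRingType) (I : R -> Prop) :=
  [/\ I 0, forall x y, I x -> I y -> I (x + y) & forall a x, I x -> I (a * x)].

Definition prime_ideal (R : comNzRingType) (I : R -> Prop) :=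
  forall a b, I (a * b) -> I a \/ I b.

Lemma idealB (R : comNzRingType) (I : R -> Prop) x y :
  ideal I -> I x -> I y -> I (x - y).
Proof. by case=> _ ID IM Ix Iy; rewrite -mulN1r; apply: ID (IM _ _ Iy). Qed.

(** Gauss's lemma: the leading coefficients of the two factors can be dealt with
one at a time. *)
Lemma coef_ideal_prime (R : idomainType) (I : R -> Prop) :
    ideal I -> prime_ideal I ->
  prime_ideal (fun f : {poly R} => forall i, I f`_i).
Proof.
move=> II pI f g; case: (II) => I0 ID IM.
have [n] := ubnP (size f + size g); elim: n f g => // n IHn f g /ltnSE le_n Ifg.
have [->|f0] := eqVneq f 0; first by left => i; rewrite coef0.
have [->|g0] := eqVneq g 0; first by right => i; rewrite coef0.
pose tr (h : {poly R}) := h - (lead_coef h)%:P * 'X^((size h).-1).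
have trE (h : {poly R}) : h = tr h + (lead_coef h)%:P * 'X^((size h).-1) by rewrite subrK.
have tr_lt (h : {poly R}) : h != 0 -> (size (tr h) < size h)%N.
  move=> h0; have sh : (0 < size h)%N by rewrite size_poly_gt0.
  rewrite -[X in (_ < X)%N](prednK sh) ltnS; apply/leq_sizeP => j lej.
  rewrite /tr coefB coefCM coefXn; case: eqVneq => [->|ne].
    by rewrite mulr1 subrr.
  by rewrite mulr0 subr0 nth_default // -(prednK sh) ltn_neqAle eq_sym ne.
have top a m i : I a -> I (a%:P * 'X^m)`_i.
  by move=> Ia; rewrite coefCM mulrC; apply: IM.
have coefM_in (p q : {poly R}) i : (forall j, I p`_j) -> I (p * q)`_i.
  move=> Ip; rewrite coefM; elim/big_ind: _ => // j _.
  by rewrite mulrC; apply: IM.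
have : I (lead_coef f * lead_coef g) by rewrite -lead_coefM; apply: Ifg.
case/pI => Il.
- case: (IHn (tr f) g); first by apply: leq_trans le_n; rewrite ltn_add2r tr_lt.
  + move=> i; rewrite /tr mulrBl coefB; apply: idealB => //.
    by apply: coefM_in => j; apply: top.
  + by move=> H; left => i; rewrite (trE f) coefD; apply: ID => //; apply: top.
  by right.
- case: (IHn f (tr g)); first by apply: leq_trans le_n; rewrite ltn_add2l tr_lt.
  + move=> i; rewrite /tr mulrBr coefB; apply: idealB => //.
    by rewrite mulrC; apply: coefM_in => j; apply: top.
  + by left.
  by move=> H; right => i; rewrite (trE g) coefD; apply: ID => //; apply: top.
Qed.

Definition divides (R : idomainType) (a b : R) := exists c, b = c * a.

Definition prime_elt (R : idomainType) (p : R) :=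
  [/\ p != 0, ~ divides p 1 &
      forall a b, divides p (a * b) -> divides p a \/ divides p b].

Definition factorial (R : idomainType) :=
  forall a : R, a != 0 -> exists (u : R) (s : seq R),
    [/\ divides u 1, forall p, p \in s -> prime_elt p & a = u * \prod_(p <- s) p].

Section Divides.
Variable R : idomainType.
Implicit Types a b c p u : R.

Lemma divides_refl a : divides a a.
Proof. by exists 1; rewrite mul1r. Qed.

Lemma divides_mull a b c : divides a b -> divides a (c * b).
Proof. by case=> d ->; exists (c * d); rewrite mulrA. Qed.

Lemma divides_mulr a b c : divides a b -> divides a (b * c).
Proof. by rewrite mulrC; apply: divides_mull. Qed.

Lemma dividesD a b c : divides a b -> divides a c -> divides a (b + c).
Proof. by case=> d -> [e ->]; exists (d + e); rewrite mulrDl. Qed.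

Lemma divides0 a : divides a 0.
Proof. by exists 0; rewrite mul0r. Qed.

Lemma divides_trans b a c : divides a b -> divides b c -> divides a c.
Proof. by move=> ab [d ->]; apply: divides_mull. Qed.

Lemma divides_prime_unit p u : prime_elt p -> divides u 1 -> ~ divides p u.
Proof. by case=> _ p1 _ u1 pu; apply/p1/(divides_trans pu). Qed.

(** Two primes that divide each other differ by a unit. *)
Lemma prime_divides_prod p (s : seq R) :
    prime_elt p -> (forall q, q \in s -> prime_elt q) ->
  divides p (\prod_(q <- s) q) ->
  exists2 q, q \in s & exists2 u, divides u 1 & q = u * p.
Proof.
move=> pp; elim: s => [|q s IHs] ps.
  by rewrite big_nil => p1; case: pp.
rewrite big_cons; case: (pp) => _ p1 pM /pM [[c qE]|/IHs IH].
  have [q0 q1 qM] : prime_elt q by apply: ps; rewrite mem_head.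
  exists q; rewrite ?mem_head //; exists c => //.
  have /qM [[d cE]|[d pE]] : divides q (c * p) by rewrite -qE; apply: divides_refl.
    exfalso; apply: p1; exists d; apply: (mulfI q0).
    by rewrite mulr1 {1}qE cE; ring.
  exists d; apply: (mulfI q0); rewrite mulr1 {1}qE pE; ring.
case: IH => [x xs|q' q's H]; first by apply: ps; rewrite inE xs orbT.
by exists q' => //; rewrite inE q's orbT.
Qed.

End Divides.

Section FactorialPoly.
Variable R : idomainType.
Implicit Types (f g h P : {poly R}) (a b c p u : R).

Lemma divides_polyC c (f : {poly R}) :
  (forall i, divides c f`_i) -> divides c%:P f.
Proof.
move=> H; have [g gE] := choice H.
exists (\poly_(i < size f) g i); apply/polyP=> i; rewrite coefMC coef_poly.
case: ltnP => [_|lt]; first by rewrite -gE.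
by rewrite mul0r nth_default.
Qed.

Lemma divides_polyC_coef c f i : divides c%:P f -> divides c f`_i.
Proof. by case=> g ->; exists g`_i; rewrite coefMC. Qed.

Lemma divides_ideal p : ideal (divides p).
Proof.
by split=> [|a b|a b]; [apply: divides0|apply: dividesD|apply: divides_mull].
Qed.

Lemma prime_polyC p : prime_elt p -> prime_elt p%:P.
Proof.
case=> p0 p1 pM; split.
- by rewrite polyC_eq0.
- by move=> /(@divides_polyC_coef _ _ 0); rewrite coefC eqxx.
move=> f g pfg; case: (coef_ideal_prime (divides_ideal p) pM (a := f) (b := g)) => [i|H|H].
- exact: divides_polyC_coef.
- by left; apply: divides_polyC.
- by right; apply: divides_polyC.
Qed.

Definition primitive P := forall p, prime_elt p -> ~ divides p%:P P.

Hypothesis factR : factorial R.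

(** The primes of the constant are cancelled one at a time, as none of them
divides P. *)
Lemma primitive_cancel P c g h :
  primitive P -> c != 0 -> P * g = c%:P * h -> divides P h.
Proof.
move=> prP /factR [u [s [[v vE] + ->]]] {c}.
elim: s g h => [|p s IHs] g h ps.
  rewrite big_nil mulr1 => E; exists (v%:P * g).
  by rewrite -mulrA [g * P]mulrC E mulrA -polyCM -vE mul1r.
have pp : prime_elt p by apply: ps; rewrite mem_head.
rewrite big_cons => E; case: (prime_polyC pp) => p0 _ pM.
have /pM [/(prP p pp)//|[g1 gE]] : divides p%:P (P * g).
  by rewrite E mulrCA polyCM -mulrA; apply: divides_mulr; apply: divides_refl.
apply: (IHs g1) => [q qs|]; first by apply: ps; rewrite inE qs orbT.
apply: (mulfI p0); rewrite mulrCA [p%:P * _]mulrC -gE E !polyCM; ring.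
Qed.

(** Each prime of the constant divides one of the two factors. *)
Lemma primitive_split P c g h :
    primitive P -> c != 0 -> c%:P * P = g * h ->
  exists g' h', [/\ P = g' * h', size g' = size g & size h' = size h].
Proof.
move=> prP /factR [u [s [[v vE] + ->]]] {c}.
elim: s g h => [|p s IHs] g h ps.
  rewrite big_nil mulr1 => E; have v0 : v != 0.
    by apply: contra_eqN vE => /eqP ->; rewrite mul0r oner_neq0.
  exists (v%:P * g), h; split=> //; last by rewrite mul_polyC size_scale.
  by rewrite -mulrA -E mulrA -polyCM -vE mul1r.
have pp : prime_elt p by apply: ps; rewrite mem_head.
rewrite big_cons => E; case: (prime_polyC pp) => p0 _ pM.
have sz k : size (k * p%:P) = size k.
  by rewrite mulrC mul_polyC size_scale // -polyC_eq0.
have /pM [[g1 gE]|[h1 hE]] : divides p%:P (g * h).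
- by rewrite -E mulrCA polyCM -mulrA; apply: divides_mulr; apply: divides_refl.
- case: (IHs g1 h) => [q qs||g' [h' [PE sg sh]]].
  + by apply: ps; rewrite inE qs orbT.
  + apply: (mulfI p0); rewrite [RHS]mulrA [p%:P * g1]mulrC -gE -E !polyCM; ring.
  + by exists g', h'; rewrite gE sz.
- case: (IHs g h1) => [q qs||g' [h' [PE sg sh]]].
  + by apply: ps; rewrite inE qs orbT.
  + apply: (mulfI p0); rewrite [RHS]mulrCA [p%:P * h1]mulrC -hE -E !polyCM; ring.
  + by exists g', h'; rewrite hE sz.
Qed.

Lemma exists_minn (Q : nat -> Prop) n :
  Q n -> exists m, Q m /\ forall k, Q k -> (m <= k)%N.
Proof.
move=> Qn; have ex : exists n, `[< Q n >] by exists n; apply/asboolP.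
case: (ex_minnP ex) => m /asboolP Qm min; exists m; split=> // k Qk.
by apply: min; apply/asboolP.
Qed.

(** The ideal generated by P and f, seen over the fraction field, is principal;
when its generator is neither P nor a constant it splits P. *)
Lemma irreducible_prime P :
    primitive P -> (1 < size P)%N ->
    (forall g h, P = g * h -> (1 < size g)%N -> (1 < size h)%N -> False) ->
  prime_elt P.
Proof.
move=> prP szP irrP; have P0 : P != 0 by rewrite -size_poly_gt0 ltnW.
split=> // [[c cE]|f g Pfg].
  have c0 : c != 0 by apply: contra_eqN cE => /eqP ->; rewrite mul0r oner_neq0.
  have := congr1 (fun g : {poly R} => size g) cE; rewrite size_poly1 size_mul //.
  by move: szP; rewrite -(size_poly_gt0 c) in c0; lia.
have [f0|f0] := eqVneq f 0; first by left; rewrite f0; apply: divides0.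
pose I (r : {poly R}) := exists u v : {poly R}, r = u * P + v * f.
have IP : I P by exists 1, 0; rewrite mul1r mul0r addr0.
have If : I f by exists 0, 1; rewrite mul1r mul0r add0r.
have ISub (c : R) (r1 q r2 : {poly R}) : I r1 -> I r2 -> I (c *: r1 - q * r2).
  case=> [u1 [v1 ->]] [u2 [v2 ->]].
  exists (c%:P * u1 - q * u2), (c%:P * v1 - q * v2); rewrite -mul_polyC; ring.
have [|m [[r [r0 rm Ir]] min]] :=
    @exists_minn (fun m => exists r : {poly R}, [/\ r != 0, size r = m & I r]) (size P).
  by exists P.
have divr (h : {poly R}) : I h -> exists (c : R) (q : {poly R}), c != 0 /\ c%:P * h = q * r.
  move=> Ih; exists (lead_coef r ^+ scalp h r), (h %/ r).
  split; first by rewrite expf_neq0 // lead_coef_eq0.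
  have E := Pdiv.Idomain.divp_eq h r.
  have [m0|mn0] := eqVneq (h %% r) 0; first by rewrite mul_polyC E m0 addr0.
  have /min : exists r' : {poly R}, [/\ r' != 0, size r' = size (h %% r) & I r'].
    exists (h %% r); split=> //.
    have -> : h %% r = lead_coef r ^+ scalp h r *: h - h %/ r * r.
      by rewrite E addrC addKr.
    exact: ISub.
  by rewrite -rm leqNgt ltn_modp r0.
have [c [q [c0 PE]]] := divr _ IP.
have [d [q' [d0 fE]]] := divr _ If.
have q0 : q != 0.
  have : c%:P * P != 0 by rewrite mulf_neq0 ?polyC_eq0.
  by rewrite PE mulf_eq0 negb_or => /andP[].
case: (boolP (size r == 1)%N) => [/size_poly1P [k k0 rE]|r1].
  right; case: Ir => u [v uvE]; case: Pfg => w wE.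
  apply: (@primitive_cancel P k (u * g + v * w) g prP k0).
  by rewrite -rE uvE mulrDl -[v * f * g]mulrA wE; ring.
case: (boolP (size q == 1)%N) => [/size_poly1P [k k0 qE]|q1].
  left; apply: (@primitive_cancel P (k * d) (q' * c%:P) f prP).
    by rewrite mulf_neq0.
  by rewrite polyCM -[RHS]mulrA fE [RHS]mulrCA -qE -PE; ring.
have [g' [h' [E sg sh]]] := primitive_split prP c0 PE.
by case: (irrP _ _ E); rewrite ?sg ?sh ltn_neqAle eq_sym ?r1 ?q1 size_poly_gt0.
Qed.

(** Constant primes are divided out first, which shortens the factorisation of the
leading coefficient; a primitive polynomial is then split into factors of smaller
degree until it is irreducible. *)
Lemma factorial_prime_list (s : seq R) u f :
    f != 0 -> divides u 1 -> (forall p, p \in s -> prime_elt p) ->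
    lead_coef f = u * \prod_(p <- s) p ->
  exists (w : {poly R}) (t : seq {poly R}),
    [/\ divides w 1, forall h, h \in t -> prime_elt h & f = w * \prod_(h <- t) h].
Proof.
have [n] := ubnP (size f); elim: n f s u => // n IHn f s u /ltnSE le_fn.
have [m] := ubnP (size s); elim: m s u f le_fn => // m IHm s u f le_fn /ltnSE le_sm.
move=> f0 u1 ps lcf.
have [[p pp [g gE]]|prf] := pselect (exists2 p, prime_elt p & divides p%:P f).
  have p0 : p != 0 by case: pp.
  have g0 : g != 0 by apply: contraNneq f0 => g0; rewrite gE g0 mul0r.
  have lg : lead_coef f = lead_coef g * p by rewrite gE lead_coefM lead_coefC.
  have : divides p (u * \prod_(q <- s) q) by rewrite -lcf lg; exists (lead_coef g).
  case: (pp) => _ _ pM /pM [/(divides_prime_unit pp u1)//|].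
  move=> /(prime_divides_prod pp ps) [q qs [v v1 qE]].
  have sr : size (rem q s) = (size s).-1 by rewrite size_rem.
  have s0 : (0 < size s)%N by case: (s) qs.
  case: (IHm (rem q s) (u * v) g).
  - by rewrite gE mulrC mul_polyC size_scale in le_fn.
  - by rewrite sr prednK.
  - exact: g0.
  - by case: u1 v1 => a aE [b bE]; exists (a * b); rewrite mulrACA -aE -bE mulr1.
  - by move=> q' /mem_rem /ps.
  - apply: (mulIf p0); rewrite -lg lcf (perm_big _ (perm_to_rem qs)) big_cons /=.
    rewrite {1}qE; ring.
  move=> w [t [w1 pt gE']]; exists w, (p%:P :: t); split=> // [q'|].
    by rewrite inE => /orP[/eqP->|/pt //]; apply: prime_polyC.
  by rewrite gE gE' big_cons; ring.
have prP : primitive f by move=> p pp pf; apply: prf; exists p.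
case: (boolP (size f == 1)%N) => [/size_poly1P [a a0 fE]|f1].
  exists f, [::]; split=> //; last by rewrite big_nil mulr1.
  case: (factR a0) => v [t [[v' vE] pt aE]].
  case: t pt aE => [|q t] pt aE.
    rewrite big_nil mulr1 in aE; exists v'%:P.
    by rewrite fE aE -polyCM -vE.
  case: (prP q); first by apply: pt; rewrite mem_head.
  exists (v * \prod_(j <- t) j)%:P.
  by rewrite fE aE big_cons -polyCM; congr _%:P; ring.
have [[g [h [fE szg szh]]]|irr] := pselect (exists g h,
    [/\ f = g * h, (1 < size g)%N & (1 < size h)%N]); last first.
  exists 1, [:: f]; split=> [|p|]; first exact: divides_refl.
    rewrite inE => /eqP ->; apply: irreducible_prime => //.
      by rewrite ltn_neqAle eq_sym f1 size_poly_gt0.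
    by move=> g h E szg szh; apply: irr; exists g, h.
  by rewrite mul1r big_seq1.
have g0 : g != 0 by rewrite -size_poly_gt0 ltnW.
have h0 : h != 0 by rewrite -size_poly_gt0 ltnW.
have szE : size f = (size g + size h).-1 by rewrite fE size_mul.
have fact (k : {poly R}) : k != 0 -> (size k < size f)%N -> exists (w : {poly R}) (t : seq {poly R}),
  [/\ divides w 1, forall h, h \in t -> prime_elt h & k = w * \prod_(h <- t) h].
  move=> k0 lt_kf.
  have /factR [v [t [v1 pt kE]]] : lead_coef k != 0 by rewrite lead_coef_eq0.
  exact: (IHn k t v (leq_trans lt_kf le_fn) k0 v1 pt kE).
case: (fact g) => //; first by rewrite szE; lia.
move=> w1 [t1 [[w1' w1E] pt1 gE]].
case: (fact h) => //; first by rewrite szE; lia.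
move=> w2 [t2 [[w2' w2E] pt2 hE]].
exists (w1 * w2), (t1 ++ t2); split.
- by exists (w1' * w2'); rewrite mulrACA -w1E -w2E mulr1.
- by move=> p; rewrite mem_cat => /orP[/pt1|/pt2].
- by rewrite fE gE hE big_cat /=; ring.
Qed.

Lemma factorial_poly : factorial {poly R}.
Proof.
move=> f f0; have /factR [u [s [u1 ps E]]] : lead_coef f != 0.
  by rewrite lead_coef_eq0.
exact: factorial_prime_list f0 u1 ps E.
Qed.

End FactorialPoly.

Lemma factorial_iso (A B : idomainType) (phi : {rmorphism A -> B})
    (psi : {rmorphism B -> A}) :
  cancel phi psi -> cancel psi phi -> factorial A -> factorial B.
Proof.
move=> phiK psiK factA b b0.
have divE x y : divides x y -> divides (phi x) (phi y).
  by case=> z ->; exists (phi z); rewrite rmorphM.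
have divE' x y : divides x y -> divides (psi x) (psi y).
  by case=> z ->; exists (psi z); rewrite rmorphM.
have [u [s [u1 ps E]]] : exists (u : A) (s : seq A),
    [/\ divides u 1, forall p, p \in s -> prime_elt p &
        psi b = u * \prod_(p <- s) p].
  by apply: factA; rewrite -(rmorph0 psi) (can_eq psiK).
exists (phi u), (map phi s); split.
- by rewrite -(rmorph1 phi); apply: divE.
- move=> _ /mapP [p /ps [p0 p1 pM] ->]; split.
  + by rewrite -(rmorph0 phi) (can_eq phiK).
  + by move=> /divE'; rewrite phiK rmorph1.
  + move=> x y /divE'; rewrite phiK rmorphM.
    by case/pM => /divE; rewrite psiK => H; [left|right].
- by rewrite big_map -rmorph_prod -rmorphM -E psiK.
Qed.

Lemma widen_lift n (i : 'I_n) : widen_ord (leqnSn n) i = lift ord_max i.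
Proof. by apply: val_inj; rewrite /= /bump leqNgt ltn_ord. Qed.

Section Muni.
Variables (K : comNzRingType) (n : nat).
Local Notation widen := (widen_ord (leqnSn n)).

Lemma mpoly_ring_ind (m : nat) (P : {mpoly K[m]} -> Prop) :
    (forall c, P c%:MP) -> (forall i, P 'X_i) ->
    (forall p q, P p -> P q -> P (p + q)) ->
    (forall p q, P p -> P q -> P (p * q)) ->
  forall p, P p.
Proof.
move=> PC PX PD PM; elim/mpolyind => [|c mo p _ _ IH].
  by rewrite -mpolyC0.
apply: PD => //; rewrite -mul_mpolyC; apply: (PM) => //.
rewrite mpolyXE_id; apply: (big_ind P) => [|x y|i _]; first by rewrite -mpolyC1.
  exact: PM.
elim: (mo i) => [|e IHe]; first by rewrite expr0 -mpolyC1.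
by rewrite exprS; apply: PM.
Qed.

Definition of_uni (q : {poly {mpoly K[n]}}) : {mpoly K[n.+1]} :=
  horner_eval 'X_ord_max (map_poly (@mwiden n K) q).

HB.instance Definition _ := GRing.RMorphism.copy of_uni
  (horner_eval 'X_ord_max \o map_poly (@mwiden n K)).

Lemma of_uniD : {morph of_uni : p q / p + q}.
Proof. by move=> p q; rewrite /of_uni rmorphD /horner_eval hornerD. Qed.

Lemma of_uniM : {morph of_uni : p q / p * q}.
Proof. by move=> p q; rewrite /of_uni rmorphM /horner_eval hornerM. Qed.

Lemma of_uniC p : of_uni p%:P = mwiden p.
Proof. by rewrite /of_uni map_polyC /horner_eval hornerC. Qed.

Lemma of_uniX : of_uni 'X = 'X_ord_max.
Proof. by rewrite /of_uni map_polyX /horner_eval hornerX. Qed.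

Lemma muni_ord_max : muni 'X_ord_max = 'X :> {poly {mpoly K[n]}}.
Proof.
rewrite muniE msuppX big_seq1 mcoeffX eqxx scale1r mnm1E eqxx expr1.
rewrite (_ : [multinom _ | i < n] = 0%MM) ?mpolyX0 ?scale1r //.
apply/mnmP=> i; rewrite mnmE mnm1E mnm0E.
by rewrite -val_eqE /= gtn_eqF.
Qed.

Lemma muni_widenX i : muni 'X_(widen i) = ('X_i)%:P :> {poly {mpoly K[n]}}.
Proof.
rewrite muniE msuppX big_seq1 mcoeffX eqxx scale1r mnm1E.
rewrite -val_eqE /= ltn_eqF // expr0 -mul_polyC mulr1.
congr ('X_[_])%:P; apply/mnmP=> j; rewrite mnmE !mnm1E.
by rewrite -!val_eqE.
Qed.

Lemma muni_mwiden p : muni (mwiden p) = p%:P :> {poly {mpoly K[n]}}.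
Proof.
elim/mpoly_ring_ind: p => [c|i|p q IHp IHq|p q IHp IHq].
- by rewrite mwidenC muniC.
- by rewrite mwidenX mnmwiden1 muni_widenX.
- by rewrite mwidenD muniD IHp IHq polyCD.
- by rewrite mwidenM muniM IHp IHq polyCM.
Qed.

Lemma of_uniK : cancel of_uni (@muni n K).
Proof.
elim/poly_ind => [|q p IH]; first by rewrite rmorph0 muni0.
by rewrite of_uniD of_uniM of_uniX of_uniC muniD muniM muni_ord_max muni_mwiden IH.
Qed.

Lemma muniK : cancel (@muni n K) of_uni.
Proof.
elim/mpoly_ring_ind => [c|i|p q IHp IHq|p q IHp IHq].
- by rewrite muniC of_uniC mwidenC.
- case: (unliftP ord_max i) => [j ->|->]; last by rewrite muni_ord_max of_uniX.
  by rewrite -widen_lift muni_widenX of_uniC mwidenX mnmwiden1.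
- by rewrite muniD of_uniD; congr (_ + _).
- by rewrite muniM of_uniM; congr (_ * _).
Qed.

End Muni.

Lemma factorial_mpoly (K : fieldType) n : factorial {mpoly K[n]}.
Proof.
elim: n => [|n IHn]; last first.
  pose phi : {rmorphism {poly {mpoly K[n]}} -> {mpoly K[n.+1]}} := @of_uni K n.
  pose psi : {rmorphism {mpoly K[n.+1]} -> {poly {mpoly K[n]}}} := @muni n K.
  have H := factorial_poly IHn.
  apply: (@factorial_iso _ _ phi psi) => //.
    exact: of_uniK.
  exact: muniK.
move=> p p0; exists p, [::]; split=> //; last by rewrite big_nil mulr1.
move: p0; rewrite (nvar0_mpolyC p) mpolyC_eq0 => c0.
by exists (p@_0)^-1%:MP; rewrite -mpolyCM mulVf // mpolyC1.
Qed.

(** * Noetherian polynomial rings *)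

Definition span_of (R : comNzRingType) (s : seq R) (x : R) :=
  exists c : nat -> R, x = \sum_(i < size s) c i * s`_i.

Definition noetherian (R : comNzRingType) :=
  forall I : R -> Prop, ideal I -> exists s : seq R,
    (forall x, x \in s -> I x) /\ (forall x, I x -> span_of s x).

Section Ideals.
Variable R : comNzRingType.
Implicit Types (I J : R -> Prop) (s : seq R).

Lemma ideal_sum I (T : Type) (r : seq T) (P : pred T) (F : T -> R) :
  ideal I -> (forall t, P t -> I (F t)) -> I (\sum_(t <- r | P t) F t).
Proof. by case=> I0 ID IM; apply: big_ind. Qed.

Lemma span_sub I s x :
  ideal I -> (forall y, y \in s -> I y) -> span_of s x -> I x.
Proof.
move=> II sI [c ->]; apply: ideal_sum => // i _.
by case: II => _ _; apply; apply: sI; apply: mem_nth.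
Qed.

Lemma span_ideal s : ideal (span_of s).
Proof.
split.
- by exists (fun _ => 0); rewrite big1 // => i _; rewrite mul0r.
- move=> _ _ [c ->] [d ->]; exists (fun i => c i + d i).
  by rewrite -big_split; apply: eq_bigr => i _; rewrite mulrDl.
- move=> a _ [c ->]; exists (fun i => a * c i).
  by rewrite mulr_sumr; apply: eq_bigr => i _; rewrite mulrA.
Qed.

Lemma mem_span s x : x \in s -> span_of s x.
Proof.
move=> /(nthP 0) [j lt_j <-]; exists (fun i => (i == j)%:R).
rewrite (bigD1 (Ordinal lt_j)) //= eqxx mul1r big1 ?addr0 // => i ne.
by move: ne; rewrite -val_eqE /= => /negPf ->; rewrite mul0r.
Qed.

Lemma chain_sub (I_ : nat -> R -> Prop) m n x :
  (forall n x, I_ n x -> I_ n.+1 x) -> (m <= n)%N -> I_ m x -> I_ n x.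
Proof.
move=> incr /subnK <-; elim: (n - m)%N => // k IHk Ix; rewrite addSn.
exact/incr/IHk.
Qed.

(** Finite generation bounds ascending chains of ideals. *)
Lemma noetherian_chain (I_ : nat -> R -> Prop) :
    noetherian R -> (forall n, ideal (I_ n)) ->
    (forall n x, I_ n x -> I_ n.+1 x) ->
  exists m, forall n x, I_ n x -> I_ m x.
Proof.
move=> noeth II incr; pose U x := exists n, I_ n x.
have mono m n x : (m <= n)%N -> I_ m x -> I_ n x by apply: chain_sub.
have UI : ideal U.
  split; first by exists 0%N; case: (II 0%N).
  - move=> x y [m Ix] [n Iy]; exists (maxn m n); case: (II (maxn m n)) => _ ID _.
    by apply: ID; [apply: mono Ix|apply: mono Iy]; lia.
  - by move=> a x [n Ix]; exists n; case: (II n) => _ _; apply.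
have [s [sU Us]] := noeth U UI.
have [m sm] : exists m, forall x, x \in s -> I_ m x.
  elim: s sU {Us} => [|x s IHs] sU; first by exists 0%N.
  case: IHs => [y ys|m sm]; first by apply: sU; rewrite inE ys orbT.
  have [n Ix] : U x by apply: sU; rewrite mem_head.
  exists (maxn m n) => y; rewrite inE => /orP[/eqP->|/sm].
    by apply: mono Ix; lia.
  by apply: mono; lia.
by exists m => n x Ix; apply: span_sub (II m) sm _; apply: Us; exists n.
Qed.

Lemma noetherian_sequence (a : nat -> R) : noetherian R ->
  exists m, span_of (mkseq a m) (a m).
Proof.
move=> noeth; case: (@noetherian_chain (fun m => span_of (mkseq a m))) => //.
- by move=> n; apply: span_ideal.
- move=> n x; apply: span_sub; first exact: span_ideal.
  move=> y ya; have [i + <-] := elimT (nthP 0) ya.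
  rewrite size_mkseq => lti; rewrite nth_mkseq //.
  by apply: mem_span; apply/(nthP 0); exists i; rewrite ?size_mkseq ?nth_mkseq // ltnW.
- move=> m mP; exists m; apply: (mP m.+1); apply: mem_span.
  by apply/(nthP 0); exists m; rewrite ?size_mkseq ?nth_mkseq.
Qed.

Lemma noetherian_ind (Q : (R -> Prop) -> Prop) : noetherian R ->
    (forall I, ideal I ->
      (forall J, ideal J -> (forall x, I x -> J x) -> (exists2 x, J x & ~ I x) ->
         Q J) -> Q I) ->
  forall I, ideal I -> Q I.
Proof.
move=> noeth step I II; apply: contrapT => nQ.
pose bad := {J : R -> Prop | ideal J /\ ~ Q J}.
have next (A : bad) : exists B : bad,
    (forall x, sval A x -> sval B x) /\ exists2 x, sval B x & ~ sval A x.
  case: A => A [IA nA] /=; apply: contrapT => no; apply: nA; apply: step => // J IJ AJ xJ.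
  by apply: contrapT => nJ; apply: no; exists (exist _ J (conj IJ nJ)).
have [nx nxP] := choice next.
pose A0 : bad := exist _ I (conj II nQ).
case: (@noetherian_chain (fun n => sval (iter n nx A0))) => //.
- by move=> n; case: (iter n nx A0) => J [].
- by move=> n x; rewrite iterS; apply: (nxP _).1.
- move=> m mP; have [_ [x Bx nAx]] := nxP (iter m nx A0).
  by apply: nAx; apply: (mP m.+1).
Qed.

Lemma span_rcons s x y : span_of s y -> span_of (rcons s x) y.
Proof.
apply: span_sub (span_ideal _) _ => z zs; apply: mem_span.
by rewrite mem_rcons inE zs orbT.
Qed.

End Ideals.

(** Hilbert's basis theorem: choosing successively elements of least degree
outside the ideal generated so far, the relation between leading coefficients
given by the ground ring lowers the degree. *)
Theorem noetherian_poly (R : comNzRingType) : noetherian R -> noetherian {poly R}.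
Proof.
move=> noeth I II; apply: contrapT => nfg.
have next (s : seq {poly R}) : exists f : {poly R}, (forall g, g \in s -> I g) ->
    [/\ I f, ~ span_of s f & forall g, I g -> ~ span_of s g -> (size f <= size g)%N].
  have [sI|nsI] := pselect (forall g, g \in s -> I g); last by exists 0.
  have [f [If nf]] : exists f, I f /\ ~ span_of s f.
    apply: contrapT => no; apply: nfg; exists s; split=> // x Ix.
    by apply: contrapT => nx; apply: no; exists x.
  have [|m [[g [Ig ng sg]] min]] := @exists_minn
      (fun m => exists f, [/\ I f, ~ span_of s f & size f = m]) (size f).
    by exists f.
  exists g => _; split=> // h Ih nh; rewrite sg.
  by apply: min; exists h.
have [nx nxP] := choice next.
pose l n := iter n (fun s => rcons s (nx s)) [::].
have lI n : forall g, g \in l n -> I g.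
  elim: n => // n IHn g; rewrite /= mem_rcons inE => /orP[/eqP->|/IHn//].
  by case: (nxP _ IHn).
pose f n := nx (l n).
have lE n : l n = mkseq f n.
  elim: n => // n IHn; rewrite /mkseq -addn1 iotaD map_cat -/(mkseq f n) -IHn.
  by rewrite cats1 addn1.
have fP n := nxP _ (lI n).
have [m [c cE]] := noetherian_sequence (fun n => lead_coef (f n)) noeth.
rewrite size_mkseq in cE.
have szf i : (i <= m)%N -> (size (f i) <= size (f m))%N.
  move=> le_im; case: (fP i) => _ _; apply; first by case: (fP m).
  have mono h : span_of (l i) h -> span_of (l m) h.
    move=> sp; rewrite -(subnK le_im); elim: (m - i)%N => // k IHk.
    by rewrite addSn; apply/span_rcons/IHk.
  by move=> sp; case: (fP m) => _ + _; apply; apply: mono.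
pose g := \sum_(i < m) (c i *: 'X^(size (f m) - size (f i))) * f i.
have gs : span_of (l m) g.
  exists (fun i => c i *: 'X^(size (f m) - size (f i))).
  rewrite lE size_mkseq; apply: eq_bigr => i _.
  by rewrite nth_mkseq.
have Ig : I g by apply: span_sub II (lI m) gs.
have nfm : ~ span_of (l m) (f m - g).
  move=> h; case: (fP m) => _ + _; apply; rewrite -[nx _](subrK g).
  by case: (span_ideal (l m)) => _ + _; apply.
case: (fP m) => Ifm nf /(_ _ (idealB II Ifm Ig) nfm).
have f0 : f m != 0.
  by apply/eqP => f0; apply: nf; rewrite [nx _]f0; case: (span_ideal (l m)).
have sf : (0 < size (f m))%N by rewrite size_poly_gt0.
rewrite leqNgt => /negP; apply.
rewrite -[X in (_ < X)%N](prednK sf) ltnS; apply/leq_sizeP => j lej.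
rewrite coefB; apply/eqP; rewrite subr_eq0; apply/eqP.
have gj : g`_j = \sum_(i < m) c i * (f i)`_(j - (size (f m) - size (f i))).
  rewrite /g coef_sum; apply: eq_bigr => i _.
  rewrite -scalerAl coefZ coefXnM ltnNge.
  have -> //= : (size (f m) - size (f i) <= j)%N.
  have fi0 : f i != 0.
    by apply/eqP => fi0; case: (fP i) => _ + _; apply; rewrite [nx _]fi0; case: (span_ideal (l i)).
  by have := szf i (ltnW (ltn_ord i)); move: fi0; rewrite -size_poly_gt0; lia.
rewrite gj; case: (ssrnat.ltngtP j (size (f m)).-1) lej => // [lt|jE] _.
  have le_mj : (size (f m) <= j)%N by rewrite -(prednK sf).
  rewrite nth_default //.
  rewrite big1 // => i _; rewrite nth_default ?mulr0 //.
  have := szf i (ltnW (ltn_ord i)).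
  by move: (size (f i)) (size (f m)) le_mj => a b; lia.
rewrite jE -lead_coefE cE; apply: eq_bigr => i _; rewrite nth_mkseq //=.
congr (_ * _); rewrite lead_coefE; congr (_`_ _).
have fi0 : f i != 0.
  by apply/eqP => fi0; case: (fP i) => _ + _; apply; rewrite [nx _]fi0; case: (span_ideal (l i)).
rewrite -size_poly_gt0 in fi0; have := szf i (ltnW (ltn_ord i)).
by move: (size (f i)) (size (f m)) fi0 => a b; lia.
Qed.

Lemma noetherian_image (A B : comNzRingType) (phi : {rmorphism A -> B}) (psi : B -> A) :
  cancel psi phi -> noetherian A -> noetherian B.
Proof.
move=> psiK noeth I [I0 ID IM].
have II : ideal (I \o phi).
  by split=> [|x y|a x] /=; rewrite ?rmorph0 ?rmorphD ?rmorphM; auto.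
have [s [sI Is]] := noeth _ II.
exists (map phi s); split=> [_ /mapP[x /sI Ix ->] //|x Ix].
have [c cE] : span_of s (psi x) by apply: Is; rewrite /= psiK.
exists (phi \o c); rewrite -(psiK x) cE rmorph_sum size_map.
by apply: eq_bigr => i _; rewrite rmorphM (nth_map 0).
Qed.

Lemma noetherian_mpoly (K : fieldType) n : noetherian {mpoly K[n]}.
Proof.
elim: n => [|n IHn].
  have noethK : noetherian K.
    move=> I [I0 ID IM]; have [[x Ix x0]|no] := pselect (exists2 x, I x & x != 0).
      exists [:: x]; split=> [y|y Iy]; first by rewrite inE => /eqP->.
      by exists (fun _ => y / x); rewrite big_ord1 /= divfK.
    exists [::]; split=> // x Ix; exists (fun _ => 0); rewrite big_ord0.
    by apply/eqP; apply: contrapT => /negP x0; apply: no; exists x.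
  pose phi : {rmorphism K -> {mpoly K[0]}} := @mpolyC 0 K.
  by apply: (@noetherian_image _ _ phi (mcoeff 0%MM)) => // p; rewrite /= -nvar0_mpolyC.
pose phi : {rmorphism {poly {mpoly K[n]}} -> {mpoly K[n.+1]}} := @of_uni K n.
apply: (@noetherian_image _ _ phi (@muni n K)); first exact: muniK.
exact: noetherian_poly.
Qed.

(** * The Nullstellensatz over an uncountable field *)

(** Uncountability, in the form needed to choose a general element: one that
avoids countably many finite sets. *)
Definition uncountable_type (K : eqType) :=
  forall F : nat -> seq K, exists a, forall k, a \notin F k.

Lemma exists_left_kernel (K : fieldType) m N (A : 'M[K]_(m, N)) :
  (N < m)%N -> exists2 r : 'rV_m, r != 0 & r *m A = 0.
Proof.
move=> lt_Nm; have : kermx A != 0.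
  by rewrite -mxrank_eq0 mxrank_ker subn_eq0 -ltnNge (leq_ltn_trans (rank_leq_col A)).
case/rowV0Pn => r /sub_kermxP rA r0; by exists r.
Qed.

Lemma mpoly_dependent (K : fieldType) n k m (g : 'I_m -> {mpoly K[n]}) :
    (forall i, msize (g i) <= k)%N -> (#|{: 'X_{1..n < k}}| < m)%N ->
  exists2 c : 'I_m -> K, (exists i, c i != 0) & \sum_i c i *: g i = 0.
Proof.
move=> szg /(@exists_left_kernel _ _ _
  (\matrix_(i < m, j < #|{: 'X_{1..n < k}}|) (g i)@_(enum_val j))) [r r0 rA].
exists (r 0).
  by case/rV0Pn: r0 => i ri; exists i.
apply/mpolyP => mo; rewrite mcoeff0 raddf_sum /=.
have [lt_k|le_k] := ltnP (mdeg mo) k; last first.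
  rewrite big1 // => i _; rewrite mcoeffZ.
  by rewrite (memN_msupp_eq0 (msize_mdeg_ge (leq_trans (szg i) le_k))) mulr0.
have := congr1 (fun B : 'rV_ _ => B 0 (enum_rank (BMultinom lt_k))) rA.
rewrite !mxE => E; rewrite -[RHS]E; apply: eq_bigr => i _.
by rewrite mcoeffZ mxE enum_rankK.
Qed.

Lemma cover_or_uniq (T : eqType) (A : T -> Prop) N :
  (exists l : seq T, forall a, A a -> a \in l) \/
  (exists l : seq T, [/\ uniq l, size l = N & forall a, a \in l -> A a]).
Proof.
elim: N => [|N [IH|[l [ul sl lA]]]]; first by right; exists [::].
  by left.
have [cov|] := pselect (forall a, A a -> a \in l); first by left; exists l.
move=> /existsNP [a /not_implyP [Aa /negP al]]; right; exists (a :: l).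
split=> /= [||b]; rewrite ?al ?sl // inE => /orP[/eqP->//|]; exact: lA.
Qed.

Section Nullstellensatz.
Variables (K : closedFieldType) (n : nat).
Hypothesis uncK : uncountable_type K.
Implicit Types (J : {mpoly K[n]} -> Prop) (f g h : {mpoly K[n]}).

Definition at_var (i : 'I_n) (q : {poly K}) : {mpoly K[n]} :=
  horner_eval 'X_i (map_poly (@mpolyC n K) q).

HB.instance Definition _ i := GRing.RMorphism.copy (at_var i)
  (horner_eval 'X_i \o map_poly (@mpolyC n K)).

Lemma at_varXB i a : at_var i ('X - a%:P) = 'X_i - a%:MP.
Proof.
by rewrite /at_var rmorphB /= map_polyX map_polyC /horner_eval hornerD hornerN hornerX hornerC.
Qed.

Lemma at_varZ i a q : at_var i (a *: q) = a *: at_var i q.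
Proof.
by rewrite -mul_polyC rmorphM /= {1}/at_var map_polyC /horner_eval hornerC mul_mpolyC.
Qed.

(** If J is maximal among the ideals avoiding the powers of f, then every X_i - a
outside J has an inverse modulo J once f is inverted. These uncountably many
inverses lie in countably many finite-dimensional spaces, one of which therefore
contains more of them than its dimension; clearing denominators in a linear
dependence gives an algebraic equation for X_i modulo J. *)
Lemma max_ideal_coordinate J f i :
    ideal J -> (forall s, ~ J (f ^+ s)) ->
    (forall h, ~ J h -> exists s g, J (f ^+ s - h * g)) ->
  exists a, J ('X_i - a%:MP).
Proof.
move=> IJ Jf Jmax; case: (IJ) => J0 JD JM.
apply: contrapT => nJ.
have sg_ex a : exists sg : nat * {mpoly K[n]},
    J (f ^+ sg.1 - ('X_i - a%:MP) * sg.2).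
  case: (Jmax ('X_i - a%:MP)) => [Ja|s [g H]]; last by exists (s, g).
  by apply: nJ; exists a.
have [sg sgP] := choice sg_ex.
pose N k := #|{: 'X_{1..n < k}}|.+1.
pose A s k a := (sg a).1 = s /\ (msize (sg a).2 <= k)%N.
have [s [k [l [ul sl lA]]]] : exists s k l,
    [/\ uniq l, size l = N k & forall a, a \in l -> A s k a].
  apply: contrapT => no.
  have F_ex (p : nat * nat) : exists l : seq K, forall a, A p.1 p.2 a -> a \in l.
    case: (@cover_or_uniq K (A p.1 p.2) (N p.2)) => // -[l H].
    by case: no; exists p.1, p.2, l.
  have [F FP] := choice F_ex.
  have [a aP] := uncK (fun m => oapp F [::] (@choice.unpickle (nat * nat)%type m)).
  have /negP := aP (choice.pickle ((sg a).1, msize (sg a).2)).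
  by rewrite choice.pickleK /=; apply; apply: FP.
pose a (j : 'I_(N k)) := l`_j.
have a_inj : injective a.
  move=> j1 j2 /eqP; rewrite nth_uniq ?sl // => /eqP; exact: val_inj.
have aA j : A s k (a j) by apply: lA; apply: mem_nth; rewrite sl.
have [c [j0 cj0] cE] : exists2 c : 'I_(N k) -> K, (exists j, c j != 0) &
    \sum_j c j *: (sg (a j)).2 = 0.
  by apply: (@mpoly_dependent _ _ k) => // j; case: (aA j).
pose P j : {poly K} := \prod_(t | t != j) ('X - (a t)%:P).
pose Q := \sum_j c j *: P j.
have Q0 : Q != 0.
  apply: contra_neq cj0 => Q0; have := congr1 (fun q => q.[a j0]) Q0.
  rewrite horner0 /Q horner_sum (bigD1 j0) //= big1 ?addr0 => [|j ne]; last first.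
    by rewrite hornerZ /P (bigD1 j0) 1?eq_sym //= hornerM hornerXsubC subrr mul0r mulr0.
  rewrite hornerZ => /eqP; rewrite mulf_eq0 => /orP[/eqP //|].
  rewrite /P horner_prod => /eqP H; case/idP: (negPf (oner_neq0 K)).
  suff /eqP : \prod_(t | t != j0) ('X - (a t)%:P).[a j0] != 0 by rewrite H.
  rewrite prodf_seq_neq0; apply/allP => t _; apply/implyP => ne.
  by rewrite hornerXsubC subr_eq0 (inj_eq a_inj) eq_sym.
have JQ : J (f ^+ s * at_var i Q).
  have -> : f ^+ s * at_var i Q = \sum_j (c j *: at_var i (P j)) *
      (f ^+ s - ('X_i - (a j)%:MP) * (sg (a j)).2).
    apply: esym; rewrite (eq_bigr (fun j => f ^+ s * (c j *: at_var i (P j)) -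
       at_var i (\prod_t ('X - (a t)%:P)) * (c j *: (sg (a j)).2))) => [|j _].
      rewrite sumrB -!mulr_sumr cE mulr0 subr0; congr (_ * _).
      by rewrite rmorph_sum; apply: eq_bigr => j _; rewrite /= at_varZ.
    rewrite (bigD1 j) //= -/(P j) rmorphM /= at_varXB -!mul_mpolyC; ring.
  apply: ideal_sum => // j _; apply: JM.
  by have := sgP (a j); case: (aA j) => -> _.
have JQ' : J (at_var i Q).
  apply: contrapT => /Jmax [t [g H]]; apply: (Jf (t + s)%N).
  have -> : f ^+ (t + s) = f ^+ s * (f ^+ t - at_var i Q * g) + g * (f ^+ s * at_var i Q).
    by rewrite exprD; ring.
  by apply: JD; apply: JM.
have [r rE] := closed_field_poly_normal Q.
have lQ : (lead_coef Q)^-1 *: at_var i Q = at_var i (\prod_(z <- r) ('X - z%:P)).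
  by rewrite {2}rE at_varZ scalerA mulVf ?scale1r // lead_coef_eq0.
have : J (at_var i (\prod_(z <- r) ('X - z%:P))).
  by rewrite -lQ -mul_mpolyC; apply: JM.
elim: r {rE lQ} => [|z r IHr].
  by rewrite big_nil rmorph1 => J1; apply: (Jf 0%N); rewrite expr0.
rewrite big_cons rmorphM /= at_varXB => H.
case: (pselect (J (at_var i (\prod_(z <- r) ('X - z%:P))))) => [/IHr //|].
move=> /Jmax [t [g Hg]]; case: (pselect (J ('X_i - z%:MP))) => [Jz|].
  by apply: nJ; exists z.
move=> /Jmax [t' [g' Hg']]; apply: (Jf (t + t')%N).
set u := 'X_i - z%:MP in H Hg' *; set w := at_var i _ in H Hg.
have -> : f ^+ (t + t') = f ^+ t' * (f ^+ t - w * g) + (w * g) * (f ^+ t' - u * g')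
   + (g * g') * (u * w).
  by rewrite exprD; ring.
by apply: (JD); [apply: JD|]; apply: JM.
Qed.

(** By noetherian induction one may suppose that J is maximal among the ideals
avoiding the powers of f; modulo such an ideal every variable is a constant, and
these constants are the coordinates of the point. *)
Theorem nullstellensatz J f : ideal J -> (forall s, ~ J (f ^+ s)) ->
  exists2 v : 'I_n -> K, (forall h, J h -> h.@[v] = 0) & f.@[v] != 0.
Proof.
move: J; apply: (noetherian_ind (@noetherian_mpoly K n)) => J IJ IH Jf.
case: (IJ) => J0 JD JM.
have [[h [nJh hf]]|no] := pselect (exists h, ~ J h /\
    forall s g, ~ J (f ^+ s - h * g)).
  case: (IH (fun p => exists g, J (p - h * g))).
  - split; first by exists 0; rewrite mulr0 subr0.
    + move=> p q [g1 H1] [g2 H2]; exists (g1 + g2).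
      by rewrite mulrDr opprD addrACA; apply: JD.
    + by move=> a p [g H]; exists (a * g); rewrite mulrCA -mulrBr; apply: JM.
  - by move=> p Jp; exists 0; rewrite mulr0 subr0.
  - by exists h => //; exists 1; rewrite mulr1 subrr.
  - by move=> s [g /hf].
  - move=> v vP fv; exists v => // p Jp; apply: vP; exists 0.
    by rewrite mulr0 subr0.
have Jmax h : ~ J h -> exists s g, J (f ^+ s - h * g).
  move=> nJh; apply: contrapT => nex; apply: no; exists h; split=> // s g H.
  by apply: nex; exists s, g.
have [v vP] := choice (fun i => max_ideal_coordinate i IJ Jf Jmax).
have ev h : J (h - h.@[v]%:MP).
  elim/mpoly_ring_ind: h => [c|i|p q Hp Hq|p q Hp Hq].
  - by rewrite mevalC subrr.
  - by rewrite mevalXU.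
  - by rewrite mevalD mpolyCD opprD addrACA; apply: JD.
  - rewrite mevalM mpolyCM.
    have -> : p * q - p.@[v]%:MP * q.@[v]%:MP =
      q * (p - p.@[v]%:MP) + p.@[v]%:MP * (q - q.@[v]%:MP) by ring.
    by apply: JD; apply: JM.
have Jc (c : K) : J c%:MP -> c = 0.
  move=> Jc; apply/eqP; apply/negPn/negP => c0; apply: (Jf 0%N).
  by rewrite expr0 -mpolyC1 -(mulVf c0) mpolyCM; apply: JM.
exists v => [h Jh|].
  by apply: Jc; rewrite -[_%:MP](subKr h); apply: idealB.
apply/eqP => fv; apply: (Jf 1%N); rewrite expr1.
by have := ev f; rewrite fv mpolyC0 subr0.
Qed.

End Nullstellensatz.

(** * Uncountability of the complex numbers *)

Section Uncountable.
Variable R : realType.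

Lemma interval_avoiding (l : seq R) (a b : R) : a < b ->
  exists a' b', [/\ a <= a', a' < b', b' <= b & forall x, x \in l -> x < a' \/ b' < x].
Proof.
move=> ab; elim: l => [|x l [a' [b' [le_a lt_ab le_b avoid]]]].
  by exists a, b; rewrite !lexx.
pose m := (a' + b') / 2.
have am : a' < m by rewrite /m; lra.
have mb : m < b' by rewrite /m; lra.
have [le_xm|lt_mx] := lerP x m; [exists ((m + b') / 2), b'|exists a', m]; split.
- lra.
- lra.
- by [].
- move=> y; rewrite inE => /orP[/eqP ->|/avoid [|]]; [left; lra|left; lra|by right].
- by [].
- by [].
- lra.
- move=> y; rewrite inE => /orP[/eqP ->|/avoid [|]]; [by right|by left|right; lra].
Qed.

(** Cantor's nested intervals, each one avoiding one more finite set. *)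
Lemma uncountable_real : uncountable_type R.
Proof.
move=> F; pose Itv := {p : R * R | p.1 < p.2}.
have next (p : nat * Itv) : exists q : Itv, [/\ (sval p.2).1 <= (sval q).1,
    (sval q).2 <= (sval p.2).2 &
    forall x, x \in F p.1 -> x < (sval q).1 \/ (sval q).2 < x].
  case: p => k [[a b] /= ab]; have [a' [b' [H1 H2 H3 H4]]] := interval_avoiding (F k) ab.
  by exists (exist (fun p : R * R => p.1 < p.2) (a', b') H2).
have [nx nxP] := choice next.
have lt01 : (0 : R, 1 : R).1 < (0 : R, 1 : R).2 by rewrite /= ltr01.
pose I0 : Itv := exist (fun p : R * R => p.1 < p.2) _ lt01.
pose I := fix I k := if k is k'.+1 then nx (k', I k') else I0.
pose a k := (sval (I k)).1; pose b k := (sval (I k)).2.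
have IS k : [/\ a k <= a k.+1, b k.+1 <= b k &
    forall x, x \in F k -> x < a k.+1 \/ b k.+1 < x] := nxP (k, I k).
have ab k : a k < b k by rewrite /a /b; case: (I k).
have amono j k : a k <= a (j + k)%N.
  by elim: j => // j IHj; rewrite addSn; case: (IS (j + k)%N) => H _ _; apply: le_trans H.
have bmono j k : b (j + k)%N <= b k.
  by elim: j => // j IHj; rewrite addSn; case: (IS (j + k)%N) => _ H _; apply: le_trans IHj.
have a_le_b j k : a j <= b k.
  case/orP: (leq_total j k) => /subnK E.
    by apply: le_trans (ltW (ab k)); rewrite -E; apply: amono.
  by apply: le_trans (ltW (ab j)) _; rewrite -E; apply: bmono.
pose A : set R := [set a k | k in [set: nat]].
have supA : has_sup A.
  split; first by exists (a 0%N); exists 0%N.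
  by exists (b 0%N) => _ [k _ <-].
exists (sup A) => k; apply/negP => Fs.
have le_sup j : a j <= sup A by apply: sup_upper_bound => //; exists j.
have sup_le j : sup A <= b j.
  by apply: ge_sup; [case: supA|move=> _ [i _ <-]].
case: (IS k) => _ _ /(_ _ Fs) [|].
  by rewrite ltNge le_sup.
by rewrite ltNge sup_le.
Qed.

Lemma uncountable_complex : uncountable_type R[i].
Proof.
move=> F; have [a aP] := uncountable_real (fun k => map (@complex.Re R) (F k)).
exists (real_complex R a) => k; apply/negP => H.
by have := aP k; rewrite (map_f (@complex.Re R) H).
Qed.

End Uncountable.

(** * Hilbert functions of homogeneous ideals *)

(** Among the subspaces contained in P, one of largest dimension is all of P. *)
Lemma exists_vspace (K : fieldType) (V : vectType K) (P : V -> Prop) :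
    P 0 -> (forall a u v, P u -> P v -> P (a *: u + v)) ->
  exists U : {vspace V}, forall v, v \in U <-> P v.
Proof.
move=> P0 PD; pose Q m := exists U : {vspace V},
  (forall v, v \in U -> P v) /\ (\dim {:V} - \dim U = m)%N.
have [|m [[U [UP Um]] min]] := @exists_minn Q (\dim {:V} - \dim (0%VS : {vspace V}))%N.
  by exists 0%VS; split=> // v; rewrite memv0 => /eqP->.
exists U => v; split=> [/UP //|Pv]; apply: contrapT => /negP vU.
have : Q (\dim {:V} - \dim (U + <[v]>)%VS)%N.
  exists (U + <[v]>)%VS; split=> // _ /memv_addP [u uU [_ /vlineP [a ->] ->]].
  by rewrite addrC; apply: PD => //; apply: UP.
rewrite -{}Um in min; move/min => le_dim.
have UW : (U <= U + <[v]>)%VS by apply: addvSl.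
have := dimvS (subvf (U + <[v]>)%VS); have := dimvS UW => H1 H2.
have : U == (U + <[v]>)%VS by rewrite eqEdim UW /=; lia.
move/eqP => E; case/negP: vU; rewrite E.
by apply: subvP (addvSr _ _) _ _; apply: memv_line.
Qed.

Definition codim (K : fieldType) (V : vectType K) (U : {vspace V}) :=
  (\dim {:V} - \dim U)%N.

Lemma codimE (K : fieldType) (V : vectType K) (U : {vspace V}) :
  (codim U + \dim U = \dim {:V})%N.
Proof. by rewrite /codim subnK // dimvS // subvf. Qed.

Lemma codimS (K : fieldType) (V : vectType K) (U W : {vspace V}) :
  (U <= W)%VS -> (codim W <= codim U)%N.
Proof. by move=> UW; apply: leq_sub2l; apply: dimvS. Qed.

Lemma codimI (K : fieldType) (V : vectType K) (U W : {vspace V}) :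
  (codim (U :&: W)%VS <= codim U + codim W)%N.
Proof.
have := codimE U; have := codimE W; have := codimE (U :&: W)%VS.
have := dimv_sum_cap U W; have := dimvS (subvf (U + W)%VS).
by move: (\dim _) (\dim _) (\dim _) (\dim _) (\dim _); lia.
Qed.

(** The second isomorphism theorem, in terms of dimensions. *)
Lemma codim_preim_add (K : fieldType) (V W : vectType K) (f : 'Hom(V, W))
    (U : {vspace W}) :
  (codim (f @^-1: U)%VS + codim (U + limg f)%VS = codim U)%N.
Proof.
have := codimE U; have := codimE (f @^-1: U)%VS; have := codimE (U + limg f)%VS.
have := limg_ker_dim f {:V}; have := limg_ker_dim f (f @^-1: U)%VS.
rewrite capfv; have /capv_idPr -> : (lker f <= f @^-1: U)%VS.
  by rewrite -lpreim0 lpreimS // sub0v.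
rewrite -[X in (f @: X)%VS](lpreim_cap_limg f U) lpreimK ?capvSr //.
have := dimv_sum_cap U (limg f); lia.
Qed.

Lemma variable_homog (R : nzRingType) n (i : 'I_n) : ('X_i : {mpoly R[n]}) \is 1.-homog.
Proof. by rewrite dhomogX /= mdeg1. Qed.

Lemma homog0_constant (R : nzRingType) n (f : {mpoly R[n]}) d :
  f \is d.-homog -> d = 0%N -> exists c, f = c%:MP.
Proof.
move=> fd d0; exists f@_0; apply/mpolyP => m; rewrite mcoeffC.
have [->|m0] := eqVneq m 0%MM; first by rewrite mulr1.
by rewrite mulr0 (dhomog_nemf_coeff fd) // d0 mdeg_eq0.
Qed.

Lemma exists_mnm_neq0 n (m : 'X_{1..n}) : mdeg m != 0%N -> exists i, m i != 0%N.
Proof.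
rewrite mdeg_eq0 => m0; apply: contrapT => no; case/eqP: m0; apply/mnmP => i.
by rewrite mnm0E; apply/eqP/negPn/negP => mi; apply: no; exists i.
Qed.

Section HilbertFunction.
Variables (K : fieldType) (n : nat).
Local Notation S := {mpoly K[n.+1]}.
Local Notation H k := (dhomog n.+1 K k).
Implicit Types (J : S -> Prop) (f g p : S).

(** The degree k part of an ideal. The subspace exists for every ideal, but as
ideals are arbitrary predicates it has to be chosen. *)
Definition hpart J k : {vspace H k} :=
  xget 0%VS [set U : {vspace H k} | forall v : H k, v \in U <-> J (mpoly_of_dhomog v)].

Lemma hpartP J k (v : H k) : ideal J -> v \in hpart J k <-> J (mpoly_of_dhomog v).
Proof.
move=> [J0 JD JM]; case: (@exists_vspace K (H k) (fun v => J (mpoly_of_dhomog v))).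
- by rewrite raddf0.
- move=> a u w Ju Jw; rewrite linearP /=; apply: JD => //.
  by rewrite -mul_mpolyC; apply: JM.
by move=> U UP; rewrite /hpart; case: xgetP => [W _ |/(_ U)/(_ UP)//]; apply.
Qed.

Definition hf J k : nat := codim (hpart J k).

Lemma hf_sub J J' k : ideal J -> ideal J' ->
  (forall p, p \is k.-homog -> J p -> J' p) -> (hf J' k <= hf J k)%N.
Proof.
move=> IJ IJ' sub; apply: codimS; apply/subvP => v /(hpartP _ IJ) Jv.
by apply/(hpartP _ IJ'); apply: sub => //; apply: dhomog_is_dhomog.
Qed.

Lemma hf_eq0 J k : ideal J -> (forall p, p \is k.-homog -> J p) -> hf J k = 0%N.
Proof.
move=> IJ Jk; apply/eqP; rewrite subn_eq0; apply: dimvS; apply/subvP => v _.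
by apply/(hpartP _ IJ); apply: Jk; apply: dhomog_is_dhomog.
Qed.

Definition mulh d (f : H d) k (p : H k) : H (k + d) :=
  DHomog (dhomogM (dhomog_is_dhomog p) (dhomog_is_dhomog f)).

Lemma mulh_is_linear d (f : H d) k : linear (@mulh d f k).
Proof.
by move=> a u v; apply: val_inj; rewrite /= mulrDl scalerAl.
Qed.

HB.instance Definition _ d (f : H d) k :=
  GRing.isLinear.Build K (H k) (H (k + d)) _ (@mulh d f k) (@mulh_is_linear d f k).

(** Membership in the ideals J : f and J + (f). *)
Definition colon J f : S -> Prop := fun p => J (p * f).
Definition addp J f : S -> Prop := fun p => exists g, J (p - g * f).

Definition hom_ideal J := ideal J /\ forall p d, J p -> J (pihomog mdeg d p).

Lemma colon_ideal J f : ideal J -> ideal (colon J f).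
Proof.
case=> J0 JD JM; split; rewrite /colon.
- by rewrite mul0r.
- by move=> p q Jp Jq; rewrite mulrDl; apply: JD.
- by move=> a p Jp; rewrite -mulrA; apply: JM.
Qed.

Lemma addp_ideal J f : ideal J -> ideal (addp J f).
Proof.
case=> J0 JD JM; split; rewrite /addp.
- by exists 0; rewrite mul0r subr0.
- move=> p q [g Hp] [h Hq]; exists (g + h).
  by rewrite mulrDl opprD addrACA; apply: JD.
- by move=> a p [g Hp]; exists (a * g); rewrite -mulrA -mulrBr; apply: JM.
Qed.

Lemma addp_sub J f p : J p -> addp J f p.
Proof. by move=> Jp; exists 0; rewrite mul0r subr0. Qed.

Lemma addp_gen J f : ideal J -> addp J f f.
Proof. by case=> J0 _ _; exists 1; rewrite mul1r subrr. Qed.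

Lemma pihomogM p f d k : f \is d.-homog ->
  pihomog mdeg (k + d)%N (p * f) = pihomog mdeg k p * f.
Proof.
move=> fd; rewrite {1}(pihomog_partitionE (leqnn (msize p))) mulr_suml raddf_sum /=.
have [lt_k|le_k] := ltnP k (msize p); last first.
  have -> : pihomog mdeg k p = 0.
    rewrite pihomogE big_seq_cond big1 // => m /andP[mp /eqP mk].
    by have := msize_mdeg_lt mp; rewrite mk ltnNge le_k.
  rewrite mul0r big1 // => i _; apply: (@pihomog_ne0 _ _ mdeg (i + d)%N).
    by rewrite eqn_add2r ltn_eqF // (leq_trans _ le_k).
  by apply: dhomogM fd; apply: pihomogP.
rewrite (bigD1 (Ordinal lt_k)) //= big1 ?addr0 => [|i ne].
  by apply: pihomog_dE; apply: dhomogM fd; apply: pihomogP.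
apply: (@pihomog_ne0 _ _ mdeg (i + d)%N); first by rewrite eqn_add2r.
by apply: dhomogM fd; apply: pihomogP.
Qed.

Lemma pihomogM_small p f d k : f \is d.-homog -> (k < d)%N ->
  pihomog mdeg k (p * f) = 0.
Proof.
move=> fd lt_kd; rewrite (pihomog_partitionE (leqnn (msize p))) mulr_suml raddf_sum /=.
rewrite big1 // => i _; apply: (@pihomog_ne0 _ _ mdeg (i + d)%N).
  by rewrite gtn_eqF // (leq_trans lt_kd) // leq_addl.
by apply: dhomogM fd; apply: pihomogP.
Qed.

Lemma colon_hom J f d : f \is d.-homog -> hom_ideal J -> hom_ideal (colon J f).
Proof.
move=> fd [IJ HJ]; split; first exact: colon_ideal.
by move=> p k Jp; rewrite /colon -(pihomogM _ _ fd); apply: HJ.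
Qed.

Lemma addp_hom J f d : f \is d.-homog -> hom_ideal J -> hom_ideal (addp J f).
Proof.
move=> fd [IJ HJ]; split; first exact: addp_ideal.
move=> p k [g /(HJ _ k)]; rewrite raddfB /=.
have [le_dk|lt_kd] := leqP d k.
  by rewrite -{1 2}(subnK le_dk) (pihomogM _ _ fd) subnK // => H; exists (pihomog mdeg (k - d) g).
by rewrite (pihomogM_small _ fd lt_kd) => H; exists 0; rewrite mul0r.
Qed.

(** Multiplication by f identifies the quotients of the exact sequence
0 -> S/(J : f) -> S/J -> S/(J + f) -> 0. *)
Lemma hf_exact J f d k : hom_ideal J -> f \is d.-homog ->
  hf J (k + d) = (hf (colon J f) k + hf (addp J f) (k + d))%N.
Proof.
move=> [IJ HJ] fd; pose m := linfun (@mulh d (DHomog fd) k).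
have preE : (m @^-1: hpart J (k + d))%VS = hpart (colon J f) k.
  apply/vspaceP => v; apply/idP/idP => [|/(hpartP _ (colon_ideal f IJ)) H].
    by rewrite -memv_preim lfunE /= => /(hpartP _ IJ) H; apply/(hpartP _ (colon_ideal f IJ)).
  by rewrite -memv_preim lfunE; apply/(hpartP _ IJ).
have sumE : (hpart J (k + d) + limg m)%VS = hpart (addp J f) (k + d).
  apply/vspaceP => v; apply/idP/idP.
    case/memv_addP => u /(hpartP _ IJ) Ju [_ /memv_imgP [w _ ->] ->].
    apply/(hpartP _ (addp_ideal f IJ)); rewrite lfunE /=.
    by exists (mpoly_of_dhomog w); rewrite addrK.
  move/(hpartP _ (addp_ideal f IJ)) => [g Hg].
  have gd : pihomog mdeg k g \is k.-homog by apply: pihomogP.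
  apply/memv_addP; exists (v - m (DHomog gd)).
    apply/(hpartP _ IJ); rewrite raddfB /= lfunE /= -(pihomogM _ _ fd).
    rewrite -[X in X - _](pihomog_dE (dhomog_is_dhomog v)) -raddfB.
    exact: HJ.
  by exists (m (DHomog gd)); rewrite ?subrK // memv_img ?memvf.
by rewrite /hf -preE -sumE codim_preim_add.
Qed.

Lemma hf_add_small J f d k : hom_ideal J -> f \is d.-homog -> (k < d)%N ->
  hf J k = hf (addp J f) k.
Proof.
move=> [IJ HJ] fd lt_kd; rewrite /hf.
have -> // : hpart J k = hpart (addp J f) k.
apply/vspaceP => v; apply/idP/idP => [/(hpartP _ IJ) Jv|/(hpartP _ (addp_ideal f IJ)) [g /(HJ _ k)]].
  by apply/(hpartP _ (addp_ideal f IJ)); apply: addp_sub.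
rewrite raddfB /= (pihomogM_small _ fd lt_kd) subr0 pihomog_dE.
  by move=> Jv; apply/(hpartP _ IJ).
exact: dhomog_is_dhomog.
Qed.

End HilbertFunction.

(** * Krull dimension and the growth of Hilbert functions *)

Section Zeros.
Variables (K : closedFieldType) (n : nat).
Local Notation S := {mpoly K[n.+1]}.
Implicit Types (J : S -> Prop) (f g p : S) (v : 'rV[K]_n.+1).

Definition zeros J : set 'rV[K]_n.+1 :=
  [set v : 'rV[K]_n.+1 | v != 0 /\ forall f, J f -> f.@[v ord0] = 0].

Lemma hom_ideal_eval0 J v : ideal J ->
    (forall f d, J f -> f \is d.-homog -> f.@[v ord0] = 0) ->
    (forall f d, J f -> J (pihomog mdeg d f)) ->
  forall f, J f -> f.@[v ord0] = 0.
Proof.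
move=> IJ Jv HJ f Jf; rewrite (pihomog_partitionE (leqnn (msize f))) raddf_sum /=.
by rewrite big1 // => i _; apply: (Jv _ i); [apply: HJ|apply: pihomogP].
Qed.

Lemma zeros_closed J : hom_ideal J -> proj_closed (zeros J).
Proof.
move=> [IJ HJ]; exists [set f : S | J f /\ exists d, f \is d.-homog].
split=> [f [] //|]; apply/seteqP; split=> v /= [v0 H]; split=> // f.
  by case=> Jf _; apply: H.
by apply: hom_ideal_eval0 => // g d Jg gd; apply: H; split=> //; exists d.
Qed.

Lemma homog_eval0 f d v : f \is d.-homog -> (0 < d)%N -> v = 0 -> f.@[v ord0] = 0.
Proof.
move=> fd d0 ->; rewrite mevalE big_seq big1 // => m mf.
suff -> : \prod_i ((0 : 'rV[K]_n.+1) ord0 i) ^+ m i = 0 by rewrite mulr0.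
have [i mi] : exists i, m i != 0%N.
  by apply: exists_mnm_neq0; rewrite (dhomog_mf fd mf) -lt0n.
by rewrite (bigD1 i) //= mxE expr0n (negPf mi) mul0r.
Qed.

Definition homog_prime J :=
  forall f g d e, f \is d.-homog -> g \is e.-homog -> J (f * g) -> J f \/ J g.

Lemma homog_nullstellensatz J f d : uncountable_type K -> hom_ideal J ->
    homog_prime J -> f \is d.-homog ->
    (forall v, zeros J v -> f.@[v ord0] = 0) -> (0 < d)%N \/ zeros J !=set0 ->
  J f.
Proof.
move=> unc [IJ HJ] pJ fd Vf nd; apply: contrapT => nJf.
case: (IJ) => J0 JD JM.
have Jpow s : ~ J (f ^+ s).
  elim: s => [|s IHs].
    by rewrite expr0 => J1; apply: nJf; rewrite -[f]mulr1; apply: JM.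
  by rewrite exprS => /(pJ _ _ _ _ fd (dhomogMn _ fd)) [].
have [v Jv fv] := nullstellensatz unc IJ Jpow.
pose w : 'rV[K]_n.+1 := \row_i v i.
have wE h : h.@[w ord0] = h.@[v] by apply: meval_eq => i; rewrite mxE.
case/negP: fv; rewrite -wE; apply/eqP.
have [w0|w0] := eqVneq w 0; last first.
  by apply: Vf; split=> // h Jh; rewrite wE Jv.
case: (posnP d) => [d0|d_gt0]; last exact: homog_eval0 fd d_gt0 w0.
case: nd => [|[u Vu]]; first by rewrite d0.
have [c fc] := homog0_constant fd d0.
by have := Vf u Vu; rewrite fc !mevalC.
Qed.

(** Two forms, each separating the zero set from one of the closed sets, have a
product that vanishes on it. *)
Lemma zeros_irreducible J : uncountable_type K -> hom_ideal J -> homog_prime J ->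
  zeros J !=set0 -> irreducible_variety (zeros J).
Proof.
move=> unc HJ pJ V0; split=> //; first exact: zeros_closed.
move=> A B [SA [SAh ->]] [SB [SBh ->]] sub; apply: contrapT => /not_orP [nA nB].
have out (SX : set S) : (forall f, SX f -> exists d, f \is d.-homog) ->
    ~ (zeros J `<=` zero_locus SX) -> exists (f : S) d (v : 'rV[K]_n.+1),
    [/\ f \is d.-homog, SX f, zeros J v & f.@[v ord0] != 0].
  move=> SXh /existsNP [v /not_implyP [Vv nv]].
  apply: contrapT => no; apply: nv; case: (Vv) => v0 _; split=> // f Sf.
  have [d fd] := SXh f Sf; apply/eqP/negPn/negP => fv.
  by apply: no; exists f, d, v.
have [f [d [v [fd SAf Vv fv]]]] := out SA SAh nA.
have [g [e [w [ge SBg Vw gw]]]] := out SB SBh nB.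
have : J (f * g).
  apply: (homog_nullstellensatz unc HJ pJ (dhomogM fd ge)); last by right.
  move=> u Vu; rewrite mevalM; case: (sub u Vu) => -[_ H].
    by rewrite (H f SAf) mul0r.
  by rewrite (H g SBg) mulr0.
case/(pJ _ _ _ _ fd ge) => [Jf|Jg].
  by case/negP: fv; case: Vv => _ /(_ _ Jf) ->.
by case/negP: gw; case: Vw => _ /(_ _ Jg) ->.
Qed.

Lemma irreducible_chainS (T T' : set 'rV[K]_n.+1) d :
  T `<=` T' -> irreducible_chain T d -> irreducible_chain T' d.
Proof.
move=> sub [Z [Zirr Zlt]]; exists Z; split=> // i le_id.
by have [H1 H2] := Zirr i le_id; split=> // v /H2 /sub.
Qed.

Lemma irreducible_chain_cons (T T' : set 'rV[K]_n.+1) d :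
    irreducible_variety T' -> T `<=` T' -> ~ (T' `<=` T) ->
  irreducible_chain T d -> irreducible_chain T' d.+1.
Proof.
move=> T'irr sub nsub [Z [Zirr Zlt]].
exists (fun i => if (i <= d)%N then Z i else T'); split=> i le_i.
  have [le_id|lt_di] := leqP i d; last by split.
  by have [H1 H2] := Zirr i le_id; split=> // v /H2 /sub.
rewrite -ltnS le_i; have [lt_id|le_di] := ltnP i d; first exact: Zlt.
have -> : i = d by apply/eqP; rewrite eqn_leq le_di -ltnS le_i.
have [_ Zd] := Zirr d (leqnn d); split=> [v /Zd /sub //|H].
by apply: nsub => v /H /Zd.
Qed.

(** The Hilbert function is summed so that d bounds the dimension of the affine
cone and may be zero, for a finite-dimensional quotient. *)
Definition grows J d := exists C, forall k,
  (\sum_(j < k) hf J j <= C * k.+1 ^ d)%N.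

Lemma variables_hf_eq0 J k : hom_ideal J -> (forall i, J 'X_i) -> hf J k.+1 = 0%N.
Proof.
move=> [IJ HJ] JX; case: (IJ) => J0 JD JM; apply: hf_eq0 => // p pk.
rewrite (mpolyE p) big_seq; apply: ideal_sum => // m mp.
rewrite -mul_mpolyC; apply: (JM).
have [i mi] : exists i, m i != 0%N.
  by apply: exists_mnm_neq0; rewrite (dhomog_mf pk mp).
have /submK <- : (U_(i) <= m)%MM by rewrite lep1mP.
by rewrite mpolyXD; apply: JM.
Qed.

Lemma leq_sum_ord (a : nat -> nat) m k : (m <= k)%N ->
  (\sum_(j < m) a j <= \sum_(j < k) a j)%N.
Proof.
move=> /subnKC <-; elim: (k - m)%N => [|e IHe]; first by rewrite addn0.
by rewrite addnS big_ord_recr (leq_trans IHe) ?leq_addr.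
Qed.

Lemma sum_shift_le (a : nat -> nat) d k :
  (\sum_(j < k) (if (d <= j)%N then a (j - d)%N else 0) <= \sum_(j < k) a j)%N.
Proof.
suff -> : (\sum_(j < k) (if (d <= j)%N then a (j - d)%N else 0) =
   \sum_(j < k - d) a j)%N.
  exact: leq_sum_ord (leq_subr d k).
elim: k => [|k IHk]; first by rewrite !big_ord0.
rewrite big_ord_recr /= IHk; case: (leqP d k) => [le_dk|lt_kd].
  by rewrite subSn // big_ord_recr.
by rewrite addn0; have -> : (k.+1 - d = k - d)%N by lia.
Qed.

Lemma hf_split_le J f d j : hom_ideal J -> f \is d.-homog ->
  (hf J j <= (if (d <= j)%N then hf (colon J f) (j - d) else 0) + hf (addp J f) j)%N.
Proof.
move=> HJ fd; case: (leqP d j) => [le_dj|lt_jd].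
  by have := hf_exact (j - d) HJ fd; rewrite subnK // => ->.
by rewrite add0n (hf_add_small HJ fd lt_jd).
Qed.

(** An ideal that is not prime lies under two larger ideals whose zero sets
are no larger and whose Hilbert functions add up to an upper bound. *)
Lemma grows_reduce_prime d :
    (forall J, hom_ideal J -> homog_prime J -> ~ irreducible_chain (zeros J) d ->
       grows J d) ->
  forall J, hom_ideal J -> ~ irreducible_chain (zeros J) d -> grows J d.
Proof.
move=> Hprime J HJ; case: (HJ) => IJ _; move: J IJ HJ.
apply: (noetherian_ind (@noetherian_mpoly K n.+1)) => J IJ IH HJ nchain.
have [pJ|npJ] := pselect (homog_prime J); first exact: Hprime.
have [f [g [e1 [e2 [fa [gb [Jfg [nJf nJg]]]]]]]] : exists (f g : S) e1 e2,
    f \is e1.-homog /\ g \is e2.-homog /\ J (f * g) /\ ~ J f /\ ~ J g.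
  apply: contrapT => no; apply: npJ => f g e1 e2 fa gb Jfg.
  apply: contrapT => /not_orP [nJf nJg]; apply: no.
  by exists f, g, e1, e2.
case: (IJ) => J0 JD JM.
have up I : hom_ideal I -> (forall p, J p -> I p) -> (exists2 p, I p & ~ J p) ->
    grows I d.
  move=> HI sub ex; case: (HI) => II _; apply: IH => //.
  apply: contra_not nchain; apply: irreducible_chainS => v [v0 Iv].
  by split=> // p /sub /Iv.
have [C1 H1] : grows (colon J f) d.
  apply: up; first exact: colon_hom fa HJ.
    by move=> p Jp; rewrite /colon mulrC; apply: JM.
  by exists g => //; rewrite /colon mulrC.
have [C2 H2] : grows (addp J f) d.
  apply: up; first exact: addp_hom fa HJ.
    by move=> p; apply: addp_sub.
  by exists f => //; apply: addp_gen.
exists (C1 + C2)%N => k; rewrite mulnDl; apply: leq_trans (leq_add (H1 k) (H2 k)).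
apply: (@leq_trans (\sum_(j < k) ((if e1 <= j then hf (colon J f) (j - e1) else 0)
    + hf (addp J f) j))%N); first by apply: leq_sum => j _; apply: hf_split_le HJ fa.
rewrite big_split leq_add2r /=.
exact: (sum_shift_le (fun j => hf (colon J f) j)).
Qed.

Lemma grows_empty d J : uncountable_type K -> hom_ideal J -> homog_prime J ->
  ~ (zeros J !=set0) -> grows J d.
Proof.
move=> unc HJ pJ V0; exists (hf J 0) => k.
have JX i : J 'X_i.
  apply: (homog_nullstellensatz unc HJ pJ (d := 1)); last by left.
    by rewrite dhomogX /= mdeg1.
  by move=> v Vv; case: V0; exists v.
case: k => [|k]; first by rewrite big_ord0.
rewrite big_ord_recl big1 /= => [|j _]; last by rewrite variables_hf_eq0.
by rewrite addn0 leq_pmulr // expn_gt0.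
Qed.

(** The Hilbert function of a homogeneous ideal is controlled by the Krull
dimension of its zero set: for a prime ideal, cutting with a coordinate
hyperplane lowers both. *)
Theorem grows_of_dim d J : uncountable_type K -> hom_ideal J ->
  ~ irreducible_chain (zeros J) d -> grows J d.
Proof.
move=> unc; elim: d J => [|d IHd]; apply: grows_reduce_prime => J HJ pJ nchain.
  apply: grows_empty => // V0; apply: nchain; exists (fun _ => zeros J).
  by split=> // i _; split=> //; apply: zeros_irreducible.
have [V0|V0] := pselect (zeros J !=set0); last exact: grows_empty.
have [v [v0 Jv]] := V0; have [i vi] := elimT (rV0Pn v) v0.
have Xi : ('X_i : S) \is 1.-homog by exact: variable_homog.
have HJX := addp_hom Xi HJ.
have [C HC] : grows (addp J 'X_i) d.
  apply: IHd => //; apply: contra_not nchain; apply: irreducible_chain_cons.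
  - exact: zeros_irreducible.
  - by move=> w [w0 Jw]; split=> // p Jp; apply: Jw; apply: addp_sub.
  - move=> /(_ v (conj v0 Jv)) [_ /(_ 'X_i (addp_gen _ HJ.1))].
    by rewrite mevalXU => vi0; rewrite vi0 eqxx in vi.
have le_hf k : (hf J k <= \sum_(j < k.+1) hf (addp J 'X_i) j)%N.
  elim: k => [|k IHk].
    by rewrite big_ord_recr big_ord0 /= (hf_add_small HJ Xi).
  rewrite big_ord_recr /= -[in hf J _]addn1 (hf_exact _ HJ Xi) addn1 leq_add2r.
  apply: leq_trans IHk; apply: hf_sub; first by case: HJ.
    by apply: colon_ideal; case: HJ.
  move=> p _ Jp; rewrite /colon mulrC; case: HJ => -[_ _ JM] _; exact: JM.
exists C => k; apply: leq_trans (_ : (\sum_(j < k) C * k.+1 ^ d <= _)%N).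
  apply: leq_sum => j _; apply: leq_trans (le_hf j) (leq_trans (HC _) _).
  rewrite leq_mul2l; apply/orP; right.
  by case: (d) => // e; rewrite leq_exp2r // ltnS (ltn_ord j).
by rewrite sum_nat_const card_ord expnS mulnCA leq_mul2l leq_mul2r leqnSn !orbT.
Qed.

End Zeros.

(** * Vanishing ideals of projective varieties *)

Lemma uncountable_list (K : eqType) : uncountable_type K ->
  forall l : seq K, exists a, a \notin l.
Proof. by move=> unc l; have [a al] := unc (fun _ => l); exists a; apply: al 0%N. Qed.

Lemma uncountable_uniq (K : eqType) : uncountable_type K ->
  forall (l : seq K) m, exists s : seq K,
    [/\ uniq s, size s = m & forall a, a \in s -> a \notin l].
Proof.
move=> unc l; elim=> [|m [s [us sm sl]]]; first by exists [::].
have [a] := uncountable_list unc (s ++ l).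
rewrite mem_cat => /norP[as_ al]; exists (a :: s); split=> /= [||b].
- by rewrite as_.
- by rewrite sm.
- by rewrite inE => /orP[/eqP->//|/sl].
Qed.

Lemma poly_vanish (K : fieldType) (p : {poly K}) (l : seq K) :
  uncountable_type K -> (forall a, a \notin l -> p.[a] = 0) -> p = 0.
Proof.
move=> unc pl; apply/eqP/negPn/negP => p0.
have [s [us sm sl]] := uncountable_uniq unc l (size p).
have rs : all (root p) s by apply/allP => a /sl /pl pa; apply/eqP.
by have := max_poly_roots p0 rs us; rewrite sm ltnn.
Qed.

Section HomogeneousComponents.
Variables (K : fieldType) (n : nat).
Implicit Types (f g p : {mpoly K[n.+1]}).

Lemma pihomog_small k p : (msize p <= k)%N -> pihomog mdeg k p = 0.
Proof.
move=> le_p; rewrite pihomogE big_seq_cond big1 // => m /andP[mp /eqP mk].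
by have := msize_mdeg_lt mp; rewrite mk ltnNge le_p.
Qed.

Lemma msize_sub_top k p : (msize p <= k.+1)%N -> (msize (p - pihomog mdeg k p) <= k)%N.
Proof.
move=> le_p; rewrite {1}(pihomog_partitionE le_p) big_ord_recr /= addrK.
apply: leq_trans (msize_sum _ _ _) _; apply/bigmax_leqP => i _.
apply/bigmax_leqP_seq => m mp _; apply: leq_ltn_trans (ltn_ord i).
by rewrite (dhomog_mf (pihomogP mdeg i p) mp).
Qed.

Lemma pihomogM_top f g a b : (msize f <= a.+1)%N -> (msize g <= b.+1)%N ->
  pihomog mdeg (a + b)%N (f * g) = pihomog mdeg a f * pihomog mdeg b g.
Proof.
move=> fa gb; set t := pihomog mdeg b g.
have tb : t \is b.-homog by apply: pihomogP.
rewrite -[g](subrK t) mulrDr raddfD /= (pihomogM _ _ tb).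
suff -> : pihomog mdeg (a + b)%N (f * (g - t)) = 0 by rewrite add0r.
have [->|f0] := eqVneq f 0; first by rewrite mul0r raddf0.
have [->|g0] := eqVneq (g - t) 0; first by rewrite mulr0 raddf0.
apply: pihomog_small; rewrite msizeM //; have := msize_sub_top gb; rewrite -/t.
by move: fa; move: (msize f) (msize (g - t)) => x y; lia.
Qed.

Lemma meval_homog f d (c : K) (v : 'I_n.+1 -> K) : f \is d.-homog ->
  f.@[fun i => c * v i] = c ^+ d * f.@[v].
Proof.
move=> fd; rewrite !mevalE mulr_sumr [LHS]big_seq [RHS]big_seq.
apply: eq_bigr => m mf; rewrite mulrCA; congr (_ * _).
under eq_bigr do rewrite exprMn.
by rewrite big_split /= prodrXr -mdegE (dhomog_mf fd mf).
Qed.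

End HomogeneousComponents.

Section Vanishing.
Variables (K : closedFieldType) (n : nat).
Hypothesis unc : uncountable_type K.
Local Notation S := {mpoly K[n.+1]}.
Implicit Types (T : set 'rV[K]_n.+1) (J : S -> Prop) (f g p : S).

Definition van T : S -> Prop := fun f => forall v, T v -> f.@[v ord0] = 0.

Lemma proj_closed_cone T v c : proj_closed T -> T v -> c != 0 -> T (c *: v).
Proof.
move=> [SX [SXh ->]] [v0 Hv] c0; split; first by rewrite scaler_eq0 negb_or c0.
move=> f Sf; have [d fd] := SXh f Sf.
rewrite (@meval_eq _ _ _ (fun i => c * v ord0 i)); last by move=> i; rewrite mxE.
by rewrite (meval_homog _ _ fd) Hv ?mulr0.
Qed.

Lemma van_ideal T : ideal (van T).
Proof.
split=> [v _|f g Hf Hg v Tv|a f Hf v Tv]; first by rewrite meval0.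
  by rewrite mevalD Hf // Hg // addr0.
by rewrite mevalM Hf // mulr0.
Qed.

(** The values of f on a line through the origin, which lies in the cone, form a
polynomial whose coefficients are the values of the homogeneous components. *)
Lemma van_hom T : proj_closed T -> hom_ideal (van T).
Proof.
move=> cT; split=> [|f d Hf v Tv]; first exact: van_ideal.
have [lt_d|le_d] := ltnP d (msize f); last by rewrite pihomog_small ?meval0.
pose q : {poly K} := \poly_(i < msize f) (pihomog mdeg i f).@[v ord0].
suff q0 : q = 0.
  by have := congr1 (fun p : {poly K} => p`_d) q0; rewrite coef_poly lt_d coef0.
apply: (@poly_vanish _ _ [:: 0]) => // c; rewrite inE => c0.
have := Hf _ (proj_closed_cone cT Tv c0).
rewrite {1}(pihomog_partitionE (leqnn (msize f))) raddf_sum horner_poly => fc0.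
rewrite -[RHS]fc0; apply: eq_bigr => i _; rewrite mulrC.
rewrite -(meval_homog c (v ord0) (pihomogP mdeg i f)).
by apply: meval_eq => j; rewrite mxE.
Qed.

Lemma zeros_van T : proj_closed T -> zeros (van T) = T.
Proof.
move=> [SX [SXh TE]]; apply/seteqP; split=> v.
  move=> [v0 Hv]; rewrite TE; split=> // f Sf; apply: Hv => w.
  by rewrite TE => -[_]; apply.
move=> Tv; split=> [|f]; last exact.
by move: Tv; rewrite TE => -[].
Qed.

(** The top forms of two polynomials are removed one at a time. *)
Lemma homog_prime_prime J : hom_ideal J -> homog_prime J -> prime_ideal J.
Proof.
move=> [IJ HJ] pJ f g; have [m] := ubnP (msize f + msize g).
elim: m f g => // m IHm f g /ltnSE le_m Jfg.
have [->|f0] := eqVneq f 0; first by left; case: IJ.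
have [->|g0] := eqVneq g 0; first by right; case: IJ.
pose a := (msize f).-1; pose b := (msize g).-1.
have fa : (msize f <= a.+1)%N by rewrite /a -mpolySpred.
have gb : (msize g <= b.+1)%N by rewrite /b -mpolySpred.
have lt_a : (a < msize f)%N by rewrite /a -mpolySpred.
have lt_b : (b < msize g)%N by rewrite /b -mpolySpred.
have := HJ _ (a + b)%N Jfg; rewrite pihomogM_top //.
case/(pJ _ _ _ _ (pihomogP mdeg a f) (pihomogP mdeg b g)) => Jt.
  case: (IHm (f - pihomog mdeg a f) g).
  - apply: leq_trans le_m; rewrite ltn_add2r; apply: leq_ltn_trans lt_a.
    exact: msize_sub_top.
  - rewrite mulrBl; apply: idealB => //; rewrite mulrC.
    by case: IJ => _ _ JM; apply: JM.
  - move=> H; left; rewrite -[f](subrK (pihomog mdeg a f)).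
    by case: IJ => _ JD _; apply: JD.
  - by right.
case: (IHm f (g - pihomog mdeg b g)).
- apply: leq_trans le_m; rewrite ltn_add2l; apply: leq_ltn_trans lt_b.
  exact: msize_sub_top.
- rewrite mulrBr; apply: idealB => //.
  by case: IJ => _ _ JM; apply: JM.
- by left.
- move=> H; right; rewrite -[g](subrK (pihomog mdeg b g)).
  by case: IJ => _ JD _; apply: JD.
Qed.

Lemma van_prime T : irreducible_variety T -> prime_ideal (van T).
Proof.
move=> [cT _ irrT]; apply: homog_prime_prime; first exact: van_hom.
move=> f g d e fd ge Tfg; pose Z (h : S) := zero_locus [set h].
have Zclosed h k : h \is k.-homog -> proj_closed (Z h).
  by move=> hk; exists [set h]; split=> // _ ->; exists k.
have T0 v : T v -> v != 0 by case: cT => SX [_ ->] [].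
case: (irrT (Z f) (Z g)); [exact: Zclosed fd|exact: Zclosed ge| | |].
- move=> v Tv; have /eqP := Tfg v Tv; rewrite mevalM mulf_eq0.
  by case/orP => /eqP H; [left|right]; split; rewrite ?T0 // => _ ->.
- by move=> H; left => v /H [_]; apply.
- by move=> H; right => v /H [_]; apply.
Qed.

Lemma hilbert_functionE T k N : hilbert_function T k N -> N = hf (van T) k.
Proof.
move=> [U [UP dU]]; rewrite /hf.
have <- : U = hpart (van T) k; last by rewrite /codim -dU addnK.
apply/vspaceP => f; apply/idP/idP => [/UP H|/(hpartP _ (van_ideal T)) H].
  exact/(hpartP _ (van_ideal T)).
exact/UP.
Qed.

Lemma van_separate T T' : proj_closed T -> proj_closed T' -> ~ (T' `<=` T) ->
  exists f d, [/\ f \is d.-homog, van T f & ~ van T' f].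
Proof.
move=> [SX [SXh ->]] [SX' [_ T'E]] /existsNP [v /not_implyP [T'v nTv]].
apply: contrapT => no; apply: nTv; split; first by move: T'v; rewrite T'E => -[].
move=> f Sf; have [d fd] := SXh f Sf; apply: contrapT => fv; apply: no.
exists f, d; split=> //; first by move=> w [_]; apply.
by move=> /(_ v T'v).
Qed.

Lemma hf_van_gt0 T k : T !=set0 -> proj_closed T -> (0 < hf (van T) k)%N.
Proof.
move=> [v Tv] cT; have v0 : v != 0 by case: cT Tv => SX [_ ->] [].
have [i vi] := elimT (rV0Pn v) v0.
rewrite /hf /codim subn_gt0 ltn_neqAle dimvS ?subvf // andbT.
apply/negP => /eqP E; have : hpart (van T) k == fullv by rewrite eqEdim subvf E leqnn.
move=> /eqP full; have Xk : ('X_i ^+ k : S) \is k.-homog.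
  by have := dhomogMn k (variable_homog K i); rewrite mul1n.
have : DHomog Xk \in hpart (van T) k by rewrite full memvf.
move=> /(hpartP _ (van_ideal T)) /= /(_ v Tv); rewrite rmorphXn /= mevalXU => /eqP.
by rewrite expf_eq0 (negPf vi) andbF.
Qed.

(** A form that vanishes on Z but not on T is a nonzerodivisor modulo the ideal of
T; the exact sequences given by its powers, of degrees d * e, compare the two
Hilbert functions. *)
Lemma hf_van_step T Z : irreducible_variety T -> proj_closed Z -> Z `<=` T ->
    ~ (T `<=` Z) -> Z !=set0 ->
  exists2 d, (0 < d)%N & forall e k, (0 < e)%N ->
    (hf (van T) k + hf (van Z) (k + d * e) <= hf (van T) (k + d * e))%N.
Proof.
move=> irrT cZ ZT nTZ [z Zz]; have [cT _ _] := irrT.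
have [f [d [fd Zf nTf]]] := van_separate cZ cT nTZ.
exists d => [|e k e0].
  case: (posnP d) => // d0; case: nTf => v Tv.
  have [c fc] := homog0_constant fd d0.
  by have := Zf z Zz; rewrite fc !mevalC.
have HT := van_hom cT; have pT := van_prime irrT.
have fe : f ^+ e \is (d * e).-homog by apply: dhomogMn.
have nTfe : ~ van T (f ^+ e).
  case: e e0 fe => // e _ _; elim: e => [|e IHe]; first by rewrite expr1.
  by rewrite exprS => /pT [].
rewrite (hf_exact _ HT fe); apply: leq_add.
  apply: hf_sub; [exact/colon_ideal/van_ideal|exact: van_ideal|].
  by move=> p _ /pT [].
apply: hf_sub; [exact/addp_ideal/van_ideal|exact: van_ideal|].
move=> p _ [g H] v Zv; have := H v (ZT v Zv); rewrite mevalB mevalM rmorphXn /=.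
by rewrite Zf // expr0n gtn_eqF // mulr0 subr0.
Qed.

(** Each of the two inclusions of the chain contributes one degree of growth. *)
Lemma hf_van_lower T : irreducible_variety T -> irreducible_chain T 2 ->
  exists M k0, forall k, (k0 <= k)%N -> (k ^ 2 <= M * hf (van T) k)%N.
Proof.
move=> irrT [Z [Zirr Zlt]].
have [irr0 _] := Zirr 0%N isT; have [irr1 _] := Zirr 1%N isT.
have [irr2 Z2T] := Zirr 2%N isT.
have [Z01 nZ10] := Zlt 0%N isT; have [Z12 nZ21] := Zlt 1%N isT.
have [d1 d1_gt0 H1] : exists2 d, (0 < d)%N & forall e k, (0 < e)%N ->
  (hf (van (Z 1)) k + hf (van (Z 0)) (k + d * e) <= hf (van (Z 1)) (k + d * e))%N.
  by apply: hf_van_step => //; [case: irr0|case: irr0].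
have [d2 d2_gt0 H2] : exists2 d, (0 < d)%N & forall e k, (0 < e)%N ->
  (hf (van (Z 2)) k + hf (van (Z 1)) (k + d * e) <= hf (van (Z 2)) (k + d * e))%N.
  by apply: hf_van_step => //; [case: irr1|case: irr1].
pose d := (d1 * d2)%N; have d_gt0 : (0 < d)%N by rewrite muln_gt0 d1_gt0.
have L1 j r : (j <= hf (van (Z 1)) (r + j * d))%N.
  elim: j => // j IHj; have := H1 d2 (r + j * d)%N d2_gt0.
  rewrite -addnA -mulSnr -/d; apply: leq_trans; rewrite -addn1; apply: leq_add => //.
  by apply: hf_van_gt0; case: irr0.
have L2 j r : (j * j.+1 <= 2 * hf (van (Z 2)) (r + j * d))%N.
  elim: j => // j IHj; have := H2 d1 (r + j * d)%N d1_gt0.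
  rewrite [(d2 * d1)%N]mulnC -/d -addnA -mulSnr; have := L1 j.+1 r.
  move: (hf _ _) (hf _ _) (hf _ _) IHj => x y z; nia.
exists (4 * d ^ 2)%N, d => k le_dk.
have le_hf : (hf (van (Z 2)) k <= hf (van T) k)%N.
  apply: hf_sub; [exact: van_ideal|exact: van_ideal|].
  by move=> p _ Tp v /Z2T /Tp.
apply: leq_trans (_ : 4 * d ^ 2 * hf (van (Z 2)) k <= _)%N; last by rewrite leq_mul2l le_hf orbT.
have := L2 (k %/ d)%N (k %% d)%N; rewrite addnC -divn_eq.
have := divn_eq k d; have := ltn_pmod k d_gt0.
have : (0 < k %/ d)%N by rewrite divn_gt0.
move: (k %/ d)%N (k %% d)%N (hf _ _) => j r h j0 lt_r kE Hh.
have le_k : (k <= d * j.+1)%N by rewrite kE; nia.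
apply: leq_trans (_ : (d * j.+1) ^ 2 <= _)%N; first by rewrite leq_exp2r.
rewrite expnMn -mulnA [(4 * _)%N]mulnCA leq_mul2l; apply/orP; right.
by nia.
Qed.

End Vanishing.

(** * Degree as a bound for the Hilbert function *)

Section PolyGrowth.
Implicit Types q : {poly rat}.

Definition coef_norm q : rat := \sum_(i < size q) `|q`_i|.

Lemma horner_lead_approx q s k : (size q <= s.+2)%N -> (0 < k)%N ->
  `|q.[k%:R] - q`_s.+1 * k%:R ^+ s.+1| <= coef_norm q * k%:R ^+ s.
Proof.
move=> szq k0; have k1 : 1 <= k%:R :> rat by rewrite ler1n.
have -> : q.[k%:R] - q`_s.+1 * k%:R ^+ s.+1 = \sum_(i < s.+1) q`_i * k%:R ^+ i.
  by rewrite (horner_coef_wide _ szq) big_ord_recr /= addrK.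
apply: le_trans (ler_norm_sum _ _ _) _.
have -> : coef_norm q = \sum_(i < s.+2) `|q`_i|.
  rewrite /coef_norm (big_ord_widen_cond _ xpredT (fun i => `|q`_i|) szq).
  rewrite [RHS](bigID (fun i : 'I_s.+2 => (i < size q)%N)) /= [X in _ + X]big1 ?addr0 //.
  by move=> i; rewrite -leqNgt => le_i; rewrite nth_default ?normr0.
rewrite [in leRHS]big_ord_recr /= mulrDl mulr_suml -[leLHS]addr0; apply: lerD; last first.
  by rewrite mulr_ge0 ?exprn_ge0 ?ler0n.
apply: ler_sum => i _; rewrite normrM ler_wpM2l // ger0_norm ?exprn_ge0 ?ler0n //.
by rewrite ler_weXn2l // -ltnS.
Qed.

Lemma nat_above (x : rat) : exists k0 : nat, forall k, (k0 <= k)%N -> x < k%:R.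
Proof.
exists (Num.bound `|x|) => k le_k; apply: le_lt_trans (ler_norm x) _.
by apply: lt_le_trans (archi_boundP (normr_ge0 x)) _; rewrite ler_nat.
Qed.

Lemma poly_lower q s : (size q = s.+2)%N -> 0 < lead_coef q ->
  exists k0 : nat, forall k, (k0 <= k)%N ->
    lead_coef q / 2 * k%:R ^+ s.+1 <= q.[k%:R].
Proof.
move=> szq lq; have [k0 k0P] := nat_above (2 * coef_norm q / lead_coef q).
exists k0.+1 => k lt_k; have k_gt0 : (0 < k)%N by apply: leq_ltn_trans lt_k.
have := horner_lead_approx (eq_leq szq) k_gt0.
have lE : lead_coef q = q`_s.+1 by rewrite lead_coefE szq.
rewrite -lE ler_norml => /andP[H _].
have kb : coef_norm q <= lead_coef q / 2 * k%:R.
  by have := k0P k (ltnW lt_k); rewrite ltr_pdivrMr // => H'; lra.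
have ks : 0 <= k%:R ^+ s :> rat by rewrite exprn_ge0 ?ler0n.
have := ler_wpM2r ks kb.
move: H; rewrite exprS; move: (lead_coef q) (k%:R ^+ s : rat) (coef_norm q) (q.[_]) => a b c d.
by lra.
Qed.

End PolyGrowth.

Lemma sum_ord_cat_le (a : nat -> nat) k :
  (\sum_(j < k) a (k + j) <= \sum_(j < k + k) a j)%N.
Proof. by rewrite big_split_ord /= leq_addl. Qed.

Section DegreeBound.
Variables (K : closedFieldType) (n : nat).
Hypothesis unc : uncountable_type K.

(** Krull dimension at most two bounds the degree of the Hilbert polynomial, and the
degree of the variety its leading coefficient. *)
Lemma hf_van_upper (T : set 'rV[K]_n.+1) D : proj_closed T ->
    ~ irreducible_chain T 3 -> variety_degree T D ->
  exists k0, forall k, (k0 <= k)%N -> (hf (van T) k <= D.+1 * k ^ 2)%N.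
Proof.
move=> cT nchain [q [[k1 qP] DE]].
have qhf k : (k1 <= k)%N -> (hf (van T) k)%:R = q.[k%:R].
  by move=> /qP [N [/(hilbert_functionE) <- ->]].
have [C HC] : grows (van T) 3.
  by apply: grows_of_dim => //; [exact: van_hom|rewrite zeros_van].
have lq0 : 0 <= lead_coef q.
  have : 0 <= ((size q).-1)`!%:R * lead_coef q by rewrite -DE ler0n.
  by rewrite pmulr_rge0 // ltr0n fact_gt0.
have szq : (size q <= 3)%N.
  rewrite leqNgt; apply/negP => lt3.
  have szE : size q = ((size q).-2).+2 by rewrite -subn2; lia.
  have lq : 0 < lead_coef q.
    by rewrite lt_neqAle eq_sym lead_coef_eq0 lq0 -size_poly_gt0 szE.
  have [k2 k2P] := poly_lower szE lq.
  have [k3 k3P] := nat_above (54 * C%:R / lead_coef q).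
  pose k := (k1 + k2 + k3).+1.
  have big j : ((lead_coef q / 2) * k%:R ^+ 3 <= (hf (van T) (k + j))%:R).
    rewrite qhf; last by rewrite /k; lia.
    apply: le_trans (k2P (k + j)%N _); last by rewrite /k; lia.
    rewrite ler_wpM2l ?divr_ge0 //.
    apply: le_trans (_ : k%:R ^+ (size q).-2.+1 <= _); last first.
      by rewrite lerXn2r ?nnegrE ?ler0n // ler_nat leq_addr.
    by rewrite ler_weXn2l ?ler1n //; move: lt3; rewrite {1}szE.
  have := leq_trans (sum_ord_cat_le (hf (van T)) k) (HC (k + k)%N).
  rewrite -(ler_nat rat) natr_sum natrM natrX => Hle.
  have : k%:R * ((lead_coef q / 2) * k%:R ^+ 3) <= \sum_(i < k) (hf (van T) (k + i))%:R.
    rewrite mulr_natl -[X in _ *+ X]card_ord -sumr_const.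
    by apply: ler_sum => i _; apply: big.
  move=> /le_trans /(_ Hle).
  have : (k + k).+1%:R <= 3 * k%:R :> rat by rewrite -natrM ler_nat /k; lia.
  have kpos : 0 < k%:R :> rat by rewrite ltr0n.
  have := k3P k; rewrite ltr_pdivrMr // => /(_ _) H4.
  have {}H4 : 54 * C%:R < k%:R * lead_coef q by apply: H4; rewrite /k; lia.
  move=> H5 H6; have H7 : (k + k).+1%:R ^+ 3 <= (3 * k%:R) ^+ 3 :> rat.
    by rewrite lerXn2r // nnegrE ?mulr_ge0 ?ler0n.
  have := ler_wpM2l (ler0n rat C) H7.
  have -> : (3 * k%:R) ^+ 3 = 27 * k%:R ^+ 3 :> rat by ring.
  have : 0 < (k%:R * lead_coef q - 54 * C%:R) * k%:R ^+ 3.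
    by rewrite mulr_gt0 ?exprn_gt0 ?subr_gt0.
  move: H6; move: (k%:R ^+ 3 : rat) ((k + k).+1%:R ^+ 3 : rat) => a b.
  by lra.
have q2 : q`_2 <= D%:R.
  have [sz|sz] := eqVneq (size q) 3%N.
    by rewrite DE lead_coefE sz /= !factS fact0; move: lq0; rewrite lead_coefE sz /=; lra.
  by rewrite nth_default ?ler0n // -ltnS ltn_neqAle sz.
have [k2 k2P] := nat_above (coef_norm q).
exists (k1 + k2).+1 => k lt_k; have k_gt0 : (0 < k)%N by lia.
rewrite -(ler_nat rat) qhf; last by lia.
have := horner_lead_approx szq k_gt0; rewrite ler_norml => /andP[_].
have := ltW (k2P k (_ : (k2 <= k)%N)); rewrite natrM natrX -natr1.
have kpos : 0 < k%:R :> rat by rewrite ltr0n.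
move=> H1 H2; have {}H1 : coef_norm q <= k%:R by apply: H1; lia.
have H3 := ler_wpM2r (exprn_ge0 2 (ltW kpos)) q2.
have H4 := ler_wpM2r (ltW kpos) H1.
by move: H2 H3 H4; rewrite expr1 expr2; move: (q.[_]) (q`_2) => a b; nra.
Qed.

End DegreeBound.

(** * Equations of a point moving on a family of lines *)

Section Composition.
Variables (K : fieldType).

Lemma comp_homog n m (t : m.-tuple {mpoly K[n]}) d (f : {mpoly K[m]}) k :
    (forall i, tnth t i \is d.-homog) -> f \is k.-homog ->
  f \mPo t \is (d * k).-homog.
Proof.
move=> td fk; rewrite comp_mpolyE big_seq; apply: rpred_sum => mo mf.
apply: rpredZ; rewrite -(dhomog_mf fk mf) /= mdegE big_distrr /=.
elim/big_rec2: _ => [|i p q _ IH]; first by rewrite dhomog1.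
by rewrite mulnC; apply: dhomogM => //; rewrite mulnC; apply: dhomogMn.
Qed.

Lemma pihomog_comp n m (t : m.+1.-tuple {mpoly K[n.+1]}) (f : {mpoly K[m.+1]}) k :
    (forall i, tnth t i \is 1.-homog) ->
  pihomog mdeg k (f \mPo t) = pihomog mdeg k f \mPo t.
Proof.
move=> t1; have th g e : g \is e.-homog -> g \mPo t \is e.-homog.
  by move=> /(comp_homog t1); rewrite mul1n.
have compS N (F : 'I_N -> {mpoly K[m.+1]}) :
    (\sum_i F i) \mPo t = \sum_i (F i \mPo t) by exact: raddf_sum.
have [lt_k|le_k] := ltnP k (msize f); last first.
  rewrite (pihomog_small le_k) comp_mpoly0.
  rewrite {1}(pihomog_partitionE (leqnn (msize f))) compS raddf_sum /= big1 // => i _.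
  apply: (@pihomog_ne0 _ _ mdeg i); last by apply: th; apply: pihomogP.
  by rewrite ltn_eqF // (leq_trans (ltn_ord i)).
rewrite {1}(pihomog_partitionE (leqnn (msize f))) compS raddf_sum /=.
rewrite (bigD1 (Ordinal lt_k)) //= big1 ?addr0 => [|i ne].
  by apply: pihomog_dE; apply: th; apply: pihomogP.
by apply: (@pihomog_ne0 _ _ mdeg i) => //; apply: th; apply: pihomogP.
Qed.

Definition comph n m d (t : m.+1.-tuple {mpoly K[n.+1]})
    (td : forall i, tnth t i \is d.-homog) k (f : dhomog m.+1 K k) :
    dhomog n.+1 K (d * k) :=
  DHomog (comp_homog td (dhomog_is_dhomog f)).

Lemma comph_is_linear n m d t td k : linear (@comph n m d t td k).
Proof.
by move=> a u v; apply: val_inj; rewrite /= comp_mpolyD comp_mpolyZ.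
Qed.

HB.instance Definition _ n m d t td k :=
  GRing.isLinear.Build K (dhomog m.+1 K k) (dhomog n.+1 K (d * k)) _
    (@comph n m d t td k) (@comph_is_linear n m d t td k).

(** Substituting forms into forms can only increase Hilbert functions. *)
Lemma hf_comp_le n m d (t : m.+1.-tuple {mpoly K[n.+1]})
    (I : {mpoly K[m.+1]} -> Prop) (J : {mpoly K[n.+1]} -> Prop) k :
    (forall i, tnth t i \is d.-homog) -> ideal I -> ideal J ->
    (forall f, f \is k.-homog -> J (f \mPo t) -> I f) ->
  (hf I k <= hf J (d * k))%N.
Proof.
move=> td II IJ H; rewrite /hf.
pose c := linfun (@comph n m d t td k).
apply: leq_trans (_ : codim (c @^-1: hpart J (d * k))%VS <= _)%N; last first.
  by rewrite -(codim_preim_add c) leq_addr.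
apply: codimS; apply/subvP => f; rewrite -memv_preim lfunE => /(hpartP _ IJ) Jf.
by apply/(hpartP _ II); apply: H => //; apply: dhomog_is_dhomog.
Qed.

Definition line_poly m (h : 'I_m -> {poly K}) (f : {mpoly K[m]}) : {poly K} :=
  mmap (@polyC K) h f.

Lemma line_polyC m h c : @line_poly m h c%:MP = c%:P.
Proof. by rewrite /line_poly mmapC. Qed.
Lemma line_polyX m h i : @line_poly m h 'X_i = h i.
Proof. by rewrite /line_poly mmapX mmap1U. Qed.
Lemma line_polyD m h : {morph @line_poly m h : f g / f + g}.
Proof. by move=> f g; rewrite /line_poly mmapD. Qed.
Lemma line_polyM m h : {morph @line_poly m h : f g / f * g}.
Proof. by move=> f g; rewrite /line_poly rmorphM. Qed.

Lemma horner_line_poly m h (f : {mpoly K[m]}) z :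
  (line_poly h f).[z] = f.@[fun i => (h i).[z]].
Proof.
elim/mpoly_ring_ind: f => [c|i|f g IHf IHg|f g IHf IHg].
- by rewrite line_polyC hornerC mevalC.
- by rewrite line_polyX mevalXU.
- by rewrite line_polyD hornerD IHf IHg mevalD.
- by rewrite line_polyM hornerM IHf IHg mevalM.
Qed.

Lemma deriv_line_poly m h (f : {mpoly K[m]}) :
  (line_poly h f)^`() = \sum_i line_poly h f^`M(i) * (h i)^`().
Proof.
elim/mpoly_ring_ind: f => [c|j|f g IHf IHg|f g IHf IHg].
- rewrite line_polyC derivC big1 // => i _.
  by rewrite mderivC -mpolyC0 line_polyC polyC0 mul0r.
- rewrite line_polyX (bigD1 j) //= big1 ?addr0 => [|i ne].
    rewrite mderivX mnm1E eqxx scale1r.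
    rewrite (_ : (U_(j) - U_(j))%MM = 0%MM); last first.
      by apply/mnmP => e; rewrite mnmBE subnn mnm0E.
    by rewrite mpolyX0 -mpolyC1 line_polyC mul1r.
  by rewrite mderivX mnm1E eq_sym (negPf ne) scale0r -mpolyC0 line_polyC mul0r.
- rewrite line_polyD derivD IHf IHg -big_split; apply: eq_bigr => i _.
  by rewrite mderivD line_polyD mulrDl.
- rewrite line_polyM derivM IHf IHg mulr_suml mulr_sumr -big_split /=.
  apply: eq_bigr => i _; rewrite mderivM line_polyD !line_polyM; ring.
Qed.

Lemma size_line_poly m (h : 'I_m -> {poly K}) (f : {mpoly K[m]}) k :
  (forall i, size (h i) <= 2)%N -> f \is k.-homog -> (size (line_poly h f) <= k.+1)%N.
Proof.
move=> h2 fk; rewrite /line_poly /mmap big_seq.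
apply: (leq_trans (size_sum _ _ _)); apply/bigmax_leqP_seq => mo _ mf.
rewrite mul_polyC; apply: (leq_trans (size_scale_leq _ _)).
rewrite /mmap1 -(dhomog_mf fk mf) /= mdegE.
elim/big_rec2: _ => [|i d p _ IH]; first by rewrite size_poly1.
have hi : (size (h i ^+ mo i) <= (mo i).+1)%N.
  elim: (mo i) => [|e IHe]; first by rewrite expr0 size_poly1.
  rewrite exprS; apply: (leq_trans (size_polyMleq _ _)).
  have := h2 i; move: (size (h i)) (size (h i ^+ e)) IHe => a b; lia.
apply: (leq_trans (size_polyMleq _ _)).
by move: IH hi; move: (size (h i ^+ mo i)) (size p) => a b; lia.
Qed.

End Composition.

Section Relations.
Variables (K : closedFieldType) (n m : nat).
Hypothesis unc : uncountable_type K.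
Variable T : set 'rV[K]_n.+1.
Variables a b : m.+1.-tuple {mpoly K[n.+1]}.
Hypothesis irrT : irreducible_variety T.
Hypothesis a1 : forall i, tnth a i \is 1.-homog.
Hypothesis b1 : forall i, tnth b i \is 1.-homog.
Local Notation S := {mpoly K[m.+1]}.

(** The point of parameter z on the line that joins the images of v under the
linear maps a and b. *)
Definition pt (z : K) (v : 'rV[K]_n.+1) (i : 'I_m.+1) : K :=
  (tnth a i).@[v ord0] + z * (tnth b i).@[v ord0].

Definition rels : S -> Prop := fun f => forall v z, T v -> f.@[pt z v] = 0.

Definition subst z : m.+1.-tuple {mpoly K[n.+1]} :=
  [tuple tnth a i + z *: tnth b i | i < m.+1].

Lemma subst1 z i : tnth (subst z) i \is 1.-homog.
Proof. by rewrite tnth_mktuple; apply: dhomogD => //; apply: dhomogZ. Qed.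

Lemma meval_subst z f (v : 'rV[K]_n.+1) : (f \mPo subst z).@[v ord0] = f.@[pt z v].
Proof.
rewrite comp_mpoly_meval; apply: meval_eq => i.
by rewrite tnth_mktuple mevalD mevalZ.
Qed.

Lemma relE f : rels f <-> forall z, van T (f \mPo subst z).
Proof.
by split=> H; [move=> z v Tv; rewrite meval_subst H|move=> v z Tv; rewrite -meval_subst H].
Qed.

Lemma rel_ideal : ideal rels.
Proof.
split=> [v z _|f g Hf Hg v z Tv|f g Hg v z Tv]; first by rewrite meval0.
  by rewrite mevalD Hf // Hg // addr0.
by rewrite mevalM Hg // mulr0.
Qed.

Lemma rel_hom : hom_ideal rels.
Proof.
split=> [|f d /relE Hf]; first exact: rel_ideal.
have [cT _ _] := irrT; apply/relE => z.
by rewrite -pihomog_comp; [apply: (van_hom unc cT).2|apply: subst1].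
Qed.

Definition pt_poly (v : 'rV[K]_n.+1) (i : 'I_m.+1) : {poly K} :=
  ((tnth a i).@[v ord0])%:P + ((tnth b i).@[v ord0])%:P * 'X.

Lemma horner_pt_poly v f z : (line_poly (pt_poly v) f).[z] = f.@[pt z v].
Proof.
rewrite horner_line_poly; apply: meval_eq => i.
by rewrite /pt_poly hornerD hornerM !hornerC hornerX mulrC.
Qed.

Lemma size_pt_poly v i : (size (pt_poly v i) <= 2)%N.
Proof.
apply: (leq_trans (size_polyD _ _)); rewrite geq_max; apply/andP; split.
  by rewrite size_polyC; case: (_ != 0).
by rewrite mul_polyC (leq_trans (size_scale_leq _ _)) // size_polyX.
Qed.

Lemma rel_line_poly f v : rels f -> T v -> line_poly (pt_poly v) f = 0.
Proof.
move=> Rf Tv; apply: (@poly_vanish _ _ [::]) => // z _.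
by rewrite horner_pt_poly Rf.
Qed.

(** Given two polynomials that are not relations, some parameter z witnesses both
at once; at that parameter the claim is the primality of the ideal of T. *)
Lemma rel_prime : prime_ideal rels.
Proof.
have nrel f : ~ rels f -> exists2 v, T v & line_poly (pt_poly v) f != 0.
  move=> nf; apply: contrapT => no; apply: nf => v z Tv.
  rewrite -horner_pt_poly; have [->|f0] := eqVneq (line_poly (pt_poly v) f) 0.
    by rewrite horner0.
  by case: no; exists v.
move=> f g Rfg; apply: contrapT => /not_orP [/nrel [v Tv fv] /nrel [w Tw gw]].
have [z] : exists z, (line_poly (pt_poly v) f * line_poly (pt_poly w) g).[z] != 0.
  apply: contrapT => no; case/negP: (mulf_neq0 fv gw); apply/eqP.
  apply: (@poly_vanish _ _ [::]) => // z _.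
  by apply/eqP/negPn/negP => H; apply: no; exists z.
rewrite hornerM !horner_pt_poly mulf_eq0 negb_or => /andP[fz gz].
have := (relE _).1 Rfg z; rewrite rmorphM /=.
case/(van_prime unc irrT) => [/(_ v Tv)|/(_ w Tw)]; rewrite meval_subst => H.
  by rewrite H eqxx in fz.
by rewrite H eqxx in gz.
Qed.

(** A form of degree k in the coordinates of a moving point is a polynomial of
degree k in the parameter, so that k.+1 parameters detect its vanishing. *)
Lemma hf_rel_le k : (hf rels k <= k.+1 * hf (van T) k)%N.
Proof.
have [s [us ss _]] := uncountable_uniq unc [::] k.+1.
have IT := van_ideal T.
have [U [cU UP]] : exists U : {vspace dhomog m.+1 K k},
    (codim U <= size s * hf (van T) k)%N /\
    forall f, f \in U -> forall z, z \in s -> van T (mpoly_of_dhomog f \mPo subst z).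
  elim: (s) => [|z r [U [cU UP]]].
    by exists fullv; split=> //; rewrite /codim subnn.
  pose c := linfun (@comph K n m 1 (subst z) (subst1 z) k).
  exists (U :&: (c @^-1: hpart (van T) (1 * k)))%VS; split.
    apply: leq_trans (codimI _ _) _; rewrite [size _]/= [leqRHS]mulSnr; apply: leq_add => //.
    have -> : hf (van T) k = hf (van T) (1 * k) by rewrite mul1n.
    by rewrite /hf -(codim_preim_add c) leq_addr.
  move=> f; rewrite memv_cap => /andP[/UP fU fz] z'; rewrite inE => /orP[/eqP->|/fU //].
  by move: fz; rewrite -memv_preim lfunE => /(hpartP _ IT).
rewrite -{1}ss; apply: leq_trans cU; apply: codimS; apply/subvP => f /UP Uf.
apply/(hpartP _ rel_ideal) => v z Tv; rewrite -horner_pt_poly.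
suff -> : line_poly (pt_poly v) (mpoly_of_dhomog f) = 0 by rewrite horner0.
apply/eqP/negPn/negP => f0.
have rs : all (root (line_poly (pt_poly v) (mpoly_of_dhomog f))) s.
  by apply/allP => y sy; rewrite rootE horner_pt_poly -meval_subst Uf.
have := max_poly_roots f0 rs us; rewrite ss ltnNge => /negP; apply.
by apply: size_line_poly; [apply: size_pt_poly|apply: dhomog_is_dhomog].
Qed.

End Relations.

(** * Adjoining a variable *)

Lemma ideal_preim (A B : comNzRingType) (phi : {rmorphism A -> B}) (I : B -> Prop) :
  ideal I -> ideal (I \o phi).
Proof.
by case=> I0 ID IM; split=> [|x y|a x] /=; rewrite ?rmorph0 ?rmorphD ?rmorphM; auto.
Qed.

Lemma coef_ideal (R : comNzRingType) (I : R -> Prop) :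
  ideal I -> ideal (fun f : {poly R} => forall i, I f`_i).
Proof.
move=> II; have [I0 ID IM] := II; split=> [i|f g If Ig i|a f If i].
- by rewrite coef0.
- by rewrite coefD; apply: ID.
- by rewrite coefM; apply: ideal_sum => // j _; apply: IM.
Qed.

Section LastVariable.
Variables (K : fieldType) (N : nat).
Local Notation R := {mpoly K[N]}.
Local Notation S := {mpoly K[N.+1]}.
Local Notation widen := (widen_ord (leqnSn N)).
Implicit Types (p q f g : S).

Lemma meval_mwiden (p : R) (u : 'I_N.+1 -> K) :
  (mwiden p).@[u] = p.@[fun i => u (widen i)].
Proof.
elim/mpoly_ring_ind: p => [c|i|p q IHp IHq|p q IHp IHq].
- by rewrite mwidenC !mevalC.
- by rewrite mwidenX mnmwiden1 !mevalXU.
- by rewrite mwidenD !mevalD IHp IHq.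
- by rewrite mwidenM !mevalM IHp IHq.
Qed.

Lemma muni_expand p :
  p = \sum_(i < size (muni p)) mwiden (muni p)`_i * 'X_ord_max ^+ i.
Proof.
apply: (can_inj (@muniK K N)); rewrite raddf_sum -[LHS]coefK poly_def.
apply: eq_bigr => i _; rewrite /= muniM muni_mwiden -mul_polyC; congr (_ * _).
by rewrite rmorphXn /= muni_ord_max.
Qed.

Lemma meval_muni p (u : 'I_N.+1 -> K) :
  p.@[u] = (map_poly (meval (fun i => u (widen i))) (muni p)).[u ord_max].
Proof.
rewrite {1}(muni_expand p) raddf_sum /=.
rewrite (@horner_coef_wide _ (size (muni p))) ?size_poly //.
apply: eq_bigr => i _; rewrite mevalM meval_mwiden rmorphXn /= mevalXU.
by rewrite coef_map.
Qed.

Lemma muni_coef_homog p d i : p \is d.-homog ->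
  (muni p)`_i \is (d - i).-homog /\ ((d < i)%N -> (muni p)`_i = 0).
Proof.
move=> pd; have E : (muni p)`_i = \sum_(m <- msupp p | m ord_max == i)
    p@_m *: 'X_[[multinom m (widen j) | j < N]].
  rewrite muniE coef_sum [RHS]big_mkcond; apply: eq_bigr => m _.
  by rewrite coefZ coefXn eq_sym; case: eqP => _; rewrite ?mulr1 ?mulr0.
have mE m : m \in msupp p -> mdeg m = d by move=> mp; rewrite (dhomog_mf pd mp).
have dE (m : 'X_{1..N.+1}) :
    mdeg m = (mdeg [multinom m (widen j) | j < N] + m ord_max)%N.
  rewrite !mdegE big_ord_recr /=; congr (_ + _)%N.
  by apply: eq_bigr => j _; rewrite mnmE.
split; rewrite E.
  rewrite big_seq_cond; apply: rpred_sum => m /andP[/mE md /eqP mi].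
  by apply: rpredZ; rewrite dhomogX /= -md dE mi addnK.
move=> lt_di; rewrite big_seq_cond big1 // => m /andP[/mE md /eqP mi].
by move: lt_di; rewrite -md dE mi ltnNge leq_addl.
Qed.

(** The ideal generated by I in the polynomial ring with one more variable. *)
Definition ext (I : R -> Prop) : S -> Prop := fun p => forall i, I (muni p)`_i.

Lemma ext_ideal I : ideal I -> ideal (ext I).
Proof.
move=> II; pose psi : {rmorphism S -> {poly R}} := @muni N K.
exact: (ideal_preim psi (coef_ideal II)).
Qed.

Lemma ext_primeM I p q : ideal I -> prime_ideal I ->
  ext I (p * q) -> ext I p \/ ext I q.
Proof.
move=> II pI H; pose psi : {rmorphism S -> {poly R}} := @muni N K.
by apply: (coef_ideal_prime II pI) => i; rewrite -(rmorphM psi); apply: H.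
Qed.

Lemma ext_mwiden I (p : R) : ideal I -> I p -> ext I (mwiden p).
Proof. by move=> [I0 _ _] Ip i; rewrite muni_mwiden coefC; case: eqP. Qed.

Lemma ext_sub I (J : S -> Prop) : ideal J -> (forall p : R, I p -> J (mwiden p)) ->
  forall p, ext I p -> J p.
Proof.
move=> IJ sub p Ip; rewrite (muni_expand p); apply: ideal_sum => // i _.
by case: IJ => _ _ JM; rewrite mulrC; apply: JM; apply: sub.
Qed.

Lemma addp_ext_var I p : ideal I -> I (muni p)`_0 -> addp (ext I) 'X_ord_max p.
Proof.
move=> II Ip.
have split_poly (q : {poly R}) : exists q' : {poly R}, q = q' * 'X + (q`_0)%:P.
  elim/poly_ind: q => [|q c _]; first by exists 0; rewrite coef0 mul0r add0r.
  by exists q; rewrite coefD coefMX coefC add0r.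
have [q qE] := split_poly (muni p).
exists (of_uni q).
have -> : p - of_uni q * 'X_ord_max = mwiden (muni p)`_0.
  rewrite -{1}(muniK p) {1}qE of_uniD of_uniM of_uniX of_uniC.
  by rewrite addrC addKr.
exact: ext_mwiden.
Qed.

End LastVariable.

Section ExtHilbert.
Variables (K : fieldType) (N : nat).
Local Notation R := {mpoly K[N.+1]}.
Local Notation S := {mpoly K[N.+2]}.
Local Notation widen := (widen_ord (leqnSn N.+1)).
Variable I : R -> Prop.
Hypothesis HI : hom_ideal I.

Lemma ext_hom : hom_ideal (ext I).
Proof.
have [II HH] := HI; split=> [|p k Ip i]; first exact: ext_ideal.
have [lt_ki|le_ik] := ltnP k i.
  have [_ ->] := muni_coef_homog i (pihomogP mdeg k p); last by [].
  by case: II.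
suff -> : (muni (pihomog mdeg k p))`_i = pihomog mdeg (k - i)%N (muni p)`_i by apply: HH.
have muniS M (F : 'I_M -> S) : muni (\sum_e F e) = \sum_e muni (F e) by exact: raddf_sum.
have coefS M (F : 'I_M -> {poly R}) : (\sum_e F e)`_i = \sum_e (F e)`_i by exact: coef_sum.
have piS M (F : 'I_M -> R) d :
    pihomog mdeg d (\sum_e F e) = \sum_e pihomog mdeg d (F e) by exact: raddf_sum.
have pE : (muni p)`_i = \sum_(e < msize p) (muni (pihomog mdeg e p))`_i.
  have E := congr1 (fun g : S => (muni g)`_i) (pihomog_partitionE (leqnn (msize p))).
  exact: etrans E (etrans (congr1 (fun g : {poly R} => g`_i) (muniS _ _)) (coefS _ _)).
apply: esym; apply: etrans (congr1 (pihomog mdeg (k - i)%N) pE) _.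
apply: etrans (piS _ _ _) _.
have other (e : nat) : e != k ->
    pihomog mdeg (k - i)%N (muni (pihomog mdeg e p))`_i = 0.
  move=> ne; have [H0 H1] := muni_coef_homog i (pihomogP mdeg e p).
  have [lt_ei|le_ie] := ltnP e i; first by rewrite H1 // raddf0.
  apply: pihomog_ne0 H0; apply: contra ne => /eqP E.
  by rewrite -(subnK le_ie) E subnK.
have self : pihomog mdeg (k - i)%N (muni (pihomog mdeg k p))`_i =
    (muni (pihomog mdeg k p))`_i.
  by apply: pihomog_dE; have [] := muni_coef_homog i (pihomogP mdeg k p).
have [lt_k|le_k] := ltnP k (msize p); last first.
  rewrite big1 => [|e _]; last by apply: other; rewrite ltn_eqF // (leq_trans (ltn_ord e)).
  have pk0 : pihomog mdeg k p = 0 by apply: pihomog_small.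
  by rewrite pk0 (raddf0 (@muni N.+1 K)) coef0.
apply: etrans (bigD1 (Ordinal lt_k) isT) _.
apply: etrans (congr2 +%R self (big1 _ _ _ _)) (addr0 _) => e ne.
exact: other.
Qed.

Lemma hf_ext_var k : (hf (addp (ext I) 'X_ord_max) k <= hf I k)%N.
Proof.
have [II _] := HI.
pose t : N.+2.-tuple R := [tuple if unlift ord_max i is Some j then 'X_j else 0 | i < N.+2].
have t1 i : tnth t i \is 1.-homog.
  by rewrite tnth_mktuple; case: unliftP => [j _|_]; rewrite ?dhomogX /= ?mdeg1 ?dhomog0.
have tE (p : S) : p \mPo t = (muni p)`_0.
  rewrite {1}(muni_expand p) raddf_sum /=.
  have tw (q : R) : mwiden q \mPo t = q.
    elim/mpoly_ring_ind: q => [c|i|q r IHq IHr|q r IHq IHr].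
    - by rewrite mwidenC comp_mpolyC.
    - rewrite mwidenX mnmwiden1 comp_mpolyXU -tnth_nth tnth_mktuple.
      by rewrite widen_lift liftK.
    - by rewrite mwidenD comp_mpolyD IHq IHr.
    - by rewrite mwidenM rmorphM /= IHq IHr.
  have tm : ('X_ord_max : S) \mPo t = 0.
    by rewrite comp_mpolyXU -tnth_nth tnth_mktuple unlift_none.
  case sz: (size (muni p)) => [|e].
    by rewrite big_ord0 nth_default ?sz.
  rewrite big_ord_recl big1 ?addr0 => [|i _]; last first.
    by rewrite rmorphM rmorphXn /= tm expr0n mulr0.
  by rewrite expr0 mulr1 tw.
rewrite -[k in hf I k]mul1n; apply: (hf_comp_le t1 _ II).
  exact/addp_ideal/ext_ideal.
by move=> p _; rewrite tE; apply: addp_ext_var.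
Qed.

(** Iterated exact sequence for the last variable, which is not a zero divisor
modulo ext I. *)
Lemma hf_ext_le k e : (hf (ext I) (k + e) <= hf (ext I) k + \sum_(j < e) hf I (k + j.+1))%N.
Proof.
have X1 := @variable_homog K N.+2 ord_max.
have IE := ext_ideal HI.1.
elim: e => [|e IHe]; first by rewrite addn0 big_ord0 addn0.
rewrite big_ord_recr /= addnA; have -> : (k + e.+1 = k + e + 1)%N by lia.
rewrite (hf_exact _ ext_hom X1); apply: leq_add; last exact: hf_ext_var.
apply: leq_trans IHe; apply: hf_sub; [exact: IE|exact: colon_ideal|].
by move=> p _ Ip; rewrite /colon mulrC; case: IE => _ _; apply.
Qed.

(** A relation that is not a consequence of the old ones makes the new variable
algebraic, and then the Hilbert function grows no faster than before. *)
Lemma hf_algebraic (J : S -> Prop) psi e k :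
    prime_ideal I -> ideal J -> (forall p : R, I p -> J (mwiden p)) ->
    psi \is e.-homog -> J psi -> ~ ext I psi ->
  (hf J (k + e) <= \sum_(j < e) hf I (k + j.+1))%N.
Proof.
move=> pI IJ sub psie Jpsi npsi; have IE := ext_ideal HI.1.
have JE := ext_sub IJ sub.
have -> : (hf J (k + e) <= \sum_(j < e) hf I (k + j.+1))%N =
  (hf (ext I) k + hf J (k + e) <= hf (ext I) k + \sum_(j < e) hf I (k + j.+1))%N.
  by rewrite leq_add2l.
apply: leq_trans (hf_ext_le k e); rewrite (hf_exact _ ext_hom psie); apply: leq_add.
  apply: hf_sub; [exact: colon_ideal|exact: IE|].
  move=> p _; rewrite /colon => H.
  case: (ext_primeM HI.1 pI H) => [H0|H1]; first exact: H0.
  case: (npsi H1).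
apply: hf_sub; [exact: addp_ideal|exact: IJ|].
move=> p _ [g /JE H]; rewrite -[p](subrK (g * psi)).
by case: IJ => _ JD JM; apply: JD => //; apply: JM.
Qed.

End ExtHilbert.

Definition quad_growth (K : fieldType) n (J : {mpoly K[n.+1]} -> Prop) :=
  exists C k0, forall k, (k0 <= k)%N -> (hf J k <= C * k ^ 2)%N.

Lemma quad_growth_algebraic (K : fieldType) N (I : {mpoly K[N.+1]} -> Prop)
    (J : {mpoly K[N.+2]} -> Prop) psi e :
    hom_ideal I -> prime_ideal I -> ideal J -> (forall p : {mpoly K[N.+1]}, I p -> J (mwiden p)) ->
    psi \is e.-homog -> J psi -> ~ ext I psi -> quad_growth I ->
  quad_growth J.
Proof.
move=> HI pI IJ sub psie Jpsi npsi [C [k0 HC]]; exists (e * C)%N, (k0 + e)%N => k le_k.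
have le_ek : (e <= k)%N by lia.
have := hf_algebraic HI (k - e) pI IJ sub psie Jpsi npsi.
rewrite subnK // => /leq_trans; apply.
apply: leq_trans (_ : \sum_(j < e) C * k ^ 2 <= _)%N.
  apply: leq_sum => j _; apply: leq_trans (HC _ _) _; first by lia.
  rewrite leq_mul2l leq_exp2r //; apply/orP; right.
  by have := ltn_ord j; lia.
by rewrite sum_nat_const card_ord mulnA.
Qed.

Definition zero_ideal (R : comNzRingType) : R -> Prop := fun p => p = 0.

Section ZeroIdeal.
Variables (K : fieldType) (N : nat).
Local Notation Z := (@zero_ideal {mpoly K[N.+1]}).

Lemma zero_ideal_ideal : ideal Z.
Proof.
by split=> [|x y -> ->|a x ->]; rewrite /zero_ideal ?addr0 ?mulr0.
Qed.

Lemma zero_ideal_hom : hom_ideal Z.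
Proof.
by split=> [|p k ->]; [apply: zero_ideal_ideal|rewrite /zero_ideal raddf0].
Qed.

Lemma zero_ideal_prime : prime_ideal Z.
Proof. by move=> p q /eqP; rewrite mulf_eq0 => /orP[/eqP|/eqP]; [left|right]. Qed.

Lemma hf_zero_ideal k : hf Z k = 'C(k + N, k).
Proof.
rewrite /hf /codim dimvf; have -> : hpart Z k = 0%VS; last by rewrite dimv0 subn0.
apply/vspaceP => v; rewrite memv0; apply/idP/eqP => [/(hpartP _ zero_ideal_ideal) v0|->].
  exact: val_inj.
by rewrite mem0v.
Qed.

End ZeroIdeal.

(** * Equations of least degree are linear *)

Section AdjoinFunction.
Variables (K : closedFieldType) (n m : nat).
Variable T : set 'rV[K]_n.+1.
Variables (a b : m.+1.-tuple {mpoly K[n.+1]}) (c : {mpoly K[n.+1]}).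
Local Notation widen := (widen_ord (leqnSn m.+1)).
Local Notation ra := [tuple of rcons a c].
Local Notation rb := [tuple of rcons b 0].

Lemma tnth_rcons_widen (t : m.+1.-tuple {mpoly K[n.+1]}) d i :
  tnth [tuple of rcons t d] (widen i) = tnth t i.
Proof. by rewrite !(tnth_nth 0) nth_rcons size_tuple /= ltn_ord. Qed.

Lemma tnth_rcons_max (t : m.+1.-tuple {mpoly K[n.+1]}) d :
  tnth [tuple of rcons t d] ord_max = d.
Proof. by rewrite (tnth_nth 0) nth_rcons size_tuple ltnn eqxx. Qed.

Lemma rcons_homog (t : m.+1.-tuple {mpoly K[n.+1]}) d :
    (forall i, tnth t i \is 1.-homog) -> d \is 1.-homog ->
  forall i, tnth [tuple of rcons t d] i \is 1.-homog.
Proof.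
move=> t1 d1 i; case: (unliftP ord_max i) => [j ->|->]; last by rewrite tnth_rcons_max.
by rewrite -widen_lift tnth_rcons_widen.
Qed.

Lemma pt_rcons_widen z v i : pt ra rb z v (widen i) = pt a b z v i.
Proof. by rewrite /pt !tnth_rcons_widen. Qed.

Lemma pt_rcons_max z v : pt ra rb z v ord_max = c.@[v ord0].
Proof. by rewrite /pt !tnth_rcons_max meval0 mulr0 addr0. Qed.

Lemma meval_pt_mwiden z v (p : {mpoly K[m.+1]}) :
  (mwiden p).@[pt ra rb z v] = p.@[pt a b z v].
Proof. by rewrite meval_mwiden; apply: meval_eq => i; rewrite pt_rcons_widen. Qed.

Lemma rel_mwiden p : rels T ra rb (mwiden p) <-> rels T a b p.
Proof.
by split=> H v z Tv; have := H v z Tv; rewrite meval_pt_mwiden.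
Qed.

End AdjoinFunction.

Lemma mderiv_homog (K : fieldType) n (f : {mpoly K[n]}) d i :
  f \is d.-homog -> f^`M(i) \is d.-1.-homog.
Proof.
move=> fd; apply/dhomogP => m; rewrite mcoeff_msupp mcoeff_deriv => H.
have : f@_(m + U_(i)) != 0 by apply: contraNneq H => ->; rewrite mul0rn.
rewrite -mcoeff_msupp => /(dhomog_mf fd) /= <-.
by rewrite mdegD mdeg1 addn1.
Qed.

Lemma homog_msizeE (K : fieldType) n (f : {mpoly K[n]}) d :
  f \is d.-homog -> f != 0 -> msize f = d.+1.
Proof. by move=> fd f0; rewrite -mlead_deg // (dhomog_mf fd (mlead_supp f0)). Qed.

Lemma mpoly_eval0 (K : fieldType) n (f : {mpoly K[n]}) :
  uncountable_type K -> (forall u, f.@[u] = 0) -> f = 0.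
Proof.
move=> unc; elim: n f => [|n IHn] f f0.
  have := f0 (fun _ => 0); rewrite [f]nvar0_mpolyC mevalC => ->.
  by rewrite mpolyC0.
apply: (can_inj (@muniK K n)); rewrite muni0; apply/polyP => i; rewrite coef0.
apply: IHn => u; have E : map_poly (meval u) (muni f) = 0.
  apply: (@poly_vanish _ _ [::]) => // z _.
  pose w (j : 'I_n.+1) := if unlift ord_max j is Some k then u k else z.
  have := f0 w; rewrite meval_muni /w unlift_none => <-.
  congr (_.[_]); apply: eq_map_poly => p; apply: meval_eq => k.
  by rewrite widen_lift liftK.
by have := congr1 (fun g : {poly K} => g`_i) E; rewrite coef_map coef0.
Qed.

Lemma comp_congr (K : fieldType) n (l : {mpoly K[n]}) (t : n.-tuple {mpoly K[n]}) f :
  (forall i, divides l ('X_i - tnth t i)) -> divides l (f - (f \mPo t)).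
Proof.
move=> lt; elim/mpoly_ring_ind: f => [c|i|p q IHp IHq|p q IHp IHq].
- by rewrite comp_mpolyC subrr; apply: divides0.
- by rewrite comp_mpolyXU -tnth_nth; apply: lt.
- by rewrite comp_mpolyD opprD addrACA; apply: dividesD.
- rewrite rmorphM /=.
  have -> : p * q - (p \mPo t) * (q \mPo t) =
    q * (p - (p \mPo t)) + (p \mPo t) * (q - (q \mPo t)) by ring.
  by apply: dividesD; apply: divides_mull.
Qed.

Lemma coef1_linear (R : nzRingType) (u w : R) : (u%:P * 'X + w%:P)`_1 = u.
Proof. by rewrite coefD coefMX !coefC addr0. Qed.

Lemma mwiden_comp (K : fieldType) n (p : {mpoly K[n]}) :
  mwiden p = p \mPo [tuple 'X_(widen_ord (leqnSn n) i) | i < n].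
Proof.
elim/mpoly_ring_ind: p => [c|i|p q IHp IHq|p q IHp IHq].
- by rewrite mwidenC comp_mpolyC.
- by rewrite mwidenX mnmwiden1 comp_mpolyXU -tnth_nth tnth_mktuple.
- by rewrite mwidenD comp_mpolyD IHp IHq.
- by rewrite mwidenM rmorphM /= IHp IHq.
Qed.

Lemma mwiden_homog (K : fieldType) n (p : {mpoly K[n]}) d :
  p \is d.-homog -> mwiden p \is d.-homog.
Proof.
move=> pd; rewrite mwiden_comp -[d]mul1n; apply: comp_homog => // i.
by rewrite tnth_mktuple dhomogX /= mdeg1.
Qed.

(** A relation stays a relation when differentiated along the moving point. *)
Lemma rel_velocity (K : closedFieldType) n m (T : set 'rV[K]_n.+1)
    (a b : m.+1.-tuple {mpoly K[n.+1]}) g v z :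
    uncountable_type K -> rels T a b g -> T v ->
  \sum_i g^`M(i).@[pt a b z v] * (tnth b i).@[v ord0] = 0.
Proof.
move=> unc Jg Tv; have := congr1 (fun p : {poly K} => p^`().[z]) (rel_line_poly unc Jg Tv).
rewrite /= deriv0 horner0 deriv_line_poly horner_sum => E.
rewrite -[RHS]E; apply: eq_bigr => i _; rewrite hornerM horner_pt_poly; congr (_ * _).
by rewrite /pt_poly derivD derivC derivM derivC derivX mul0r !add0r mulr1 hornerC.
Qed.

Section Nonplanar.
Variables (K : closedFieldType) (n : nat).
Hypothesis unc : uncountable_type K.
Variable T : set 'rV[K]_n.+1.
Hypothesis irrT : irreducible_variety T.
Hypothesis chainT : irreducible_chain T 2.
Variables a b : 4.-tuple {mpoly K[n.+1]}.
Hypothesis a1 : forall i, tnth a i \is 1.-homog.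
Hypothesis b1 : forall i, tnth b i \is 1.-homog.
Variables ix iy : 'I_4.
Hypothesis nxy : ix != iy.
Hypothesis nx0 : ix != 0. Hypothesis nx3 : ix != 3.
Hypothesis ny0 : iy != 0. Hypothesis ny3 : iy != 3.
Hypothesis a3 : tnth a 3 = 0.
Hypothesis b0 : tnth b 0 = 0.
Hypothesis b3 : tnth b 3 = tnth a 0.
Hypothesis HD : ~ van T (tnth a 0).

Local Notation a5 := [tuple of rcons a (tnth b ix)].
Local Notation b5 := [tuple of rcons b 0].
Local Notation a6 := [tuple of rcons a5 (tnth b iy)].
Local Notation b6 := [tuple of rcons b5 0].
Local Notation widen4 := (widen_ord (leqnSn 4)).
Local Notation widen5 := (widen_ord (leqnSn 5)).

Variable q : n.+1.-tuple {mpoly K[6]}.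
Hypothesis q2 : forall j, tnth q j \is 2.-homog.
Hypothesis qE : forall v, T v -> forall j,
  (tnth q j).@[pt a6 b6 0 v] = (tnth a 0).@[v ord0] * v ord0 j.

Let zero1 : (0 : {mpoly K[n.+1]}) \is 1.-homog. Proof. exact: dhomog0. Qed.
Let a5h := rcons_homog a1 (b1 ix).
Let b5h := rcons_homog b1 zero1.
Let a6h := rcons_homog a5h (b1 iy).
Let b6h := rcons_homog b5h zero1.

Local Notation J4 := (rels T a b).
Local Notation J5 := (rels T a5 b5).
Local Notation J6 := (rels T a6 b6).

(** The quadrics q express the coordinates of T at the parameter 0, so that the
relations at 0 grow like the homogeneous ideal of T; letting the parameter vary
adds one to the dimension. *)
Lemma not_quad_growth_rel6 : ~ quad_growth J6.
Proof.
have [cT _ _] := irrT.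
pose J0 f := van T (f \mPo subst a6 b6 0).
have IJ0 : ideal J0.
  have [I0 ID IM] := van_ideal T; rewrite /J0; split.
  - by rewrite comp_mpoly0.
  - by move=> f g Hf Hg; rewrite comp_mpolyD; apply: ID.
  - by move=> f g Hg; rewrite rmorphM; apply: IM.
have HJ6 := rel_hom unc irrT a6h b6h.
have pJ6 : prime_ideal J6. exact: (@rel_prime K n 5 unc T a6 b6 irrT).
pose i3 : 'I_6 := widen5 (widen4 3).
have i3E z v : pt a6 b6 z v i3 = z * (tnth a 0).@[v ord0].
  by rewrite !pt_rcons_widen /pt a3 b3 meval0 add0r.
have X1 := variable_homog K i3.
have nX : ~ J6 'X_i3.
  move=> H; apply: HD => v Tv; have := H v 1 Tv.
  by rewrite mevalXU i3E mul1r.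
have step k : (hf J6 k + hf J0 k.+1 <= hf J6 k.+1)%N.
  have -> : hf J6 k.+1 = (hf (colon J6 'X_i3) k + hf (addp J6 'X_i3) k.+1)%N.
    by have := hf_exact k HJ6 X1; rewrite addn1.
  apply: leq_add.
    apply: hf_sub; [exact/colon_ideal/rel_ideal|exact: rel_ideal|].
    by move=> p _ /pJ6 [].
  apply: hf_sub; [exact/addp_ideal/rel_ideal|exact: IJ0|].
  move=> p _ [g Hg] v Tv; rewrite meval_subst; have := Hg v 0 Tv.
  by rewrite mevalB mevalM mevalXU i3E mul0r mulr0 subr0.
have hf0 k : (hf (van T) k <= hf J0 (2 * k))%N.
  apply: (hf_comp_le q2 (van_ideal T) IJ0) => f fk Hf.
  have [Dk|//] : van T (tnth a 0 ^+ k) \/ van T f.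
    apply: (van_prime unc irrT) => v Tv.
    have E : f.@[fun j => (tnth q j).@[pt a6 b6 0 v]] =
        f.@[fun j => (tnth a 0).@[v ord0] * v ord0 j].
      by apply: meval_eq => j; apply: qE.
    have := Hf v Tv; rewrite meval_subst comp_mpoly_meval E.
    by rewrite (meval_homog _ _ fk) mevalM rmorphXn.
  case: HD; elim: k Dk {fk Hf} => [|k IHk].
    rewrite expr0 => H v Tv; have := H v Tv; rewrite meval1 => /eqP.
    by rewrite oner_eq0.
  by rewrite exprS => /(van_prime unc irrT) [].
have low k : (\sum_(j < k.+1) hf (van T) j <= hf J6 (2 * k))%N.
  elim: k => [|k IHk].
    rewrite big_ord1; apply: leq_trans (hf0 0%N) _.
    apply: hf_sub; [exact: rel_ideal|exact: IJ0|].
    by move=> p _ Hp v Tv; rewrite meval_subst; apply: Hp.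
  rewrite big_ord_recr mulnS; apply: leq_trans (step (2 * k).+1).
  apply: leq_add; last by have := hf0 k.+1; rewrite mulnS.
  by apply: leq_trans IHk _; apply: leq_trans (step (2 * k)%N); apply: leq_addr.
have [M [k0 HM]] := hf_van_lower unc irrT chainT.
move=> [C [k1 HC]].
have [j [jk0 jk1 jC]] : exists j, [/\ (k0 <= j)%N, (k1 <= j)%N & (16 * C * M < j)%N].
  exists (k0 + k1 + 16 * C * M).+1; split; last by rewrite ltnS leq_addl.
    by rewrite -addnA leqW // leq_addr.
  by rewrite leqW // (leq_trans (leq_addl k0 k1)) // leq_addr.
have lej : (j * j ^ 2 <= M * (\sum_(i < j + j) hf (van T) i))%N.
  apply: leq_trans (_ : M * (\sum_(i < j) hf (van T) (j + i)) <= _)%N; last first.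
    by rewrite leq_mul2l sum_ord_cat_le orbT.
  rewrite big_distrr -[X in (X * _)%N]card_ord -sum_nat_const /=.
  apply: leq_sum => i _; apply: leq_trans (HM _ (leq_trans jk0 (leq_addr _ _))).
  by rewrite leq_exp2r // leq_addr.
have H2 : (hf J6 (2 * (j + j)) <= C * (2 * (j + j)) ^ 2)%N.
  by apply: HC; rewrite (leq_trans jk1) // mulnDr -addnA mul2n -addnn -!addnA leq_addr.
have H3 : (\sum_(i < j + j) hf (van T) i <= hf J6 (2 * (j + j)))%N.
  by apply: leq_trans (low (j + j)%N); rewrite big_ord_recr leq_addr.
have : (j * j ^ 2 <= M * (C * (2 * (j + j)) ^ 2))%N.
  by apply: leq_trans lej _; rewrite leq_mul2l (leq_trans H3 H2) orbT.
have -> : (M * (C * (2 * (j + j)) ^ 2) = (16 * C * M) * j ^ 2)%N by ring.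
by rewrite leq_pmul2r ?expn_gt0 ?(leq_ltn_trans _ jC) // leqNgt jC.
Qed.

Lemma ord4_cases (i : 'I_4) : [\/ i = 0, i = 3, i = ix | i = iy].
Proof.
move: nxy nx0 nx3 ny0 ny3; rewrite -!val_eqE /=.
case: ix iy i => [x xlt] [y ylt] [z zlt] /= H1 H2 H3 H4 H5.
have : z = 0%N \/ z = 3%N \/ z = x \/ z = y.
  by clear -xlt ylt zlt H1 H2 H3 H4 H5; lia.
by case=> [|[|[|]]] E; [constructor 1|constructor 2|constructor 3|constructor 4];
  apply: val_inj; rewrite /= E.
Qed.

Lemma tangency g v z : J4 g -> T v ->
  g^`M(iy).@[pt a b z v] * (tnth b iy).@[v ord0] +
   (g^`M(ix).@[pt a b z v] * (tnth b ix).@[v ord0] +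
    g^`M(3).@[pt a b z v] * pt a b z v 0) = 0.
Proof.
move=> Jg Tv; have := rel_velocity z unc Jg Tv.
rewrite (bigD1 iy) // (bigD1 ix) //= (bigD1 3) /=; last by rewrite eq_sym ny3 eq_sym nx3.
rewrite big1 ?addr0 => [E|i /andP[/andP[niy nix] ni3]]; last first.
  case: (ord4_cases i) => E; move: niy nix ni3; rewrite E ?eqxx // => _ _ _.
  by rewrite b0 meval0 mulr0.
by rewrite -[RHS]E {4}/pt b0 b3 meval0 mulr0 addr0.
Qed.

(** The new coordinate of a relation is transcendental over the old ones once
the moving point satisfies an equation involving the coordinate iy: otherwise
the second velocity would be algebraic too. *)
Lemma rel5_ext g e : g \is e.-homog -> J4 g -> g != 0 -> ~ J4 g^`M(iy) ->
  forall f, J5 f -> ext J4 f.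
Proof.
move=> ge Jg g0 ngy.
have HJ4 := rel_hom unc irrT a1 b1.
have HJ5 := rel_hom unc irrT a5h b5h.
have pJ4 : prime_ideal J4. exact: (@rel_prime K n 3 unc T a b irrT).
have pJ5 : prime_ideal J5. exact: (@rel_prime K n 4 unc T a5 b5 irrT).
have q4 : quad_growth J4.
  pose Z := @zero_ideal {mpoly K[3]}.
  apply: (@quad_growth_algebraic K 2 Z J4 g e) => //.
  - exact: zero_ideal_hom.
  - exact: zero_ideal_prime.
  - exact: rel_ideal.
  - by move=> p ->; rewrite mwiden0; case: HJ4.1.
  - move=> H; case/eqP: g0; rewrite (muni_expand g) big1 // => i _.
    by rewrite (H i) mwiden0 mul0r.
  exists 6%N, 1%N => k k1; rewrite hf_zero_ideal -bin_sub ?leq_addr // addKn addn2.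
  by rewrite bin2 /=; clear -k1; nia.
have q5 f d : J5 f -> f \is d.-homog -> ~ ext J4 f -> quad_growth J5.
  move=> Jf fd nf; apply: (@quad_growth_algebraic K 3 J4 J5 f d) => //.
    exact: rel_ideal.
  by move=> p; apply: (rel_mwiden T a b (tnth b ix) p).2.
pose gx := g^`M(ix); pose gy := g^`M(iy); pose gz := g^`M(3).
pose psi : {mpoly K[6]} := mwiden (mwiden gy) * 'X_ord_max +
   mwiden (mwiden gx * 'X_ord_max + mwiden (gz * 'X_0)).
have psih : psi \is (e.-1 + 1).-homog.
  have X1 := @variable_homog K.
  apply: dhomogD; first by apply: dhomogM (X1 _ _); do 2!apply: mwiden_homog; apply: mderiv_homog.
  apply: mwiden_homog; apply: dhomogD.
    by apply: dhomogM (X1 _ _); apply: mwiden_homog; apply: mderiv_homog.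
  by apply: mwiden_homog; apply: dhomogM (X1 _ _); apply: mderiv_homog.
have Jpsi : J6 psi.
  move=> v z Tv; rewrite -[RHS](tangency z Jg Tv).
  rewrite /psi mevalD mevalM mevalXU pt_rcons_max !meval_pt_mwiden; congr (_ + _).
  by rewrite mevalD mevalM mevalXU pt_rcons_max !meval_pt_mwiden mevalM mevalXU.
have npsi : ~ ext J5 psi.
  move=> H; apply: ngy; apply/(rel_mwiden T a b (tnth b ix)); have := H 1%N.
  have -> : muni psi = (mwiden gy)%:P * 'X + (mwiden gx * 'X_ord_max + mwiden (gz * 'X_0))%:P.
    by rewrite /psi muniD muniM !muni_mwiden muni_ord_max.
  by rewrite coef1_linear.
have homog_ext f d : J5 f -> f \is d.-homog -> ext J4 f.
  move=> Jf fd; apply: contrapT => nf; apply: not_quad_growth_rel6.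
  apply: (@quad_growth_algebraic K 4 J5 J6 psi (e.-1 + 1)) => //.
  - exact: rel_ideal.
  - by move=> p; apply: (rel_mwiden T a5 b5 (tnth b iy) p).2.
  - exact: q5 Jf fd nf.
move=> f Jf; rewrite (pihomog_partitionE (leqnn (msize f))).
apply: ideal_sum => [|i _]; first exact: ext_ideal HJ4.1.
apply: homog_ext (pihomogP mdeg i f); exact: HJ5.2.
Qed.

(** A direction (0, alpha, beta, P 0) tangent to g = 0 at P, scaled by the
derivative of g along iy in order to avoid denominators: tangency determines
beta. *)
Definition tangent g (P : 'I_4 -> K) (alpha : K) (i : 'I_4) : K :=
  if i == ix then g^`M(iy).@[P] * alpha
  else if i == iy then - (g^`M(ix).@[P] * alpha + P 0 * g^`M(3).@[P])
  else if i == 3 then P 0 * g^`M(iy).@[P] else 0.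

(** The lines of T through a point satisfy one linear condition; as the slope is
transcendental, every line satisfying it lies on the surface g = 0. *)
Lemma tangent_plane g e v z s alpha : g \is e.-homog -> J4 g -> g != 0 ->
    ~ J4 g^`M(iy) -> T v ->
  g.@[fun i => pt a b z v i + s * tangent g (pt a b z v) alpha i] = 0.
Proof.
move=> ge Jg g0 ngy Tv.
pose gx := g^`M(ix); pose gy := g^`M(iy); pose gz := g^`M(3).
pose delta (i : 'I_4) : {mpoly K[5]} :=
  if i == ix then mwiden gy * 'X_ord_max
  else if i == iy then - (mwiden gx * 'X_ord_max + mwiden ('X_0 * gz))
  else if i == 3 then mwiden ('X_0 * gy) else 0.
pose t : 4.-tuple {mpoly K[5]} := [tuple mwiden 'X_i + s *: delta i | i < 4].
have evt u : (g \mPo t).@[u] = g.@[fun i => u (widen4 i) +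
    s * tangent g (fun i => u (widen4 i)) (u ord_max) i].
  rewrite comp_mpoly_meval; apply: meval_eq => i.
  rewrite tnth_mktuple mevalD mevalZ meval_mwiden mevalXU; congr (_ + s * _).
  rewrite /delta /tangent; case: ifP => _.
    by rewrite mevalM mevalXU meval_mwiden.
  case: ifP => _.
    by rewrite mevalN mevalD mevalM mevalXU !meval_mwiden mevalM mevalXU.
  by case: ifP => _; rewrite ?meval0 // meval_mwiden mevalM mevalXU.
have Jt : J5 (g \mPo t).
  move=> w y Tw; rewrite evt pt_rcons_max.
  have P5 : (fun i => pt a5 b5 y w (widen4 i)) =1 pt a b y w.
    by move=> i; rewrite pt_rcons_widen.
  set c := gy.@[pt a b y w].
  rewrite (@meval_eq _ _ _ (pt a b (y + s * c) w)); first exact: Jg.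
  move=> i; rewrite P5 /tangent !(meval_eq _ P5) P5.
  have -> : pt a b (y + s * c) w i = pt a b y w i + s * (c * (tnth b i).@[w ord0]).
    by rewrite /pt; ring.
  rewrite /c; congr (_ + s * _).
  have bz : (tnth b 3).@[w ord0] = pt a b y w 0.
    by rewrite /pt b0 b3 meval0 mulr0 addr0.
  have E := tangency y Jg Tw.
  case: (ord4_cases i) => ->; rewrite ?eqxx.
  - by rewrite eq_sym (negPf nx0) eq_sym (negPf ny0) b0 meval0 mulr0.
  - by rewrite eq_sym (negPf nx3) eq_sym (negPf ny3) bz mulrC.
  - by [].
  - rewrite eq_sym (negPf nxy); move: E; rewrite -/gx -/gy -/gz => /eqP.
    by rewrite addr_eq0 => /eqP ->; ring.
have Et := rel5_ext ge Jg g0 ngy Jt.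
pose u (i : 'I_5) := if unlift ord_max i is Some k then pt a b z v k else alpha.
have uw i : u (widen4 i) = pt a b z v i by rewrite /u widen_lift liftK.
have um : u ord_max = alpha by rewrite /u unlift_none.
have := evt u; rewrite meval_muni (_ : map_poly _ _ = 0) ?horner0 => [->|].
  have um' := um; rewrite um; apply: meval_eq => i.
  rewrite uw; congr (_ + s * _); rewrite /tangent.
  by rewrite !(meval_eq _ uw) uw.
apply/polyP => i; rewrite coef_map coef0 /=.
by rewrite (meval_eq _ uw); apply: Et.
Qed.

(** An equation of least degree of the moving point is linear: it is divisible
by the equation of its tangent plane. *)
Lemma linear_relation g e : g \is e.-homog -> J4 g -> g != 0 -> g^`M(iy) != 0 ->
    (forall h d, h \is d.-homog -> J4 h -> h != 0 -> (e <= d)%N) ->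
  exists l, [/\ l \is 1.-homog, J4 l & l != 0].
Proof.
move=> ge Jg g0 gy0 min.
have pJ4 : prime_ideal J4. exact: (@rel_prime K n 3 unc T a b irrT).
have HJ4 := rel_hom unc irrT a1 b1.
have e_gt0 : (0 < e)%N.
  rewrite lt0n; apply: contra_neq gy0 => e0.
  have /msize1_polyC -> : (msize g <= 1)%N by rewrite (homog_msizeE ge g0) e0.
  exact: mderivC.
have ngy : ~ J4 g^`M(iy).
  move=> H; have := min _ _ (mderiv_homog iy ge) H gy0.
  by rewrite leqNgt prednK // leqnn.
have [v [z [Tv Pv]]] : exists v z, T v /\ ('X_0 * g^`M(iy)).@[pt a b z v] != 0.
  apply: contrapT => no; have : J4 ('X_0 * g^`M(iy)).
    by move=> v z Tv; apply/eqP/negPn/negP => H; apply: no; exists v, z.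
  case/pJ4 => // H; apply: HD => v Tv; have := H v 0 Tv.
  by rewrite mevalXU /pt mul0r addr0.
pose P := pt a b z v; move: Pv; rewrite mevalM mevalXU mulf_eq0 negb_or -/P.
pose gx := g^`M(ix).@[P]; pose gy := g^`M(iy).@[P]; pose gz := g^`M(3).@[P].
rewrite -/gy => /andP[w0 ngyP].
(* The equation of the tangent plane at P, solved for the coordinate iy. *)
pose Y : {mpoly K[4]} := (P iy / P 0) *: 'X_0 - (gx / gy) *: ('X_ix - (P ix / P 0) *: 'X_0)
   - (gz / gy) *: ('X_3 - (P 3 / P 0) *: 'X_0).
pose sub : 4.-tuple {mpoly K[4]} := [tuple if i == iy then Y else 'X_i | i < 4].
pose l : {mpoly K[4]} := 'X_iy - Y.
have subE i : tnth sub i = if i == iy then Y else 'X_i by rewrite tnth_mktuple.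
have gsub0 : g \mPo sub = 0.
  pose h : {mpoly K[4]} := 'X_0 * (P 0 *: 'X_3 - P 3 *: 'X_0).
  have h0 : h != 0.
    apply/eqP => h0; have := congr1 (meval (fun i : 'I_4 => if i == 0 then 1 else (P 3 + 1) / P 0)) h0.
    rewrite meval0 /h mevalM mevalB !mevalZ !mevalXU /= mulrCA divff // !mulr1 mul1r.
    by rewrite addrC addKr => /eqP; rewrite oner_eq0.
  have /eqP : (g \mPo sub) * h = 0.
    apply: mpoly_eval0 unc _ => u; rewrite mevalM.
    have [u0|u0] := eqVneq (u 0) 0; first by rewrite /h mevalM mevalXU u0 mul0r mulr0.
    have [u3|u3] := eqVneq (P 0 * u 3 - P 3 * u 0) 0.
      by rewrite /h mevalM mevalB !mevalZ !mevalXU u3 !mulr0.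
    (* A point of the tangent plane is c (P + s tangent): c is read off from the
    coordinate 0, then s from the coordinate 3 and alpha from ix; the polynomial h
    excludes the values where this fails. *)
    pose c := u 0 / P 0; pose s := (u 3 / c - P 3) / (P 0 * gy).
    pose alpha := (u ix / c - P ix) / (s * gy).
    have c0 : c != 0 by rewrite mulf_neq0 ?invr_eq0.
    have s0 : s != 0.
      rewrite mulf_neq0 ?invr_eq0 ?mulf_neq0 // subr_eq0.
      apply: contra_neq u3 => E; rewrite -E /c; field; exact/andP.
    rewrite comp_mpoly_meval (@meval_eq _ _ _ (fun i => c * (P i + s * tangent g P alpha i))).
      by rewrite (meval_homog _ _ ge) (tangent_plane _ _ _ ge) // mulr0 mul0r.
    move=> i; rewrite subE /tangent -/gx -/gy -/gz.
    have [->|niy] := eqVneq i iy.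
      rewrite eq_sym (negPf nxy) /Y !mevalB !mevalZ !mevalB !mevalZ !mevalXU.
      rewrite /alpha /s /c; field.
      apply/and4P; split; [exact: ngyP|exact: w0|exact: u0|].
      by rewrite mulNr [u 3 * _]mulrC.
    case: (ord4_cases i) => iE; move: niy; rewrite iE ?eqxx // => niy; rewrite mevalXU.
    - by rewrite eq_sym (negPf nx0) mulr0 addr0 /c divfK.
    - rewrite eq_sym (negPf nx3) /s /c; field.
      by apply/and3P; split; [exact: ngyP|exact: w0|exact: u0].
    - rewrite /alpha; field.
      by apply/and3P; split; [exact: ngyP|exact: s0|exact: c0].
  by rewrite mulf_eq0 (negPf h0) orbF => /eqP.
have [r gE] : divides l g.
  rewrite -[g]subr0 -gsub0; apply: comp_congr => i; rewrite subE.
  by case: eqP => [->|_]; [apply: divides_refl|rewrite subrr; apply: divides0].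
have X1 (i : 'I_4) : ('X_i : {mpoly K[4]}) \is 1.-homog by exact: variable_homog.
have subh (p p' : {mpoly K[4]}) :
    p \is 1.-homog -> p' \is 1.-homog -> p - p' \is 1.-homog.
  by move=> ph ph'; apply: dhomogD => //; rewrite dhomogN.
have lh : l \is 1.-homog.
  apply: (subh _ _ (X1 iy)); apply: (subh); first apply: (subh).
  - by apply: dhomogZ; apply: X1.
  - by apply: dhomogZ; apply: (subh _ _ (X1 ix)); apply: dhomogZ; apply: X1.
  - by apply: dhomogZ; apply: (subh _ _ (X1 3)); apply: dhomogZ; apply: X1.
have l0 : l != 0 by apply: contraNneq g0 => l0; rewrite gE l0 mulr0.
have r0 : r != 0 by apply: contraNneq g0 => r0; rewrite gE r0 mul0r.
exists l; split=> //; have : J4 (r * l) by rewrite -gE.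
case/pJ4 => [Jr|//].
have sr : msize r = ((msize r).-1).+1 by apply: mpolySpred.
have : msize g = (msize r + msize l).-1 by rewrite {1}gE msizeM.
rewrite (homog_msizeE ge g0) (homog_msizeE lh l0) addn2 /= => -[eE].
have := min _ _ (pihomogP mdeg (msize r).-1 r) (HJ4.2 _ _ Jr).
rewrite eE {2}sr ltnn => /(_ _) H; exfalso.
suff /H : pihomog mdeg (msize r).-1 r != 0 by [].
apply/negP => /eqP rt0; have := @msize_sub_top K 3 (msize r).-1 r.
by rewrite rt0 subr0 -sr leqnn => /(_ isT); rewrite {1}sr ltnn.
Qed.

End Nonplanar.

(** * Surfaces of coplanar lines are planes *)

Section Flat.
Variables (K : closedFieldType) (n : nat).
Hypothesis unc : uncountable_type K.
Variable T : set 'rV[K]_n.+1.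
Hypothesis irrT : irreducible_variety T.
Hypothesis chainT : irreducible_chain T 2.

(** A surface whose points depend linearly on three of their coordinates fills
the plane: a further equation would make its Hilbert function linear. *)
Lemma flat_of_coordinates (i : 'I_3 -> 'I_n.+1) (M : 'M[K]_(3, n.+1)) :
    (forall r s, M r (i s) = (r == s)%:R) ->
    (forall v, T v -> forall j, v ord0 j = \sum_r v ord0 (i r) * M r j) ->
  flat 2 T.
Proof.
move=> Mi TM; have [cT _ _] := irrT.
have T0 v : T v -> v != 0 by case: cT => SX [_ ->] [].
pose sel := \matrix_(j < n.+1, r < 3) ((j == i r)%:R : K).
have Msel : M *m sel = 1%:M.
  apply/matrixP => r s; rewrite !mxE (bigD1 (i s)) //= big1 => [|j ne].
    by rewrite !mxE eqxx mulr1 addr0 Mi.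
  by rewrite !mxE (negPf ne) mulr0.
exists M; split; first by apply/row_freeP; exists sel.
have Tsub v : T v -> (v <= M)%MS.
  move=> Tv; apply/submxP; exists (\row_r v ord0 (i r)); apply/rowP => j.
  rewrite mxE; apply: etrans (TM v Tv j) _.
  by apply: eq_bigr => r _; rewrite mxE.
apply/seteqP; split=> [v Tv|w [w0 wM]]; first by split; [exact: T0|exact: Tsub].
apply: contrapT => nTw.
have [SX [SXh TE]] := cT.
have [f [d [fd Tf fw]]] : exists (f : {mpoly K[n.+1]}) d,
    [/\ f \is d.-homog, van T f & f.@[w ord0] != 0].
  apply: contrapT => no; apply: nTw; rewrite TE; split=> // f Sf.
  have [d fd] := SXh f Sf; apply/eqP/negPn/negP => fw; apply: no.
  by exists f, d; split=> // v; rewrite TE => -[_]; apply.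
pose t : n.+1.-tuple {mpoly K[3]} := [tuple \sum_r M r j *: 'X_r | j < n.+1].
have X1 (r : 'I_3) : ('X_r : {mpoly K[3]}) \is 1.-homog by exact: variable_homog.
have t1 j : tnth t j \is 1.-homog.
  by rewrite tnth_mktuple; apply: rpred_sum => r _; apply: dhomogZ.
pose y (v : 'rV[K]_n.+1) (r : 'I_3) := v ord0 (i r).
pose I' (h : {mpoly K[3]}) := forall v, T v -> h.@[y v] = 0.
have I'I : ideal I'.
  split=> [v _|h k Hh Hk v Tv|a h Hh v Tv]; first by rewrite meval0.
    by rewrite mevalD Hh // Hk // addr0.
  by rewrite mevalM Hh // mulr0.
have evt h u : (h \mPo t).@[u] = h.@[fun j => \sum_r M r j * u r].
  rewrite comp_mpoly_meval; apply: meval_eq => j; rewrite tnth_mktuple raddf_sum /=.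
  by apply: eq_bigr => r _; rewrite mevalZ mevalXU.
have evT h v : T v -> (h \mPo t).@[y v] = h.@[v ord0].
  move=> Tv; rewrite evt; apply: meval_eq => j; rewrite (TM v Tv).
  by apply: eq_bigr => r _; rewrite mulrC.
have hfle k : (hf (van T) k <= hf I' k)%N.
  rewrite -[k in hf I' k]mul1n; apply: (hf_comp_le t1 (van_ideal T) I'I).
  by move=> h _ Hh v Tv; rewrite -evT // Hh.
have I'f : I' (f \mPo t) by move=> v Tv; rewrite evT // Tf.
have ft0 : f \mPo t != 0.
  apply: contra_neq fw => ft0; have /submxP [x xE] := wM.
  have := evt f (x ord0); rewrite ft0 meval0 => E; rewrite [RHS]E.
  by apply: meval_eq => j; rewrite xE mxE; apply: eq_bigr => r _; rewrite mulrC.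
have fth : f \mPo t \is d.-homog by rewrite -[d]mul1n; apply: comp_homog.
have lin k : (hf I' (k + d) <= d * (k + d).+1)%N.
  apply: leq_trans (hf_algebraic (zero_ideal_hom K 1) k (@zero_ideal_prime K 1) I'I _ fth I'f _) _.
  - by move=> p ->; rewrite mwiden0; case: I'I.
  - move=> H; case/eqP: ft0; rewrite (muni_expand (f \mPo t)) big1 // => r _.
    by rewrite (H r) mwiden0 mul0r.
  apply: leq_trans (_ : \sum_(j < d) (k + d).+1 <= _)%N.
    apply: leq_sum => j _; rewrite hf_zero_ideal addn1 binSn ltnS leq_add2l.
    exact: ltn_ord.
  by rewrite sum_nat_const card_ord.
have [B [k0 HB]] := hf_van_lower unc irrT chainT.
pose k := (k0 + 2 * (B * d)).+1.
have : ((k + d) ^ 2 <= B * (d * (k + d).+1))%N.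
  apply: leq_trans (HB _ _) _.
    by rewrite /k; apply: leq_trans (leq_addr _ _); rewrite leqW // leq_addr.
  by rewrite leq_mul2l (leq_trans (hfle _) (lin k)) orbT.
have : (2 * (B * d) < k + d)%N by rewrite /k addSn ltnS -addnA addnCA leq_addr.
clear; move: (k + d)%N => x; rewrite mulnA; move: (B * d)%N => m; nia.
Qed.

(** The linear dependence may be given by a table, for coordinates listed in any
order. *)
Lemma flat_of_list (js : seq 'I_n.+1) (s : seq nat) (L : seq (seq K)) :
    uniq js -> size js = n.+1 ->
    (forall r, (r < 3)%N -> ((nth 0%N s r) < n.+1)%N) ->
    (forall r t, (r < 3)%N -> (t < 3)%N -> (nth [::] L (nth 0%N s t))`_r = (r == t)%:R) ->
    (forall v, T v -> forall k, (k < n.+1)%N ->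
       v ord0 (nth ord0 js k) =
       \sum_(r < 3) v ord0 (nth ord0 js (nth 0%N s r)) * (nth [::] L k)`_r) ->
  flat 2 T.
Proof.
move=> ujs szj s_lt Ls TL.
pose M := \matrix_(r < 3, j < n.+1) (nth [::] L (index j js))`_r.
have all_in : forall j : 'I_n.+1, j \in js.
  by apply/subset_cardP; rewrite ?subset_predT // (card_uniqP ujs) szj card_ord.
apply: (@flat_of_coordinates (fun r => nth ord0 js (nth 0%N s r)) M).
  move=> r t; rewrite mxE index_uniq ?szj ?s_lt //.
  by rewrite Ls.
move=> v Tv j; have jE : j = nth ord0 js (index j js) by rewrite nth_index.
have lt_j : (index j js < n.+1)%N by rewrite -[X in (_ < X)%N]szj index_mem.
rewrite [in LHS]jE TL //.
by apply: eq_bigr => r _; rewrite mxE.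
Qed.

End Flat.

Section PlaneEquations.
Variables (K : fieldType) (A B C D E F c0 c1 c2 c3 : K).

Lemma point_equation_split :
    (forall z, c0 * (D + z * 0) + (c1 * (- B + z * A) +
      (c2 * (E + z * C) + (c3 * (0 + z * D) + 0))) = 0) ->
  c0 * D - c1 * B + c2 * E = 0 /\ c1 * A + c2 * C + c3 * D = 0.
Proof.
move=> H; have H0 : c0 * D - c1 * B + c2 * E = 0 by rewrite -[RHS](H 0); ring.
by split=> //; rewrite -[RHS](subr0 0) -{1}(H 1) -[X in _ - X]H0; ring.
Qed.

Hypothesis klein : A * E + C * B + D * F = 0.
Hypothesis eq3 : c0 * D - c1 * B + c2 * E = 0.
Hypothesis eq0 : c1 * A + c2 * C + c3 * D = 0.

Lemma plane_equation2 : D * (c0 * A - c2 * F + c3 * B) = 0.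
Proof.
transitivity (A * (c0 * D - c1 * B + c2 * E) + B * (c1 * A + c2 * C + c3 * D)
  - c2 * (A * E + C * B + D * F)); first by ring.
by rewrite eq3 eq0 klein !(mulr0, addr0, subr0).
Qed.

Lemma plane_equation1 : D * (c0 * C + c1 * F - c3 * E) = 0.
Proof.
transitivity (C * (c0 * D - c1 * B + c2 * E) - E * (c1 * A + c2 * C + c3 * D)
  + c1 * (A * E + C * B + D * F)); first by ring.
by rewrite eq3 eq0 klein !(mulr0, addr0, subr0).
Qed.

End PlaneEquations.

(** A line of the plane c0 w + c1 x + c2 y + c3 z = 0 is determined by three of its
Plücker coordinates, those that do not occur with a chosen nonzero coefficient.
For a nonzero c_i, the i-th entry of the table lists their positions among A, C,
D, E, B, F and the expressions of the six coordinates in terms of them. *)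
Section PlaneCoordinates.
Variables (K : fieldType) (c0 c1 c2 c3 : K).

Definition plane_table i : seq nat * seq (seq K) :=
  nth ([::], [::]) [::
   ([:: 3; 4; 5]%N,
    [:: [:: 0; - c3 / c0; c2 / c0]; [:: c3 / c0; 0; - c1 / c0];
        [:: - c2 / c0; c1 / c0; 0]; [:: 1; 0; 0]; [:: 0; 1; 0]; [:: 0; 0; 1]]);
   ([:: 1; 2; 3]%N,
    [:: [:: - c2 / c1; - c3 / c1; 0]; [:: 1; 0; 0]; [:: 0; 1; 0]; [:: 0; 0; 1];
        [:: 0; c0 / c1; c2 / c1]; [:: - c0 / c1; 0; c3 / c1]]);
   ([:: 0; 2; 4]%N,
    [:: [:: 1; 0; 0]; [:: - c1 / c2; - c3 / c2; 0]; [:: 0; 1; 0];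
        [:: 0; - c0 / c2; c1 / c2]; [:: 0; 0; 1]; [:: c0 / c2; 0; c3 / c2]]);
   ([:: 0; 1; 5]%N,
    [:: [:: 1; 0; 0]; [:: 0; 1; 0]; [:: - c1 / c3; - c2 / c3; 0];
        [:: 0; c0 / c3; c1 / c3]; [:: - c0 / c3; 0; c2 / c3]; [:: 0; 0; 1]])] i.

Lemma plane_table_free i r : (i < 4)%N -> (r < 3)%N ->
  (nth 0%N (plane_table i).1 r < 6)%N.
Proof. by case: i => [|[|[|[|//]]]] _; case: r => [|[|[|//]]]. Qed.

Lemma plane_table_id i r t : (i < 4)%N -> (r < 3)%N -> (t < 3)%N ->
  (nth [::] (plane_table i).2 (nth 0%N (plane_table i).1 t))`_r = (r == t)%:R.
Proof.
by case: i => [|[|[|[|//]]]] _; case: r => [|[|[|//]]] _; case: t => [|[|[|//]]].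
Qed.

Lemma plane_tableP i (A C D E B F : K) k :
    [:: c0; c1; c2; c3]`_i != 0 -> (k < 6)%N ->
    c0 * D - c1 * B + c2 * E = 0 -> c1 * A + c2 * C + c3 * D = 0 ->
    c0 * A - c2 * F + c3 * B = 0 -> c0 * C + c1 * F - c3 * E = 0 ->
  let x := nth 0 [:: A; C; D; E; B; F] in
  x k = \sum_(r < 3) x (nth 0%N (plane_table i).1 r) * (nth [::] (plane_table i).2 k)`_r.
Proof.
have solve (x y d : K) : d != 0 -> d * x - y = 0 -> x = d^-1 * y.
  by move=> d0 /eqP; rewrite subr_eq0 => /eqP; apply: canRL (mulKf d0).
move=> ci lt_k e1 e2 e3 e4; rewrite /= !big_ord_recl big_ord0 /=.
case: i ci => [|[|[|[|i]]]] /= ci; last by rewrite nth_nil eqxx in ci.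
- have ED : D = c0^-1 * (c1 * B - c2 * E) by apply: solve; rewrite // -[RHS]e1; ring.
  have EA : A = c0^-1 * (c2 * F - c3 * B) by apply: solve; rewrite // -[RHS]e3; ring.
  have EC : C = c0^-1 * (c3 * E - c1 * F) by apply: solve; rewrite // -[RHS]e4; ring.
  by case: k lt_k => [|[|[|[|[|[|//]]]]]] _ /=; rewrite ?ED ?EA ?EC; field.
- have EA : A = c1^-1 * (- c2 * C - c3 * D) by apply: solve; rewrite // -[RHS]e2; ring.
  have EB : B = c1^-1 * (c0 * D + c2 * E).
    by apply: solve; rewrite // -[RHS]oppr0 -e1; ring.
  have EF : F = c1^-1 * (c3 * E - c0 * C) by apply: solve; rewrite // -[RHS]e4; ring.
  by case: k lt_k => [|[|[|[|[|[|//]]]]]] _ /=; rewrite ?EA ?EB ?EF; field.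
- have EC : C = c2^-1 * (- c1 * A - c3 * D) by apply: solve; rewrite // -[RHS]e2; ring.
  have EE : E = c2^-1 * (c1 * B - c0 * D) by apply: solve; rewrite // -[RHS]e1; ring.
  have EF : F = c2^-1 * (c0 * A + c3 * B).
    by apply: solve; rewrite // -[RHS]oppr0 -e3; ring.
  by case: k lt_k => [|[|[|[|[|[|//]]]]]] _ /=; rewrite ?EC ?EE ?EF; field.
- have ED : D = c3^-1 * (- c1 * A - c2 * C) by apply: solve; rewrite // -[RHS]e2; ring.
  have EB : B = c3^-1 * (c2 * F - c0 * A) by apply: solve; rewrite // -[RHS]e3; ring.
  have EE : E = c3^-1 * (c0 * C + c1 * F).
    by apply: solve; rewrite // -[RHS]oppr0 -e4; ring.
  by case: k lt_k => [|[|[|[|[|[|//]]]]]] _ /=; rewrite ?ED ?EB ?EE; field.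
Qed.

End PlaneCoordinates.

(** The six Plücker coordinates, up to a cyclic permutation of the axes: D, A, C are
the direction, and -B, E the moments that occur in the homogeneous coordinates
(D, A z - B, C z + E, D z) of the point of height z on the line. *)
Section Plucker.
Variables (K : closedFieldType).
Hypothesis unc : uncountable_type K.
Hypothesis char0 : forall e, e.+1%:R != 0 :> K.
Variable T : set 'rV[K]_6.
Hypothesis irrT : irreducible_variety T.
Hypothesis chainT : irreducible_chain T 2.
Hypothesis nflat : ~ flat 2 T.
Variables jA jC jD jE jB jF : 'I_6.
Hypothesis uniqj : uniq [:: jA; jC; jD; jE; jB; jF].
Hypothesis klein : forall v, T v ->
  v ord0 jA * v ord0 jE + v ord0 jC * v ord0 jB + v ord0 jD * v ord0 jF = 0.
Hypothesis HD : ~ van T 'X_jD.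

(** The homogeneous coordinates of the point of height z on a line are the values
of point_base + z point_dir. *)
Definition point_base : 4.-tuple {mpoly K[6]} := [tuple 'X_jD; - 'X_jB; 'X_jE; 0].
Definition point_dir : 4.-tuple {mpoly K[6]} := [tuple 0; 'X_jA; 'X_jC; 'X_jD].

(** A linear relation says that all lines of T lie in one plane. *)
Lemma no_linear_relation l : l \is 1.-homog -> rels T point_base point_dir l -> l = 0.
Proof.
move=> l1 Jl; apply/eqP/negPn/negP => l0.
pose c (i : 'I_4) := l@_U_(i).
have lE : l = \sum_i c i *: 'X_i.
  apply/mpolyP => m; rewrite raddf_sum /=.
  have [/mdeg1P [i /eqP ->]|m1] := boolP (mdeg m == 1%N).
    rewrite (bigD1 i) //= mcoeffZ mcoeffX eqxx mulr1 big1 ?addr0 // => j ne.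
    by rewrite mcoeffZ mcoeffX eq_mnm1 (negPf ne) mulr0.
  rewrite (dhomog_nemf_coeff l1) // big1 // => i _; rewrite mcoeffZ mcoeffX.
  by case: eqP => [mE|]; [rewrite -mE /= mdeg1 in m1|rewrite mulr0].
have eqs v : T v ->
    c 0 * v ord0 jD - c 1 * v ord0 jB + c 2 * v ord0 jE = 0 /\
    c 1 * v ord0 jA + c 2 * v ord0 jC + c 3 * v ord0 jD = 0.
  move=> Tv; apply: point_equation_split => z.
  have := Jl v z Tv; rewrite lE raddf_sum !big_ord_recl big_ord0 /=.
  rewrite !mevalZ !mevalXU /pt /point_base /point_dir !(tnth_nth 0) /=.
  have i1 : lift ord0 ord0 = 1 :> 'I_4 by apply: val_inj.
  have i2 : lift ord0 (lift ord0 ord0) = 2 :> 'I_4 by apply: val_inj.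
  have i3 : lift ord0 (lift ord0 (lift ord0 ord0)) = 3 :> 'I_4 by apply: val_inj.
  by rewrite !mevalXU !meval0 mevalN !mevalXU i3 i2 i1.
have cancelD h : van T ('X_jD * h) -> van T h.
  by case/(van_prime unc irrT).
have e3 v : T v -> c 0 * v ord0 jA - c 2 * v ord0 jF + c 3 * v ord0 jB = 0.
  move=> Tv; have H : van T (c 0 *: 'X_jA - c 2 *: 'X_jF + c 3 *: 'X_jB).
    apply: cancelD => w Tw; rewrite mevalM mevalD mevalB !mevalZ !mevalXU.
    have [E1 E2] := eqs w Tw.
    exact: plane_equation2 (klein Tw) E1 E2.
  by have := H v Tv; rewrite mevalD mevalB !mevalZ !mevalXU.
have e4 v : T v -> c 0 * v ord0 jC + c 1 * v ord0 jF - c 3 * v ord0 jE = 0.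
  move=> Tv; have H : van T (c 0 *: 'X_jC + c 1 *: 'X_jF - c 3 *: 'X_jE).
    apply: cancelD => w Tw; rewrite mevalM mevalB mevalD !mevalZ !mevalXU.
    have [E1 E2] := eqs w Tw.
    exact: plane_equation1 (klein Tw) E1 E2.
  by have := H v Tv; rewrite mevalB mevalD !mevalZ !mevalXU.
have [i ci] : exists i, c i != 0.
  apply: contrapT => no; case/eqP: l0; rewrite lE big1 // => i _.
  have [->|ci] := eqVneq (c i) 0; first by rewrite scale0r.
  by case: no; exists i.
have ci' : [:: c 0; c 1; c 2; c 3]`_i != 0.
  move: ci; case: i => -[|[|[|[|//]]]] lt_i /=; set j := Ordinal _.
  - by rewrite (_ : j = 0) //; apply: val_inj.
  - by rewrite (_ : j = 1) //; apply: val_inj.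
  - by rewrite (_ : j = 2) //; apply: val_inj.
  - by rewrite (_ : j = 3) //; apply: val_inj.
apply: nflat; pose tab := plane_table (c 0) (c 1) (c 2) (c 3) i.
apply: (@flat_of_list K 5 unc T irrT chainT _ tab.1 tab.2 uniqj) => //.
- by move=> r; apply: plane_table_free.
- by move=> r t; apply: plane_table_id.
move=> v Tv k lt_k; have [E1 E2] := eqs v Tv.
have vE r : (r < 6)%N -> v ord0 (nth ord0 [:: jA; jC; jD; jE; jB; jF] r) =
    nth 0 [:: v ord0 jA; v ord0 jC; v ord0 jD; v ord0 jE; v ord0 jB; v ord0 jF] r.
  by case: r => [|[|[|[|[|[|//]]]]]].
rewrite vE // (plane_tableP ci' lt_k E1 E2 (e3 v Tv) (e4 v Tv)).
by apply: eq_bigr => r _; rewrite vE // plane_table_free.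
Qed.

End Plucker.

(** * Lines of a nonplanar surface fill space *)

Lemma meval_deriv0 (K : fieldType) n (g : {mpoly K[n]}) (u w : 'I_n -> K) :
    (forall e, e.+1%:R != 0 :> K) ->
    (forall i, g^`M(i) = 0 \/ u i = w i) -> g.@[u] = g.@[w].
Proof.
move=> char0 H; rewrite !mevalE; apply: eq_big_seq => m mg; congr (_ * _).
apply: eq_bigr => i _; have [gi0|->//] := H i.
case E : (m i) => [|e]; first by rewrite !expr0.
have := congr1 (mcoeff (m - U_(i))%MM) gi0; rewrite mcoeff_deriv mcoeff0.
rewrite submK ?lep1mP ?E // mnmBE mnm1E E eqxx subn1 /= => H0.
have g0 : g@_m = 0.
  by move/eqP: H0; rewrite -mulr_natr mulf_eq0 (negPf (char0 e)) orbF => /eqP.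
by move: mg; rewrite mcoeff_msupp g0 eqxx.
Qed.

Lemma mem_uniq_ord n (s : seq 'I_n) i : uniq s -> size s = n -> i \in s.
Proof.
move=> us sn; have le_s : (size (enum 'I_n) <= size s)%N by rewrite size_enum_ord sn.
by have [_ ->] := uniq_min_size us (fun x _ => mem_enum 'I_n x) le_s; rewrite mem_enum.
Qed.

Section PluckerDominant.
Variables (K : closedFieldType).
Hypothesis unc : uncountable_type K.
Hypothesis char0 : forall e, e.+1%:R != 0 :> K.
Variable T : set 'rV[K]_6.
Hypothesis irrT : irreducible_variety T.
Hypothesis chainT : irreducible_chain T 2.
Hypothesis nflat : ~ flat 2 T.
Variables jA jC jD jE jB jF : 'I_6.
Hypothesis uniqj : uniq [:: jA; jC; jD; jE; jB; jF].
Hypothesis klein : forall v, T v ->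
  v ord0 jA * v ord0 jE + v ord0 jC * v ord0 jB + v ord0 jD * v ord0 jF = 0.
Hypothesis HD : ~ van T 'X_jD.

Local Notation pb := (point_base K jD jE jB).
Local Notation pd := (point_dir K jA jC jD).

Lemma point_base1 i : tnth pb i \is 1.-homog.
Proof.
by rewrite (tnth_nth 0); case: i => -[|[|[|[|//]]]] lt_i /=;
  rewrite ?dhomog0 ?dhomogN ?variable_homog.
Qed.

Lemma point_dir1 i : tnth pd i \is 1.-homog.
Proof.
by rewrite (tnth_nth 0); case: i => -[|[|[|[|//]]]] lt_i /=;
  rewrite ?dhomog0 ?variable_homog.
Qed.

(** A line is determined by its point of height 0 and its direction: multiplied by
D, its Plücker coordinates are quadratic in (D, -B, E) and (A, C), and for the
last one this is the Klein equation. The variables kA and kC stand for A and C. *)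
Definition coordinate_quadrics (kA kC : 'I_6) : 6.-tuple {mpoly K[6]} :=
  [tuple if i == jA then 'X_0 * 'X_kA else if i == jC then 'X_0 * 'X_kC else
    if i == jD then 'X_0 * 'X_0 else if i == jE then 'X_0 * 'X_2 else
    if i == jB then - ('X_0 * 'X_1) else 'X_kC * 'X_1 - 'X_kA * 'X_2 | i < 6].

Lemma coordinate_quadrics2 kA kC i : tnth (coordinate_quadrics kA kC) i \is 2.-homog.
Proof.
have H (k l : 'I_6) : ('X_k * 'X_l : {mpoly K[6]}) \is 2.-homog.
  have X1 (p : 'I_6) : ('X_p : {mpoly K[6]}) \is 1.-homog by exact: variable_homog.
  exact: dhomogM (X1 k) (X1 l).
rewrite tnth_mktuple; do !case: ifP => _ //; rewrite ?dhomogN //.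
by apply: rpredB.
Qed.

Lemma klein_quadrics (A B C D E F w1 : K) : w1 = - B -> A * E + C * B + D * F = 0 ->
  C * w1 - A * E = D * F.
Proof. by move=> -> H; apply/eqP; rewrite -subr_eq0 -oppr_eq0; apply/eqP; rewrite -H; ring. Qed.

Lemma coordinate_quadricsE kA kC (w : 'I_6 -> K) v i : T v ->
    w 0 = v ord0 jD -> w 1 = - v ord0 jB -> w 2 = v ord0 jE ->
    w kA = v ord0 jA -> w kC = v ord0 jC ->
  (tnth (coordinate_quadrics kA kC) i).@[w] = v ord0 jD * v ord0 i.
Proof.
move=> Tv w0 w1 w2 wA wC; rewrite tnth_mktuple.
have iin := mem_uniq_ord i uniqj erefl.
case: eqP => [->|nA]; first by rewrite mevalM !mevalXU w0 wA.
case: eqP => [->|nC]; first by rewrite mevalM !mevalXU w0 wC.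
case: eqP => [->|nD]; first by rewrite mevalM !mevalXU w0.
case: eqP => [->|nE]; first by rewrite mevalM !mevalXU w0 w2.
case: eqP => [->|nB]; first by rewrite mevalN mevalM !mevalXU w0 w1 mulrN opprK.
have -> : i = jF.
  move: iin; rewrite !inE => /or4P[/eqP //|/eqP //|/eqP //|/or3P[/eqP //|/eqP //|/eqP //]].
rewrite mevalB !mevalM !mevalXU w2 wA wC; apply: klein_quadrics w1 _.
exact: klein.
Qed.

(** The roles of ix and iy, the two coordinates of the point other than w and z, can
be exchanged; the velocities A and C are adjoined in the same order. *)
Lemma point_derivative (ix iy : 'I_4) (kA kC : 'I_6) (g : {mpoly K[4]}) e :
    (ix, iy, kA, kC) \in [:: (1, 2, inord 4, inord 5); (2, 1, inord 5, inord 4)] ->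
    g \is e.-homog -> rels T pb pd g -> g != 0 ->
    (forall h d, h \is d.-homog -> rels T pb pd h -> h != 0 -> (e <= d)%N) ->
  g^`M(iy) = 0.
Proof.
move=> hi ge Jg g0 min; apply/eqP/negPn/negP => gy0.
have nD : ~ van T (tnth pb 0) by rewrite (tnth_nth 0).
have b3 : tnth pd 3 = tnth pb 0 by rewrite !(tnth_nth 0).
have [l [l1 Jl l0]] : exists l, [/\ l \is 1.-homog, rels T pb pd l & l != 0].
  have [nxy nx0 nx3 ny0 ny3] : [/\ ix != iy, ix != 0, ix != 3, iy != 0 & iy != 3].
    by move: hi; rewrite !inE => /orP[] /eqP[-> -> _ _].
  have a3 : tnth pb 3 = 0 by rewrite (tnth_nth 0).
  have b0 : tnth pd 0 = 0 by rewrite (tnth_nth 0).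
  apply: (@linear_relation K 5 unc T irrT chainT pb pd point_base1 point_dir1 ix iy
      nxy nx0 nx3 ny0 ny3 a3 b0 b3 nD (coordinate_quadrics kA kC) _ _ g e ge Jg g0 gy0 min).
    exact: coordinate_quadrics2.
  move=> v Tv j; rewrite [tnth pb 0](tnth_nth 0) /= mevalXU.
  apply: coordinate_quadricsE Tv _ _ _ _ _.
  - by rewrite /pt !(tnth_nth 0) /= !mevalXU mul0r addr0.
  - by rewrite /pt !(tnth_nth 0) /= !mevalN !mevalXU mul0r addr0.
  - by rewrite /pt !(tnth_nth 0) /= !mevalXU mul0r addr0.
  - by move: hi; rewrite !inE => /orP[] /eqP[-> -> -> _];
       rewrite /pt !(tnth_nth 0) !inordK //= mul0r addr0 mevalXU.
  - by move: hi; rewrite !inE => /orP[] /eqP[-> -> _ ->];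
       rewrite /pt !(tnth_nth 0) !inordK //= mul0r addr0 mevalXU.
by move/eqP: l0; apply; exact: (@no_linear_relation K unc T irrT chainT nflat jA jC jD jE jB jF uniqj klein HD).
Qed.

(** The moving point of a variable line of T satisfies no equation: an equation
of least degree would be linear as soon as it involves one of the two affine
coordinates transverse to the last one, and the two other coordinates are
independent. *)
Theorem point_dominant f : rels T pb pd f -> f = 0.
Proof.
move=> Jf; apply/eqP/negPn/negP => f0.
have HJ := rel_hom unc irrT point_base1 point_dir1.
pose Q d := exists g : {mpoly K[4]}, [/\ g \is d.-homog, rels T pb pd g & g != 0].
have [d0 Qd0] : exists d, Q d.
  exists (msize f).-1, (pihomog mdeg (msize f).-1 f); split; first exact: pihomogP.
    exact: HJ.2.
  apply: contraTneq (msize_sub_top (leqSpred (msize f))) => ->.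
  by rewrite subr0 -ltnNge prednK // lt0n msize_poly_eq0.
have [e [[g [ge Jg g0]] min]] := exists_minn Qd0.
have {}min h d : h \is d.-homog -> rels T pb pd h -> h != 0 -> (e <= d)%N.
  by move=> hd Jh h0; apply: min; exists h.
have g2 : g^`M(2) = 0.
  by apply: (@point_derivative 1 2 (inord 4) (inord 5) g e); rewrite ?inE ?eqxx.
have g1 : g^`M(1) = 0.
  by apply: (@point_derivative 2 1 (inord 5) (inord 4) g e); rewrite ?inE ?eqxx ?orbT.
have [v Tv Dv] : exists2 v, T v & v ord0 jD != 0.
  apply: contrapT => no; apply: HD => v Tv; rewrite mevalXU.
  by apply/eqP/negPn/negP => Dv; apply: no; exists v.
have [cT _ _] := irrT.
have : 'X_0 * g = 0 :> {mpoly K[4]}.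
  apply: (mpoly_eval0 unc) => u; rewrite mevalM mevalXU.
  have [->|u0] := eqVneq (u 0) 0; first by rewrite mul0r.
  pose c := u 0 / v ord0 jD.
  have c0 : c != 0 by rewrite mulf_neq0 ?invr_eq0.
  have Tw := proj_closed_cone cT Tv c0.
  rewrite [g.@[u]](_ : _ = 0) ?mulr0 // -(Jg _ (u 3 / u 0) Tw).
  apply: (meval_deriv0 char0) => i; have [->|->|->|->] : [\/ i = 0, i = 3, i = 1 | i = 2].
  - exact: (@ord4_cases 1 2).
  - by right; rewrite /pt !(tnth_nth 0) /= meval0 mulr0 addr0 mevalXU mxE /c divfK.
  - by right; rewrite /pt !(tnth_nth 0) /= meval0 add0r mevalXU mxE /c divfK // divfK.
  - by left.
  - by left.
by move/eqP; rewrite mulf_eq0 (negPf g0) orbF; apply/negP; rewrite -msize_poly_eq0 msizeX.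
Qed.

End PluckerDominant.

(** * Primes of height one *)

Lemma divides_msize (K : fieldType) n (f g : {mpoly K[n]}) :
  divides f g -> g != 0 -> (msize f <= msize g)%N.
Proof.
case=> c gE; rewrite gE mulf_eq0 negb_or => /andP[c0 f0].
by rewrite msizeM //; move: c0 f0; rewrite -!msize_poly_eq0; move: (msize c) (msize f); lia.
Qed.

Lemma muni_neq0 (K : fieldType) n (f : {mpoly K[n.+1]}) : f != 0 -> muni f != 0.
Proof.
by apply: contraNneq => H; rewrite -(muniK f) H; apply/eqP; exact: raddf0.
Qed.

Section Principal.
Local Opaque muni.
Variables (K : fieldType) (N : nat).
Local Notation S := {mpoly K[N.+1]}.
Variable J : S -> Prop.
Hypothesis IJ : ideal J.
Hypothesis pJ : prime_ideal J.
Hypothesis elim : forall p : {mpoly K[N]}, J (mwiden p) -> p = 0.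

(** A prime ideal with no equation free of the last variable has height at most
one: by pseudo-division, an irreducible element of least degree in the last
variable divides all the others. *)
Lemma principal_of_elimination (f0 : S) : J f0 -> f0 != 0 ->
  exists Phi, [/\ J Phi, Phi != 0 & forall f, J f -> divides Phi f].
Proof.
move=> Jf0 f00; have [J0 _ JM] := IJ.
have J1 : ~ J 1.
  by move=> J1; have := elim (p := 1); rewrite mwiden1 => /(_ J1) /eqP; rewrite oner_eq0.
pose Q d := exists p : S, [/\ J p, p != 0 & size (muni p) = d].
have [d [[Psi [JPsi Psi0 sPsi]] min]] : exists d, Q d /\ forall k, Q k -> (d <= k)%N.
  exact: (@exists_minn Q (size (muni f0)) (ex_intro _ f0 (And3 Jf0 f00 erefl))).
have {}min p : J p -> p != 0 -> (d <= size (muni p))%N.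
  by move=> Jp p0; exact: (min _ (ex_intro _ p (And3 Jp p0 erefl))).
have [u [s [[v uv] ps PsiE]]] := factorial_mpoly Psi0.
have [Phi pPhi JPhi] : exists2 p, p \in s & J p.
  have : J (\prod_(p <- s) p).
    by have := JPsi; rewrite PsiE => /pJ [Ju|//]; case: J1; rewrite uv; apply: JM.
  elim: (s) => [|p t IHt]; first by rewrite big_nil => /J1.
  rewrite big_cons => /pJ [Jp|/IHt [r rt Jr]]; first by exists p; rewrite ?mem_head.
  by exists r; rewrite // inE rt orbT.
have [Phi0 _ PhiM] := ps _ pPhi; exists Phi; split=> // f Jf.
have sPhi : (size (muni Phi) <= d)%N.
  have [c cE] : exists c, Psi = c * Phi.
    have : divides Phi (\prod_(p <- s) p).
      elim: (s) pPhi => // p t IHt; rewrite inE big_cons => /orP[/eqP <-|/IHt H].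
        by apply: divides_mulr; apply: divides_refl.
      exact: divides_mull.
    by case=> c cE; exists (u * c); rewrite PsiE cE mulrA.
  have c0 : c != 0 by apply: contra_neq Psi0 => c0; rewrite cE c0 mul0r.
  have sz : size (muni Psi) = (size (muni c) + size (muni Phi)).-1.
    rewrite cE; apply: (etrans (congr1 (fun g => size (polyseq g)) (muniM c Phi))).
    exact: size_mul (muni_neq0 c0) (muni_neq0 Phi0).
  have sc : size (muni c) != 0%N by rewrite size_poly_eq0; exact: muni_neq0 c0.
  have le_pred (a b : nat) : a != 0%N -> (b <= (a + b).-1)%N by lia.
  exact: (leq_trans (le_pred _ _ sc) (eq_leq (etrans (esym sz) sPsi))).
have H := Pdiv.Idomain.divp_eq (muni f) (muni Phi).
set r := (_ %% _) in H; set qq := (_ %/ _) in H; set k := scalp _ _ in H.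
have Phi0' := muni_neq0 Phi0.
have lt_r : (size r < size (muni Phi))%N by rewrite Pdiv.Idomain.ltn_modp.
pose l := lead_coef (muni Phi).
have E : mwiden (l ^+ k) * f = of_uni qq * Phi + of_uni r.
  rewrite -(muniK Phi) -of_uniM -of_uniD -H -mul_polyC of_uniM of_uniC.
  by rewrite muniK.
have Jr : J (of_uni r).
  have -> : of_uni r = mwiden (l ^+ k) * f - of_uni qq * Phi by rewrite E addrC addKr.
  by apply: idealB => //; apply: JM.
have r0 : of_uni r = 0.
  apply/eqP/negPn/negP => nr; have := min _ Jr nr; rewrite of_uniK leqNgt.
  by move/negP; apply; apply: leq_trans lt_r sPhi.
have : divides Phi (mwiden (l ^+ k) * f) by exists (of_uni qq); rewrite E r0 addr0.
case/PhiM => // -[c cE].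
have /elim /eqP : J (mwiden (l ^+ k)) by rewrite cE; apply: JM.
by rewrite expf_eq0 lead_coef_eq0 (negPf Phi0') andbF.
Qed.

(** The top form of a generator has the same degree, so it is a generator too. *)
Lemma homogeneous_generator (f0 : S) : hom_ideal J -> J f0 -> f0 != 0 ->
  exists (Phi : S) (d : nat),
    [/\ Phi \is d.-homog, J Phi, Phi != 0 & forall f, J f -> divides Phi f].
Proof.
move=> HJ Jf0 f00; have [Phi [JPhi Phi0 PhiP]] := principal_of_elimination Jf0 f00.
have mPhi : (0 < msize Phi)%N by rewrite lt0n msize_poly_eq0.
pose h := pihomog mdeg (msize Phi).-1 Phi.
have hd : h \is (msize Phi).-1.-homog by apply: pihomogP.
have h0 : h != 0.
  apply: contraTneq (msize_sub_top (leqSpred (msize Phi))); rewrite -/h => ->.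
  by rewrite subr0 -ltnNge prednK.
have Jh : J h by apply: HJ.2.
exists h, (msize Phi).-1; split=> // f /PhiP [b ->]; apply: divides_mull.
have [c hE] := PhiP _ Jh.
have c0 : c != 0 by apply: contra_neq h0 => c0; rewrite hE c0 mul0r.
have := msizeM c0 Phi0; rewrite -hE (homog_msizeE hd h0) prednK // => sE.
have [k cE] : exists k, c = k%:MP.
  exists c@_0; apply/msize1_polyC; move: sE mPhi; move: (msize c) (msize Phi); lia.
have k0 : k != 0 by move: c0; rewrite cE mpolyC_eq0.
by exists (k^-1)%:MP; rewrite hE cE mulrA -mpolyCM mulVf // mul1r.
Qed.

End Principal.

(** * The degree of a generator *)

Lemma mderiv_last_eq0 (K : fieldType) N (f : {mpoly K[N.+1]}) :
    uncountable_type K -> (forall e, e.+1%:R != 0 :> K) ->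
  f^`M(ord_max) = 0 -> f = mwiden (muni f)`_0.
Proof.
move=> unc char0 df; apply/eqP; rewrite -subr_eq0; apply/eqP.
apply: (mpoly_eval0 unc) => u; rewrite mevalB meval_mwiden.
pose w i := if i == ord_max then 0 else u i.
rewrite (@meval_deriv0 _ _ _ u w char0); last first.
  move=> i; have [->|/negPf ni] := eqVneq i ord_max; first by left.
  by right; rewrite /w ni.
rewrite meval_muni /w eqxx horner_coef0 coef_map /=.
apply/eqP; rewrite subr_eq0; apply/eqP; apply: meval_eq => i.
by rewrite -val_eqE /= ltn_eqF.
Qed.

Lemma bin4_lower k : (k ^ 4 <= 24 * 'C(k + 4, 4))%N.
Proof.
have := bin_ffact (k + 4) 4; rewrite !ffactnS ffactn0 !factS fact0 => H.
by move: H; rewrite !addnS /= addn0; move: 'C(_, _) => c; nia.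
Qed.

Lemma bin3_lower k : (k ^ 3 <= 6 * 'C(k + 4, 3))%N.
Proof.
have := bin_ffact (k + 4) 3; rewrite !ffactnS ffactn0 !factS fact0 => H.
by move: H; rewrite !addnS /= addn0; move: 'C(_, _) => c; nia.
Qed.

Lemma bin4_step k d : ('C(k + 4, 4) + d * 'C(k + 4, 3) <= 'C(k + d + 4, 4))%N.
Proof.
elim: d => [|d IHd]; first by rewrite mul0n !addn0.
have -> : (k + d.+1 + 4 = (k + d + 4).+1)%N by lia.
rewrite binS mulSn addnCA addnC leq_add // {IHd}.
by apply: leq_bin2l; rewrite leq_add2r leq_addr.
Qed.

Lemma bin4C k : 'C(k + 4, k) = 'C(k + 4, 4).
Proof. by rewrite -[RHS]bin_sub ?leq_addl // addnK. Qed.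

Section GeneratorDegree.
Variables (K : fieldType) (J : {mpoly K[5]} -> Prop) (k0 D : nat).
Hypothesis IJ : ideal J.
Hypothesis hfJ : forall k, (k0 <= k)%N -> (hf J k <= k.+1 * (D.+1 * k ^ 2))%N.
Local Notation Z := (@zero_ideal {mpoly K[5]}).

(** Without equations the Hilbert function in five variables would have degree
four, whereas that of J is at most cubic. *)
Lemma cubic_growth_neq0 : exists2 f, J f & f != 0.
Proof.
apply: contrapT => no.
have H k : (k0 <= k)%N -> (k ^ 4 <= 24 * (k.+1 * (D.+1 * k ^ 2)))%N.
  move=> le_k; apply: leq_trans (bin4_lower k) _; rewrite leq_pmul2l // -bin4C.
  rewrite -(@hf_zero_ideal K) (leq_trans _ (hfJ le_k)) //.
  apply: hf_sub => // [|p _ Jp]; first exact: zero_ideal_ideal.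
  by apply/eqP/negPn/negP => p0; apply: no; exists p.
pose k := (k0 + 48 * D.+1).+1; have := H k; rewrite /k => /(_ ltac:(lia)).
clear; move: (D.+1) => b; set t := _.+1; have : (48 * b < t)%N by rewrite /t; lia.
have : (0 < t)%N by []; move: t => t.
move=> t0 lt_t; apply/negP; rewrite -ltnNge.
apply: (@leq_ltn_trans (48 * b * t ^ 3)%N); first by rewrite !expnS expn0; nia.
by rewrite [X in (_ < X)%N]expnS ltn_pmul2r // expn_gt0 t0.
Qed.

Variables (Phi : {mpoly K[5]}) (d : nat).
Hypothesis Phid : Phi \is d.-homog.
Hypothesis PhiP : forall f, J f -> divides Phi f.

(** The forms of degree k + d modulo the multiples of Phi are at least as
numerous as d cubic polynomials in k. *)
Lemma generator_degree : (d <= 48 * D.+1)%N.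
Proof.
have HZ := zero_ideal_hom K 4.
have H k : (k0 <= k)%N -> (d * k ^ 3 <= 6 * ((k + d).+1 * (D.+1 * (k + d) ^ 2)))%N.
  move=> le_k; have le_kd : (k0 <= k + d)%N by rewrite (leq_trans le_k) ?leq_addr.
  have := hf_exact k HZ Phid; rewrite hf_zero_ideal bin4C.
  have : (hf (colon Z Phi) k <= 'C(k + 4, 4))%N.
    rewrite -bin4C -(@hf_zero_ideal K); apply: hf_sub => [||p _ ->].
    - exact: HZ.1.
    - by apply: colon_ideal; exact: HZ.1.
    - by rewrite /colon mul0r.
  have : (hf (addp Z Phi) (k + d) <= hf J (k + d))%N.
    apply: hf_sub => [//||p _ /PhiP [g gE]]; first by apply: addp_ideal; exact: HZ.1.
    by exists g; rewrite gE subrr.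
  have := hfJ le_kd; have := bin4_step k d; have := bin3_lower k.
  move: (hf J _) (hf (addp _ _) _) (hf (colon _ _) _) => h1 h2 h3.
  move: 'C(_, _) 'C(_, _) 'C(_, _) => c1 c2 c3; move: (k ^ 3)%N ((k + d).+1 * _)%N => x y.
  by clear; nia.
pose k := (k0 + d).+1; have := H k; rewrite /k => /(_ ltac:(lia)).
clear; move: (D.+1) => b; set t := _.+1; have : (d < t)%N by rewrite /t; lia.
move: t => t lt_t H.
have t0 : (0 < t ^ 3)%N by rewrite expn_gt0 (leq_ltn_trans _ lt_t).
rewrite -(leq_pmul2r t0); apply: leq_trans H _.
have : ((t + d).+1 * (t + d) ^ 2 <= 2 * t * (2 * t) ^ 2)%N.
  by apply: leq_mul; [lia|rewrite leq_exp2r //; lia].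
by rewrite !expnS expn0; nia.
Qed.

End GeneratorDegree.

(** * The equation of one more coordinate *)

Section FifthCoordinate.
Variables (K : closedFieldType).
Hypothesis unc : uncountable_type K.
Hypothesis char0 : forall e, e.+1%:R != 0 :> K.
Variable T : set 'rV[K]_6.
Hypothesis irrT : irreducible_variety T.
Hypothesis chainT : irreducible_chain T 2.
Hypothesis nchainT : ~ irreducible_chain T 3.
Hypothesis nflat : ~ flat 2 T.
Variable D : nat.
Hypothesis degT : variety_degree T D.
Variables jA jC jD jE jB jF : 'I_6.
Hypothesis uniqj : uniq [:: jA; jC; jD; jE; jB; jF].
Hypothesis klein : forall v, T v ->
  v ord0 jA * v ord0 jE + v ord0 jC * v ord0 jB + v ord0 jD * v ord0 jF = 0.
Hypothesis HD : ~ van T 'X_jD.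
Variable jM : 'I_6.

Local Notation pb := (point_base K jD jE jB).
Local Notation pd := (point_dir K jA jC jD).
Local Notation pb5 := [tuple of rcons pb 'X_jM].
Local Notation pd5 := [tuple of rcons pd 0].

(** The moving point together with one more coordinate of its line satisfies a
single equation, whose degree is controlled by that of T. *)
Theorem coordinate_relation : exists (Phi : {mpoly K[5]}) (d : nat),
  [/\ Phi \is d.-homog, rels T pb5 pd5 Phi,
      forall f, rels T pb5 pd5 f -> divides Phi f,
      Phi^`M(ord_max) != 0 & (d <= 48 * D.+1)%N].
Proof.
have pb51 : forall i, tnth pb5 i \is 1.-homog.
  by apply: rcons_homog (point_base1 K jD jE jB) _; rewrite dhomogX /= mdeg1.
have pd51 : forall i, tnth pd5 i \is 1.-homog.
  by apply: rcons_homog (point_dir1 K jA jC jD) _; rewrite dhomog0.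
have HJ := rel_hom unc irrT pb51 pd51.
have pJ : prime_ideal (rels T pb5 pd5) by exact: (@rel_prime K 5 4 unc T pb5 pd5 irrT).
have elim (p : {mpoly K[4]}) : rels T pb5 pd5 (mwiden p) -> p = 0.
  move=> Jp; apply: (@point_dominant K unc char0 T irrT chainT nflat
    jA jC jD jE jB jF uniqj klein HD).
  by have := Jp; rewrite rel_mwiden.
have [cT _ _] := irrT.
have [k0 hfT] := hf_van_upper unc cT nchainT degT.
have hfJ k : (k0 <= k)%N -> (hf (rels T pb5 pd5) k <= k.+1 * (D.+1 * k ^ 2))%N.
  move=> le_k; have le := hf_rel_le unc T pb51 pd51 k.
  apply: (leq_trans le).
  by rewrite leq_mul2l hfT.
have [f0 Jf0 f00] := cubic_growth_neq0 HJ.1 hfJ.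
have [Phi [d [Phid JPhi Phi0 PhiP]]] := homogeneous_generator HJ.1 pJ elim HJ Jf0 f00.
exists Phi, d; split=> //; last exact: generator_degree HJ.1 hfJ _ _ Phid PhiP.
apply: contra_neq Phi0 => /(mderiv_last_eq0 unc char0) E.
by have := JPhi; rewrite E => /elim ->; rewrite mwiden0.
Qed.

End FifthCoordinate.

(** * Lines on a hypersurface *)

Lemma bin2_double n : (2 * 'C(n + 2, 2) = (n + 2) * (n + 1))%N.
Proof.
have := bin_ffact (n + 2) 2; rewrite !ffactnS ffactn0 !factS fact0 => H.
by move: H; rewrite !addnS /= addn0; move: 'C(_, _) => c; nia.
Qed.

Lemma bin3_diff m e : ('C(m + e, 3) <= 'C(m, 3) + e * 'C(m + e, 2))%N.
Proof.
elim: e => [|e IHe]; first by rewrite mul0n !addn0.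
rewrite addnS binS mulSn; have := leq_bin2l 2 (leqnSn (m + e)).
by move: IHe; move: 'C(_, _) 'C(_, _) 'C(_, _) 'C(_, _) => a b c f; clear; nia.
Qed.

Lemma bin4_second_diff m d e :
  ('C(m + d + e, 4) + 'C(m, 4) <= 'C(m + d, 4) + 'C(m + e, 4) + d * e * 'C(m + d + e, 2))%N.
Proof.
elim: d => [|d IHd]; first by rewrite mul0n !addn0 addnC.
rewrite addnS addSn !binS mulSn mulnDl.
have := bin3_diff (m + d) e; have := leq_bin2l 2 (leqnSn (m + d + e)).
rewrite binS; move: IHd; move: 'C(_, _) 'C(_, _) 'C(_, _) 'C(_, _) 'C(_, _) 'C(_, _) 'C(_, _).
by move=> a b c f g h i; move: 'C(_, _) => j; clear; nia.
Qed.

(** Two successive exact sequences express the Hilbert function of (Phi, G) by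
a second difference of binomial coefficients. *)
Lemma hf_two_equations (K : fieldType) (J : {mpoly K[5]} -> Prop) Phi G d e k :
    hom_ideal J -> prime_ideal J -> Phi \is d.-homog -> G \is e.-homog ->
    J Phi -> Phi != 0 -> (forall f, J f -> divides Phi f) -> ~ J G ->
  (hf (addp J G) (k + d + e) <= d * e * 'C(k + 4 + d + e, 2))%N.
Proof.
move=> HJ pJ Phid Ge JPhi Phi0 PhiP nG; have [J0 JD JM] := HJ.1.
have HZ := zero_ideal_hom K 4; have pZ : prime_ideal (@zero_ideal {mpoly K[5]}) := @zero_ideal_prime K 4.
pose Z := @zero_ideal {mpoly K[5]}.
have hfZ j : hf Z j = 'C(j + 4, 4) by rewrite hf_zero_ideal bin4C.
have IZPhi : ideal (addp Z Phi) by apply: addp_ideal; exact: HZ.1.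
have hfJ j : hf (addp Z Phi) j = hf J j.
  apply/eqP; rewrite eqn_leq; apply/andP; split; apply: hf_sub => //; try exact: HJ.1.
    by move=> p _ /PhiP [g gE]; exists g; rewrite gE subrr.
  by move=> p _ [g /eqP]; rewrite subr_eq0 => /eqP ->; apply: JM.
have hfC j : hf (colon Z Phi) j = 'C(j + 4, 4).
  rewrite -hfZ; apply/eqP; rewrite eqn_leq; apply/andP; split; apply: hf_sub => //;
    try exact: HZ.1; try (apply: colon_ideal; exact: HZ.1).
    by move=> p _ ->; rewrite /colon mul0r.
  by move=> p _ /pZ [//|/eqP]; rewrite (negPf Phi0).
have hfG : (hf J (k + d) <= hf (colon J G) (k + d))%N.
  apply: hf_sub; [apply: colon_ideal; exact: HJ.1|exact: HJ.1|].
  by move=> p _ /pJ [].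
have := hf_exact (k + d) HJ Ge.
have := hf_exact (k + e) HZ Phid; rewrite -/Z hfZ hfC hfJ.
have := hf_exact k HZ Phid; rewrite -/Z hfZ hfC hfJ.
have := bin4_second_diff (k + 4) d e.
rewrite (addnAC k e d) (addnAC k 4 d) (addnAC (k + d) 4 e) (addnAC k 4 e).
move: hfG; move: (hf J _) (hf J _) (hf (colon _ _) _) (hf (addp _ _) _) => a b c h.
by move: 'C(_, _) 'C(_, _) 'C(_, _) 'C(_, _) (_ * _)%N => c1 c2 c3 c4 x; clear; lia.
Qed.

Lemma inter_hom (K : fieldType) n (X : eqType) (I : X -> {mpoly K[n.+1]} -> Prop)
    (s : seq X) :
  (forall x, hom_ideal (I x)) -> hom_ideal (fun f => forall x, x \in s -> I x f).
Proof.
move=> HI; split=> [|p d Ip y ys]; last by apply: (HI y).2; apply: Ip.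
split=> [y ys|f g If Ig y ys|a f If y ys]; have [[Iy0 IyD IyM] _] := HI y => //.
  by apply: IyD; [apply: If|apply: Ig].
by apply: IyM; apply: If.
Qed.

(** Linear forms separating the members of a family of prime ideals make their
Hilbert functions add up. *)
Lemma hf_separated (K : fieldType) n (X : eqType) (I : X -> {mpoly K[n.+1]} -> Prop)
    (b : nat -> nat) (s : seq X) k :
    (forall x, hom_ideal (I x)) -> (forall x, prime_ideal (I x)) ->
    (forall x, ~ I x 1) ->
    {homo b : i j / (i <= j)%N} -> (forall x j, (b j <= hf (I x) j)%N) ->
    {in s &, forall x y, x != y -> exists l, [/\ l \is 1.-homog, I y l & ~ I x l]} ->
    uniq s ->
  (size s * b k <= hf (fun f => forall x, x \in s -> I x f) (k + size s))%N.
Proof.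
move=> HI pI nI1 b_mono bI; elim: s k => [//|x s IHs] k sep /= /andP[xs us].
pose Is (s : seq X) f := forall x, x \in s -> I x f.
have HIs t : hom_ideal (Is t) := inter_hom t HI.
have [f [fd Isf nIf]] : exists f, [/\ f \is (size s).-homog, Is s f & ~ I x f].
  have : forall y, y \in s -> exists l, [/\ l \is 1.-homog, I y l & ~ I x l].
    move=> y ys; apply: sep; rewrite ?mem_head ?inE ?ys ?orbT //.
    by apply: contraNneq xs => ->.
  elim: (s) => [_|y t IHt H]; first by exists 1; split; rewrite ?dhomog1 //; exact: nI1.
  have [l [l1 Il nIl]] := H y (mem_head _ _).
  have [|f [fd If nIf]] := IHt; first by move=> z zt; apply: H; rewrite inE zt orbT.
  exists (l * f); split; first exact: (dhomogM l1 fd).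
    move=> z; have [[_ _ IzM] _] := HI z; rewrite inE => /orP[/eqP zy|zt].
      by rewrite mulrC; apply: IzM; rewrite zy.
    by apply: IzM; apply: If.
  by case/pI.
rewrite mulSn addnS -addSn -/(Is (x :: s)) (hf_exact _ (HIs _) fd); apply: leq_add.
  apply: leq_trans (b_mono _ _ (leqnSn k)) _; apply: leq_trans (bI x _) _.
  apply: hf_sub; [apply: colon_ideal; exact: (HIs _).1|exact: (HI x).1|].
  by move=> p _ /(_ x (mem_head _ _)) /pI [].
apply: leq_trans (leq_mul (leqnn _) (b_mono _ _ (leqnSn k))) _.
apply: leq_trans (IHs k.+1 _ us) _.
  by move=> y z ys zs; apply: sep; rewrite inE ?ys ?zs orbT.
apply: hf_sub; [apply: addp_ideal; exact: (HIs _).1|exact: (HIs s).1|].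
move=> p _ [g H] y ys; rewrite -[p](subrK (g * f)).
have [[_ IyD IyM] _] := HI y; apply: IyD; last by apply: IyM; apply: Isf.
by apply: H; rewrite inE ys orbT.
Qed.

Section LineIdeals.
Variable K : fieldType.
Hypothesis unc : uncountable_type K.
Implicit Types (l : K * K * K * K) (f g : {mpoly K[5]}).

(** The quadruple (A, B, C, E) stands for the line x = A z - B, y = C z + E. *)
Definition line_param l : 5.-tuple {mpoly K[3]} :=
  let: (A, B, C, E) := l in
  [tuple 'X_0; A *: 'X_1 - B *: 'X_0; C *: 'X_1 + E *: 'X_0; 'X_1; 'X_2].

Definition line_point l (w z s : K) (i : 'I_5) : K :=
  let: (A, B, C, E) := l in [:: w; A * z - B * w; C * z + E * w; z; s]`_i.

(** The ideal of the product of a line with the axis of the last coordinate. *)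
Definition line_ideal l f := f \mPo line_param l = 0.

Lemma line_param1 l i : tnth (line_param l) i \is 1.-homog.
Proof.
have X1 (j : 'I_3) : ('X_j : {mpoly K[3]}) \is 1.-homog by rewrite dhomogX /= mdeg1.
case: l => [[[A B] C] E]; rewrite (tnth_nth 0); case: i => -[|[|[|[|[|//]]]]] lt_i //=.
  by apply: rpredB; apply: rpredZ.
by apply: rpredD; apply: rpredZ.
Qed.

Lemma line_idealP l f : line_ideal l f <-> forall w z s, f.@[line_point l w z s] = 0.
Proof.
have E (u : 'I_3 -> K) : (f \mPo line_param l).@[u] = f.@[line_point l (u 0) (u 1) (u 2)].
  rewrite comp_mpoly_meval; apply: meval_eq => i.
  case: l => [[[A B] C] F]; rewrite (tnth_nth 0); case: i => -[|[|[|[|[|//]]]]] lt_i /=;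
    by rewrite ?mevalB ?mevalD ?mevalZ !mevalXU.
split=> [Hf w z s|H]; last by apply: (mpoly_eval0 unc) => u; rewrite E.
have := E (fun i => [:: w; z; s]`_i); rewrite Hf meval0 => ->.
by apply: meval_eq => i.
Qed.

Lemma line_ideal_hom l : hom_ideal (line_ideal l).
Proof.
split=> [|p d Ip]; last first.
  by rewrite /line_ideal -(pihomog_comp _ _ (line_param1 l)) Ip raddf0.
split; rewrite /line_ideal; first exact: comp_mpoly0.
  by move=> f g If Ig; rewrite comp_mpolyD If Ig addr0.
by move=> a f If; rewrite rmorphM /= If mulr0.
Qed.

Lemma line_ideal_prime l : prime_ideal (line_ideal l).
Proof.
move=> f g; rewrite /line_ideal rmorphM /= => /eqP.
by rewrite mulf_eq0 => /orP[] /eqP; [left|right].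
Qed.

Lemma hf_line_ideal l k : ('C(k + 2, 2) <= hf (line_ideal l) k)%N.
Proof.
have -> : 'C(k + 2, 2) = hf (@zero_ideal {mpoly K[3]}) k.
  by rewrite hf_zero_ideal -[RHS]bin_sub ?leq_addr // addKn.
pose t : 3.-tuple {mpoly K[5]} := [tuple 'X_0; 'X_3; 'X_4].
rewrite -[k in hf (line_ideal l) k]mul1n; apply: (@hf_comp_le _ _ _ 1 t).
- by move=> i; rewrite (tnth_nth 0); case: i => -[|[|[|//]]] lt_i /=; rewrite dhomogX /= mdeg1.
- exact: zero_ideal_ideal.
- exact: (line_ideal_hom l).1.
move=> f _ /line_idealP H; apply: (mpoly_eval0 unc) => u.
rewrite -(H (u 0) (u 1) (u 2)) comp_mpoly_meval; apply: meval_eq => i.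
by case: l H => [[[A B] C] E] _; rewrite (tnth_nth 0);
  case: i => -[|[|[|//]]] lt_i; rewrite /= mevalXU /=; congr u; apply: val_inj.
Qed.

Lemma line_ideal_separated l l' : l != l' ->
  exists h, [/\ h \is 1.-homog, line_ideal l' h & ~ line_ideal l h].
Proof.
have X1 (j : 'I_5) : ('X_j : {mpoly K[5]}) \is 1.-homog by rewrite dhomogX /= mdeg1.
case: l l' => [[[A B] C] E] [[[A' B'] C'] E']; rewrite !xpair_eqE => ne.
pose h1 : {mpoly K[5]} := 'X_1 - A' *: 'X_3 + B' *: 'X_0.
pose h2 : {mpoly K[5]} := 'X_2 - C' *: 'X_3 - E' *: 'X_0.
have [AB|AB] := boolP ((A == A') && (B == B')).
  exists h2; split.
  - by apply: rpredB; [apply: rpredB|] => //; apply: rpredZ.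
  - by apply/line_idealP => w z s; rewrite !mevalB !mevalZ !mevalXU /=; ring.
  move=> /line_idealP H; move: ne; rewrite AB /=.
  have := H 0 1 0; rewrite !mevalB !mevalZ !mevalXU /= => HC.
  have := H 1 0 0; rewrite !mevalB !mevalZ !mevalXU /= => HE.
  have -> : C = C' by apply/eqP; rewrite -subr_eq0; apply/eqP; rewrite -HC; ring.
  have -> : E = E' by apply/eqP; rewrite -subr_eq0; apply/eqP; rewrite -HE; ring.
  by rewrite !eqxx.
exists h1; split.
- by apply: rpredD; [apply: rpredB|] => //; apply: rpredZ.
- by apply/line_idealP => w z s; rewrite mevalD mevalB !mevalZ !mevalXU /=; ring.
move=> /line_idealP H; case/negP: AB.
have := H 0 1 0; rewrite mevalD mevalB !mevalZ !mevalXU /= => HA.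
have := H 1 0 0; rewrite mevalD mevalB !mevalZ !mevalXU /= => HB.
have -> : A = A' by apply/eqP; rewrite -subr_eq0; apply/eqP; rewrite -HA; ring.
have -> : B = B' by apply/eqP; rewrite eq_sym -subr_eq0; apply/eqP; rewrite -HB; ring.
by rewrite !eqxx.
Qed.

Lemma line_ideal_deriv l f : line_ideal l f -> line_ideal l f^`M(ord_max).
Proof.
move=> /line_idealP If; apply/line_idealP => w z s.
pose h (i : 'I_5) := if i == ord_max then 'X else (line_point l w z 0 i)%:P.
have hE x (i : 'I_5) : (h i).[x] = line_point l w z x i.
  rewrite /h {h}; case: l If => [[[A B] C] E] _; case: eqP => [->|ne]; first by rewrite hornerX.
  by rewrite hornerC; case: i ne => -[|[|[|[|[|//]]]]] lt_i //= ne; case: ne; exact: val_inj.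
have h0 : line_poly h f = 0.
  apply: (@poly_vanish _ _ [::]) => // x _.
  by rewrite horner_line_poly -(If w z x); apply: meval_eq => i; rewrite hE.
have := deriv_line_poly h f; rewrite h0 deriv0 (bigD1 ord_max) //=.
rewrite big1 ?addr0 => [|i /negPf ne]; last by rewrite /h ne derivC mulr0.
rewrite {2}/h eqxx derivX mulr1 => /(congr1 (fun p : {poly K} => p.[s])).
rewrite horner0 horner_line_poly => /esym; rewrite (@meval_eq _ _ _ (line_point l w z s)) //.
Qed.

End LineIdeals.

(** Where Phi vanishes on the product of a line with the last axis, so does its
derivative in the last variable; the two equations have no common factor, so
that Bezout's inequality bounds the number of these products. *)
Theorem lines_on_surface (K : fieldType) (J : {mpoly K[5]} -> Prop) Phi d
    (s : seq (K * K * K * K)) :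
    uncountable_type K -> hom_ideal J -> prime_ideal J -> Phi \is d.-homog ->
    J Phi -> (forall f, J f -> divides Phi f) -> Phi^`M(ord_max) != 0 ->
    uniq s -> (forall l, l \in s -> line_ideal l Phi) ->
  (size s <= 4 * d ^ 2)%N.
Proof.
move=> unc HJ pJ Phid JPhi PhiP G0 us sPhi; set G := Phi^`M(ord_max) in G0.
have Ge : G \is d.-1.-homog := mderiv_homog ord_max Phid.
have Phi0 : Phi != 0 by apply: contra_neq G0 => P0; rewrite /G P0 raddf0.
have nG : ~ J G.
  move=> /PhiP /divides_msize /(_ G0); rewrite (homog_msizeE Phid Phi0) (homog_msizeE Ge G0).
  case: d Phid {Ge} => [Phid _|d _]; last by rewrite ltnn.
  move: G0; rewrite /G; have /msize1_polyC -> : (msize Phi <= 1)%N by rewrite (homog_msizeE Phid Phi0).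
  by rewrite mderivC eqxx.
(* The degrees k + N and k1 + d + d.-1 agree, and k is so large that the two
binomial coefficients have a ratio of at most 4. *)
pose N := size s; pose k := (N + d + d.-1 + 10)%N; pose k1 := (2 * N + 10)%N.
have := hf_two_equations k1 HJ pJ Phid Ge JPhi Phi0 PhiP nG.
have := @hf_separated K 4 _ (@line_ideal K) (fun j => 'C(j + 2, 2)) s k
  (@line_ideal_hom K) (@line_ideal_prime K) _ _ (@hf_line_ideal K unc) _ us.
have -> : (k + size s = k1 + d + d.-1)%N by rewrite -/N /k /k1; lia.
set h1 := hf _ _; set h2 := hf _ _ => H1 H2.
have h12 : (h1 <= h2)%N.
  apply: hf_sub => [||f _ [g Jf] l ls]; first by apply: addp_ideal; exact: HJ.1.
    exact: (inter_hom s (@line_ideal_hom K)).1.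
  have [[_ ID IM] _] := line_ideal_hom l; rewrite -[f](subrK (g * G)); apply: ID.
    by have [c ->] := PhiP _ Jf; apply: IM; apply: sPhi.
  by apply: IM; apply: line_ideal_deriv => //; apply: sPhi.
have {}H1 : (N * 'C(k + 2, 2) <= h1)%N.
  apply: H1 => [x|i j le_ij|x y _ _]; last exact: line_ideal_separated.
    by rewrite /line_ideal comp_mpoly1 => /eqP; rewrite oner_eq0.
  by apply: leq_bin2l; rewrite leq_add2r.
have {H1 h12 H2} : (N * 'C(k + 2, 2) <= d * d.-1 * 'C(k1 + 4 + d + d.-1, 2))%N.
  by apply: leq_trans H1 (leq_trans h12 H2).
have [i iE] : exists i, (k1 + 4 + d + d.-1 = i + 2)%N by exists (k1 + 2 + d + d.-1)%N; lia.
have le_i : (i + 2 <= 2 * (k + 1))%N by rewrite -iE /k /k1; clear; lia.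
rewrite iE -/N; move: (bin2_double k) (bin2_double i) le_i; clearbody k; clearbody N; clear.
have : (d * d.-1 <= d ^ 2)%N by rewrite expnS expn1 leq_mul2l leq_pred orbT.
move: (d * _)%N (d ^ 2)%N 'C(_, _) 'C(_, _) N => e f c' c N ef cE c'E le_i H.
have le_c : (c' <= 4 * c)%N.
  have : ((i + 2) * (i + 1) <= (2 * (k + 1)) * (2 * (k + 2)))%N by apply: leq_mul; lia.
  have -> : (2 * (k + 1) * (2 * (k + 2)) = 4 * ((k + 2) * (k + 1)))%N by ring.
  by rewrite -c'E -cE; clear; lia.
have c0 : (0 < c)%N by move: cE; clear; nia.
rewrite -(leq_pmul2r c0); apply: leq_trans H _.
by apply: leq_trans (leq_mul ef le_c) _; rewrite mulnA [(f * 4)%N]mulnC.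
Qed.

(** * Counting incidences *)

Section CountOnLines.
Variables (K : closedFieldType) (X Y : eqType) (P : seq X) (L : seq Y).
Variables (inc : X -> Y -> bool) (pos : X -> K * K * K) (quad : Y -> K * K * K * K).
Hypothesis unc : uncountable_type K.
Hypothesis uP : uniq P.
Hypothesis uL : uniq L.
Hypothesis pos_inj : {in P &, injective pos}.
Hypothesis quad_inj : {in L &, injective quad}.
Hypothesis incE : forall p l, p \in P -> l \in L -> inc p l ->
  let: (x, y, z) := pos p in let: (A, B, C, E) := quad l in
  x = A * z - B /\ y = C * z + E.
Variables (val : Y -> K) (J : {mpoly K[5]} -> Prop) (Phi : {mpoly K[5]}) (d : nat).
Hypothesis HJ : hom_ideal J.
Hypothesis pJ : prime_ideal J.
Hypothesis Phid : Phi \is d.-homog.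
Hypothesis JPhi : J Phi.
Hypothesis PhiP : forall f, J f -> divides Phi f.
Hypothesis dPhi : Phi^`M(ord_max) != 0.
Hypothesis Phi_val : forall l z, l \in L -> Phi.@[line_point (quad l) 1 z (val l)] = 0.

Definition fibre_point (p : X) (i : 'I_5) : {poly K} :=
  let: (x, y, z) := pos p in [:: 1; x%:P; y%:P; z%:P; 'X]`_i.

Definition fibre (p : X) : {poly K} := line_poly (fibre_point p) Phi.

Lemma size_fibre p : (size (fibre p) <= d.+1)%N.
Proof.
apply: size_line_poly Phid => i; rewrite /fibre_point; case: (pos p) => [[x y] z].
case: i => -[|[|[|[|[|//]]]]] lt_i /=; rewrite ?size_polyX ?size_poly1 //;
  exact: leq_trans (size_polyC_leq1 _) _.
Qed.

Lemma fibre_root p l : p \in P -> l \in L -> inc p l -> root (fibre p) (val l).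
Proof.
move=> Pp Ll /(incE Pp Ll) H; rewrite /root /fibre horner_line_poly; apply/eqP.
case E : (pos p) H => [[x y] z] H; rewrite -(Phi_val z Ll); apply: meval_eq => i.
rewrite /fibre_point E; case: (quad l) H => [[[A B] C] F] [-> ->].
by case: i => -[|[|[|[|[|//]]]]] lt_i /=; rewrite ?hornerE ?mulr1.
Qed.

Lemma fibre_values p : p \in P -> fibre p != 0 ->
  exists2 rs : seq K, (size rs <= d)%N &
    forall l, l \in L -> inc p l -> val l \in rs.
Proof.
move=> Pp f0; have [rs rsE] := closed_field_poly_normal (fibre p).
have lc : lead_coef (fibre p) != 0 by rewrite lead_coef_eq0.
exists rs.
  have := size_fibre p; rewrite rsE size_scale // size_prod_XsubC ltnS; exact.
by move=> l Ll /(fibre_root Pp Ll); rewrite rsE rootZ // root_prod_XsubC.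
Qed.

(** A line that does not lie over the hypersurface carries, at some value of the
last coordinate, a nonzero polynomial of degree d in its parameter, which
vanishes at the points in question. *)
Lemma line_dichotomy l : l \in L -> ~ line_ideal (quad l) Phi ->
  (count (fun p => inc p l && (fibre p == 0%R)) P <= d)%N.
Proof.
move=> Ll /line_idealP nPhi.
have [z0 [s0 n0]] : exists z s, Phi.@[line_point (quad l) 1 z s] != 0.
  apply: contrapT => no; apply: nPhi => //; apply/(line_idealP unc).
  have H : 'X_0 * (Phi \mPo line_param (quad l)) = 0.
    apply: (mpoly_eval0 unc) => u; rewrite mevalM mevalXU.
    have [->|u0] := eqVneq (u 0) 0; first by rewrite mul0r.
    rewrite comp_mpoly_meval (_ : Phi.@[_] = 0) ?mulr0 //.
    have -> : Phi.@[fun i => (tnth (line_param (quad l)) i).@[u]] =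
        Phi.@[fun i => u 0 * line_point (quad l) 1 (u 1 / u 0) (u 2 / u 0) i].
      apply: meval_eq => i; case: (quad l) => [[[A B] C] F]; rewrite (tnth_nth 0).
      by case: i => -[|[|[|[|[|//]]]]] lt_i /=; rewrite ?mevalB ?mevalD ?mevalZ !mevalXU; field.
    rewrite (meval_homog _ _ Phid); apply/eqP; rewrite mulf_eq0; apply/orP; right.
    by apply/negPn/negP => n0; apply: no; exists (u 1 / u 0), (u 2 / u 0).
  move/eqP: H; rewrite mulf_eq0 => /orP[|/eqP //].
  by rewrite -msize_poly_eq0 msizeX.
pose h (i : 'I_5) : {poly K} := let: (A, B, C, E) := quad l in
  [:: 1; A *: 'X - B%:P; C *: 'X + E%:P; 'X; s0%:P]`_i.
have hE z i : (h i).[z] = line_point (quad l) 1 z s0 i.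
  rewrite /h; case: (quad l) => [[[A B] C] F].
  by case: i => -[|[|[|[|[|//]]]]] lt_i /=; rewrite ?hornerE ?mulr1.
have r0 : line_poly h Phi != 0.
  apply: contra_neq n0 => r0; rewrite -(horner0 z0) -r0 horner_line_poly.
  by apply: meval_eq => i; rewrite hE.
have sr : (size (line_poly h Phi) <= d.+1)%N.
  apply: size_line_poly Phid => i; rewrite /h; case: (quad l) => [[[A B] C] F].
  have sX a : (size (a *: 'X : {poly K}) <= 2)%N.
    by apply: leq_trans (size_scale_leq _ _) _; rewrite size_polyX.
  have sC c : (size (c%:P : {poly K}) <= 2)%N by apply: leq_trans (size_polyC_leq1 _) _.
  case: i => -[|[|[|[|[|//]]]]] lt_i /=; rewrite ?size_polyX ?size_poly1 //.
  - by apply: leq_trans (size_polyD _ _) _; rewrite geq_max size_polyN sX sC.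
  - by apply: leq_trans (size_polyD _ _) _; rewrite geq_max sX sC.
pose zs := [seq (pos p).2 | p <- P & inc p l && (fibre p == 0%R)].
rewrite -size_filter -(size_map (fun p => (pos p).2)) -ltnS; apply: leq_trans sr.
apply: max_poly_roots => //.
  apply/allP => z /mapP [p]; rewrite mem_filter => /andP[/andP[ip /eqP fp] Pp] ->.
  rewrite /root horner_line_poly; apply/eqP; have := congr1 (horner^~ s0) fp.
  rewrite horner0 /fibre horner_line_poly => <-; apply: meval_eq => i; rewrite hE.
  have := incE Pp Ll ip; rewrite /fibre_point.
  case: (pos p) => [[x y] z']; case: (quad l) => [[[A B] C] F] [-> ->].
  by case: i => -[|[|[|[|[|//]]]]] lt_i /=; rewrite ?hornerE ?mulr1.
rewrite map_inj_in_uniq ?filter_uniq // => p p'.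
rewrite !mem_filter => /andP[/andP[ip _] Pp] /andP[/andP[ip' _] Pp'].
have := incE Pp Ll ip; have := incE Pp' Ll ip' => H H' E; apply: pos_inj => //.
move: H H' E; case: (pos p) => [[x y] z]; case: (pos p') => [[x' y'] z'] /=.
by case: (quad l) => [[[A B] C] F] [-> ->] [-> ->] ->.
Qed.

(** The few lines over the hypersurface may contain all the points; each other
line contains few points over which the equation vanishes. *)
Lemma exceptional_incidences :
  (\sum_(l <- L) count (fun p => inc p l && (fibre p == 0%R)) P <=
     4 * d ^ 2 * size P + d * size L)%N.
Proof.
pose ex l := `[< line_ideal (quad l) Phi >].
have le_ex : (size [seq l <- L | ex l] <= 4 * d ^ 2)%N.
  rewrite -(size_map quad); apply: lines_on_surface PhiP dPhi _ _ => //.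
    rewrite map_inj_in_uniq ?filter_uniq // => l l'; rewrite !mem_filter.
    by move=> /andP[_ Ll] /andP[_ Ll']; apply: quad_inj.
  by move=> q /mapP [l]; rewrite mem_filter => /andP[/asboolP H _] ->.
apply: leq_trans (_ : \sum_(l <- L) (ex l * size P + d) <= _)%N.
  rewrite big_seq [in X in (_ <= X)%N]big_seq; apply: leq_sum => l Ll.
  have [/asboolP|/asboolP H] := boolP (ex l).
    by rewrite mul1n => _; apply: leq_trans (count_size _ _) (leq_addr _ _).
  by rewrite mul0n; apply: line_dichotomy.
have -> : (\sum_(l <- L) (ex l * size P + d) = count ex L * size P + d * size L)%N.
  elim: (L) => [|l s IHs]; first by rewrite big_nil muln0.
  by rewrite big_cons IHs /=; lia.
by rewrite leq_add2r leq_mul2r -size_filter le_ex orbT.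
Qed.

End CountOnLines.

Lemma sum_count_exchange (X Y : Type) (P : seq X) (L : seq Y) (r : X -> Y -> bool) :
  (\sum_(l <- L) count (r^~ l) P = \sum_(p <- P) count (r p) L)%N.
Proof.
have cnt (Z : Type) (a : pred Z) s : (count a s = \sum_(z <- s) a z)%N.
  by elim: s => [|z s IHs]; rewrite ?big_nil // big_cons -IHs.
rewrite (eq_bigr (fun l => \sum_(p <- P) r p l)%N) => [|l _]; last exact: cnt.
by rewrite exchange_big; apply: eq_bigr => p _; rewrite cnt.
Qed.

(** A point lies on few lines when the two values that a line takes over it are
roots of nonzero polynomials. *)
Lemma two_values_incidences (X Y V : eqType) (P : seq X) (L : seq Y) (inc : X -> Y -> bool)
    (val1 val2 : Y -> V) (bad1 bad2 : pred X) (e d : nat) :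
    uniq L ->
    (forall p, p \in P -> {in L &, forall l l', inc p l -> inc p l' ->
       val1 l = val1 l' -> val2 l = val2 l' -> l = l'}) ->
    (forall p, p \in P -> ~~ bad1 p -> exists2 rs : seq V, (size rs <= d)%N &
       forall l, l \in L -> inc p l -> val1 l \in rs) ->
    (forall p, p \in P -> ~~ bad2 p -> exists2 rs : seq V, (size rs <= d)%N &
       forall l, l \in L -> inc p l -> val2 l \in rs) ->
    (\sum_(l <- L) count (fun p => inc p l && bad1 p) P <= e)%N ->
    (\sum_(l <- L) count (fun p => inc p l && bad2 p) P <= e)%N ->
  (\sum_(l <- L) count (inc^~ l) P <= e + e + d ^ 2 * size P)%N.
Proof.
move=> uL inj H1 H2 B1 B2.
pose good p l := [&& inc p l, ~~ bad1 p & ~~ bad2 p].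
apply: leq_trans (_ : \sum_(l <- L) (count (fun p => inc p l && bad1 p) P +
    count (fun p => inc p l && bad2 p) P + count (good^~ l) P) <= _)%N.
  apply: leq_sum => l _; elim: (P) => //= p s IHs.
  have : (inc p l <= (inc p l && bad1 p) + (inc p l && bad2 p) + good p l)%N.
    by rewrite /good; case: (inc p l); case: (bad1 p); case: (bad2 p).
  move: IHs; move: (count _ _) (count _ _) (count _ _) (count _ _) => a b c f.
  by move: (nat_of_bool _) (nat_of_bool _) (nat_of_bool _) (nat_of_bool _) => *; lia.
rewrite !big_split /=; apply: leq_add; first exact: leq_add.
rewrite sum_count_exchange.
apply: leq_trans (_ : \sum_(p <- P) d ^ 2 <= _)%N; last first.
  by rewrite big_const_seq count_predT iter_addn_0.
rewrite big_seq [in X in (_ <= X)%N]big_seq; apply: leq_sum => p Pp.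
have [b1|nb1] := boolP (bad1 p).
  by rewrite (@eq_count _ _ pred0) ?count_pred0 // => l; rewrite /good b1 andbF.
have [b2|nb2] := boolP (bad2 p).
  by rewrite (@eq_count _ _ pred0) ?count_pred0 // => l; rewrite /good b2 !andbF.
have [rs1 s1 m1] := H1 p Pp nb1; have [rs2 s2 m2] := H2 p Pp nb2.
rewrite -size_filter -(size_map (fun l => (val1 l, val2 l))).
apply: (@leq_trans (size [seq (x, y) | x <- rs1, y <- rs2])); last first.
  by rewrite size_allpairs expnS expn1 leq_mul.
have goodP l : l \in [seq l <- L | good p l] -> l \in L /\ inc p l.
  by rewrite mem_filter => /andP[/and3P[ip _ _] Ll].
apply: uniq_leq_size.
  rewrite map_inj_in_uniq ?filter_uniq // => l l' /goodP[Ll il] /goodP[Ll' il'] [E1 E2].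
  exact: (inj p Pp).
move=> _ /mapP [l /goodP[Ll il] ->].
by apply/allpairsP; exists (val1 l, val2 l); split; [exact: m1|exact: m2|].
Qed.

(** * Incidences of lines that are graphs over an axis *)

Section ClassIncidences.
Variables (K : closedFieldType).
Hypothesis unc : uncountable_type K.
Hypothesis char0 : forall e, e.+1%:R != 0 :> K.
Variable T : set 'rV[K]_6.
Hypothesis irrT : irreducible_variety T.
Hypothesis chainT : irreducible_chain T 2.
Hypothesis nchainT : ~ irreducible_chain T 3.
Hypothesis nflat : ~ flat 2 T.
Variable D : nat.
Hypothesis degT : variety_degree T D.
Variables jA jC jD jE jB jF : 'I_6.
Hypothesis uniqj : uniq [:: jA; jC; jD; jE; jB; jF].
Hypothesis klein : forall v, T v ->
  v ord0 jA * v ord0 jE + v ord0 jC * v ord0 jB + v ord0 jD * v ord0 jF = 0.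

Variables (X Y : eqType) (P : seq X) (L : seq Y).
Variables (inc : X -> Y -> bool) (pos : X -> K * K * K) (lin : Y -> 'rV[K]_6).
Hypothesis uP : uniq P.
Hypothesis uL : uniq L.
Hypothesis pos_inj : {in P &, injective pos}.
Hypothesis lin_inj : {in L &, injective lin}.
Hypothesis Tlin : forall l, l \in L -> T (lin l).
Hypothesis linD : forall l, l \in L -> lin l ord0 jD = 1.
Hypothesis incE : forall p l, p \in P -> l \in L -> inc p l ->
  let: (x, y, z) := pos p in
  x = lin l ord0 jA * z - lin l ord0 jB /\ y = lin l ord0 jC * z + lin l ord0 jE.

Let quad l := (lin l ord0 jA, lin l ord0 jB, lin l ord0 jC, lin l ord0 jE).
Let delta := (48 * D.+1)%N.

Lemma quad_inj : {in L &, injective quad}.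
Proof.
move=> l l' Ll Ll' [EA EB EC EE]; apply: lin_inj => //; apply/rowP => i.
have EF : lin l ord0 jF = lin l' ord0 jF.
  have := klein (Tlin Ll); have := klein (Tlin Ll').
  rewrite !linD // !mul1r EA EB EC EE => /eqP; rewrite addrC addr_eq0 => /eqP ->.
  by move=> /eqP; rewrite addrC addr_eq0 => /eqP ->.
have := mem_uniq_ord i uniqj erefl.
rewrite !inE => /or4P[/eqP -> //|/eqP -> //|/eqP ->|/or3P[/eqP -> //|/eqP -> //|/eqP -> //]].
by rewrite !linD.
Qed.

(** The relation between the moving point and the coordinate jM restricts to an
equation for jM over each point; bad points are those where it is trivial. *)
Lemma value_incidences jM : L != [::] ->
  exists2 bad : pred X,
    (forall p, p \in P -> ~~ bad p -> exists2 rs : seq K, (size rs <= delta)%N &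
       forall l, l \in L -> inc p l -> lin l ord0 jM \in rs) &
    (\sum_(l <- L) count (fun p => inc p l && bad p) P <=
       4 * delta ^ 2 * size P + delta * size L)%N.
Proof.
move=> L0; have HD : ~ van T 'X_jD.
  have [l Ll] : exists l, l \in L by case: (L) L0 => // l s _; exists l; rewrite mem_head.
  move=> /(_ _ (Tlin Ll)) /eqP.
  by rewrite mevalXU linD // oner_eq0.
have [Phi [d [Phid JPhi PhiP dPhi le_d]]] := coordinate_relation unc char0 irrT chainT
  nchainT nflat degT uniqj klein HD jM.
have HJ : hom_ideal (rels T [tuple of rcons (point_base K jD jE jB) 'X_jM]
    [tuple of rcons (point_dir K jA jC jD) 0]).
  apply: (rel_hom unc irrT); apply: rcons_homog.
  - exact: point_base1.
  - by rewrite dhomogX /= mdeg1.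
  - exact: point_dir1.
  - exact: dhomog0.
have pJ := @rel_prime K 5 4 unc T [tuple of rcons (point_base K jD jE jB) 'X_jM]
    [tuple of rcons (point_dir K jA jC jD) 0] irrT.
have val0 l z : l \in L -> Phi.@[line_point (quad l) 1 z (lin l ord0 jM)] = 0.
  move=> Ll; rewrite -(JPhi _ z (Tlin Ll)); apply: meval_eq => i.
  rewrite /pt !(tnth_nth 0) /=; case: i => -[|[|[|[|[|//]]]]] lt_i /=;
    rewrite ?mevalN ?mevalXU ?meval0 ?linD // ?mulr0 ?addr0 ?add0r ?mulr1 //.
  - by rewrite mulrC addrC.
  - by rewrite mulrC addrC.
have incE' p l : p \in P -> l \in L -> inc p l ->
  let: (x, y, z) := pos p in let: (A, B, C, E) := quad l in
  x = A * z - B /\ y = C * z + E by exact: incE.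
exists (fun p => fibre pos Phi p == 0).
  move=> p Pp nb; have [rs srs rsP] := @fibre_values K _ _ P L inc pos quad incE' (fun l => lin l ord0 jM) Phi d Phid val0 p Pp nb.
  by exists rs => //; apply: leq_trans le_d.
have H := exceptional_incidences unc uP uL pos_inj quad_inj incE' HJ pJ Phid JPhi PhiP dPhi.
apply: leq_trans H _; rewrite leq_add // leq_mul2r ?le_d ?orbT // leq_mul2l.
by rewrite leq_exp2r // le_d !orbT.
Qed.

(** The slopes A and C of a line through a given point determine the line, so it is
enough to bound the number of their values. *)
Theorem class_incidences :
  (\sum_(l <- L) count (inc^~ l) P <= 11 * delta ^ 2 * (size P + size L))%N.
Proof.
have [L0|L0] := eqVneq L [::]; first by rewrite L0 big_nil.
have [bad1 H1 B1] := value_incidences jA L0.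
have [bad2 H2 B2] := value_incidences jC L0.
have := two_values_incidences uL _ H1 H2 B1 B2; move=> H.
apply: leq_trans (H _) _ => {H}.
  move=> p Pp l l' Ll Ll' il il' EA EC; apply: quad_inj => //.
  have := incE Pp Ll il; have := incE Pp Ll' il'; rewrite /quad.
  case: (pos p) => [[x y] z] [-> ->]; rewrite EA EC => -[/addrI /oppr_inj -> /addrI ->].
  by [].
have : (0 < delta)%N by rewrite /delta.
by move: (size P) (size L) delta; clear; nia.
Qed.

End ClassIncidences.

(** * Lines in real space *)

Section RealLines.
Variable R : realType.
Local Notation c := (real_complex R).

Lemma to_projE (p : 'rV[R]_3) :
  [/\ to_proj p ord0 0 = 1, to_proj p ord0 1 = c (p ord0 0),
      to_proj p ord0 2 = c (p ord0 1) & to_proj p ord0 3 = c (p ord0 2)].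
Proof.
rewrite /to_proj; split.
- rewrite (_ : 0 = lshift 3 (0 : 'I_1)); last exact: val_inj.
  by apply: etrans (row_mxEl _ _ _ _) _; rewrite mxE eqxx.
- rewrite (_ : 1 = rshift 1 (0 : 'I_3)); last exact: val_inj.
  by apply: etrans (row_mxEr _ _ _ _) _; rewrite mxE.
- rewrite (_ : 2 = rshift 1 (1 : 'I_3)); last exact: val_inj.
  by apply: etrans (row_mxEr _ _ _ _) _; rewrite mxE.
- rewrite (_ : 3 = rshift 1 (2 : 'I_3)); last exact: val_inj.
  by apply: etrans (row_mxEr _ _ _ _) _; rewrite mxE.
Qed.

(** Plücker coordinates are a direction and a moment. *)
Lemma plucker_line (a u : 'rV[R]_3) (m : 'I_6) :
  plucker (to_proj a) (to_proj (a + u)) ord0 m =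
  c [:: u ord0 0; u ord0 1; u ord0 2;
        a ord0 1 * u ord0 2 - a ord0 2 * u ord0 1;
        a ord0 2 * u ord0 0 - a ord0 0 * u ord0 2;
        a ord0 0 * u ord0 1 - a ord0 1 * u ord0 0]`_m.
Proof.
have [a0 a1 a2 a3] := to_projE a; have [b0 b1 b2 b3] := to_projE (a + u).
rewrite /plucker mxE a0 a1 a2 a3 b0 b1 b2 b3 !mxE.
case: m => -[|[|[|[|[|[|//]]]]]] lt_m /=; rewrite -?rmorph1 -!rmorphM -!rmorphB;
  congr (c _); ring.
Qed.
End RealLines.

(** Lines that are graphs over the k-th axis. *)
Definition transverse (R : realType) (k : 'I_3) (l : set 'rV[R]_3) :=
  exists a u : 'rV[R]_3, u ord0 k != 0 /\ l = [set a + t *: u | t in [set: R]].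

Section LineEquations.
Variable F : fieldType.

Lemma line_equations_point (ai ak ui uk t : F) : uk != 0 ->
  ai + t * ui = ui / uk * (ak + t * uk) - (ak * ui - ai * uk) / uk.
Proof. by move=> uk0; field. Qed.

Lemma line_equations_parameter (qi qk ai ak ui uk : F) : uk != 0 ->
  qi = ui / uk * qk - (ak * ui - ai * uk) / uk -> qi = ai + (qk - ak) / uk * ui.
Proof. by move=> uk0 ->; field. Qed.

End LineEquations.

Section RealClass.
Variables (R : realType) (T : set 'rV[R[i]]_6).
Local Notation c := (real_complex R).
Hypothesis irrT : irreducible_variety T.
Hypothesis chainT : irreducible_chain T 2.
Hypothesis nchainT : ~ irreducible_chain T 3.
Hypothesis nflat : ~ flat 2 T.
Variable D : nat.
Hypothesis degT : variety_degree T D.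
Variables (i j k : 'I_3) (jA jC jD jE jB jF : 'I_6).
Hypothesis ijk : forall s : 'I_3, [\/ s = i, s = j | s = k].
Hypothesis uniqj : uniq [:: jA; jC; jD; jE; jB; jF].
Hypothesis klein : forall v, T v ->
  v ord0 jA * v ord0 jE + v ord0 jC * v ord0 jB + v ord0 jD * v ord0 jF = 0.
Hypothesis coordE : forall a u : 'rV[R]_3,
  let w m := plucker (to_proj a) (to_proj (a + u)) ord0 m in
  [/\ w jA = c (u ord0 i), w jC = c (u ord0 j), w jD = c (u ord0 k),
      w jE = c (a ord0 j * u ord0 k - a ord0 k * u ord0 j) &
      w jB = c (a ord0 k * u ord0 i - a ord0 i * u ord0 k)].

Definition line_data (l : set 'rV[R]_3) (v : 'rV[R[i]]_6) :=
  [/\ T v, v ord0 jD = 1 & forall q : 'rV[R]_3, l q <->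
    c (q ord0 i) = v ord0 jA * c (q ord0 k) - v ord0 jB /\
    c (q ord0 j) = v ord0 jC * c (q ord0 k) + v ord0 jE].

(** The Plücker vector is scaled so that the coordinate jD is 1; the two equations
then define the line, which makes the vector determine it. *)
Lemma exists_line_data l : transverse k l -> plucker_image l `<=` T ->
  exists v, line_data l v.
Proof.
move=> [a [u [uk lE]]] lT; pose w := plucker (to_proj a) (to_proj (a + u)).
have uk' : c (u ord0 k) != 0 by rewrite fmorph_eq0.
have [wA wC wD wE wB] := coordE a u.
have scE m : ((c (u ord0 k))^-1 *: w) ord0 m = (c (u ord0 k))^-1 * w ord0 m.
  by rewrite [LHS]mxE.
exists ((c (u ord0 k))^-1 *: w); split.
- apply: lT; exists (c (u ord0 k))^-1, a, (a + u); split=> //.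
  + by rewrite invr_eq0.
  + by rewrite lE; exists 0; rewrite // scale0r addr0.
  + by rewrite lE; exists 1; rewrite // scale1r.
  + rewrite -subr_eq0 opprD addNKr oppr_eq0; apply: contra_neq uk => ->.
    by rewrite mxE.
- by rewrite scE /w wD mulVf.
move=> q; rewrite !scE /w wA wC wE wB -!fmorphV -!rmorphM -rmorphB -rmorphD.
set ri := (X in _ <-> (c _ = c X /\ _)); set rj := (X in _ <-> (_ /\ c _ = c X)).
have -> : ri = u ord0 i / u ord0 k * q ord0 k -
    (a ord0 k * u ord0 i - a ord0 i * u ord0 k) / u ord0 k by rewrite /ri; ring.
have -> : rj = u ord0 j / u ord0 k * q ord0 k -
    (a ord0 k * u ord0 j - a ord0 j * u ord0 k) / u ord0 k by rewrite /rj; ring.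
split; first by rewrite lE => -[t _ <-]; rewrite !mxE; split; congr c; apply: line_equations_point.
move=> [/complexI /(line_equations_parameter uk) qi /complexI /(line_equations_parameter uk) qj].
rewrite lE; exists ((q ord0 k - a ord0 k) / u ord0 k) => //; apply/rowP => s.
by rewrite !mxE; have [->|->|->] := ijk s; rewrite -?qi -?qj // divfK // addrC subrK.
Qed.

Lemma transverse_incidences (P : seq 'rV[R]_3) (L : seq (set 'rV[R]_3)) :
    uniq P -> uniq L -> (forall l, l \in L -> transverse k l /\ plucker_image l `<=` T) ->
  (\sum_(l <- L) count (mem l) P <= 11 * (48 * D.+1) ^ 2 * (size P + size L))%N.
Proof.
move=> uP uL HL.
pose lin l := xget 0 (line_data l).
have linP l : l \in L -> line_data l (lin l).
  by move=> /HL [tl lT]; have [v Hv] := exists_line_data tl lT; exact: (@xgetPex _ 0 (line_data l) (ex_intro _ v Hv)).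
pose pos (p : 'rV[R]_3) := (c (p ord0 i), c (p ord0 j), c (p ord0 k)).
have char0 e : e.+1%:R != 0 :> R[i] by rewrite pnatr_eq0.
apply: (@class_incidences R[i] (@uncountable_complex R) char0 T irrT chainT nchainT
  nflat D degT jA jC jD jE jB jF uniqj klein _ _ P L (fun p l => p \in l) pos lin uP uL).
- move=> p q _ _ [Ei Ej Ek]; apply/rowP => s.
  by have [->|->|->] := ijk s.
- move=> l l' /linP [_ _ Hl] /linP [_ _ Hl'] E.
  by apply/seteqP; split=> q; [move/Hl|move/Hl'] => H; [apply/Hl'|apply/Hl]; rewrite (E, esym E).
- by move=> l /linP [].
- by move=> l /linP [].
by move=> p l _ /linP [_ _ H]; rewrite inE => /H.
Qed.

End RealClass.

Lemma incidences_sum (R : realType) (P : {fset 'rV[R]_3}) (L : {fset set 'rV[R]_3}) :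
  (incidences P L <= \sum_(l <- enum_fset L) count (mem l) (enum_fset P))%N.
Proof.
rewrite /incidences; set E := [fset z in _ | _]%fset.
pose s := [seq (p, l) | l <- enum_fset L, p <- [seq p <- enum_fset P | p \in l]].
have -> : (\sum_(l <- enum_fset L) count (mem l) (enum_fset P))%N = size s.
  rewrite /s size_allpairs_dep sumnE big_map; apply: eq_bigr => l _.
  by rewrite size_filter.
apply: uniq_leq_size; first exact: fset_uniq.
move=> [p l]; rewrite !inE => /andP[/andP[Pp Ll] pl].
by apply/allpairsPdep; exists l, p; split=> //; rewrite mem_filter pl.
Qed.

Lemma line_transverse (R : realType) (l : set 'rV[R]_3) : is_line l ->
  [\/ transverse 0 l, transverse 1 l | transverse 2 l].
Proof.
move=> [a [u [u0 lE]]].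
have [k uk] : exists k, u ord0 k != 0 by apply/rV0Pn.
case: k uk => -[|[|[|//]]] lt_k uk; [apply: Or31|apply: Or32|apply: Or33];
  exists a, u; split=> //; apply: contra_neq uk => uk; rewrite -[RHS]uk; congr (u _ _);
  exact: val_inj.
Qed.

Theorem theorem4p1 (R : realType) (D : nat) :
  exists C : nat,
    forall (P : {fset 'rV[R]_3}) (L : {fset set 'rV[R]_3})
           (T : set 'rV[R[i]]_6),
      (forall l, l \in L -> is_line l) ->
      irreducible_variety T ->
      T `<=` @klein_quadric _ ->
      variety_dim T 2 ->
      ~ flat 2 T ->
      variety_degree T D ->
      plucker_images L `<=` T ->
      (incidences P L <= C * (#|` P| + #|` L|))%N.
Proof.
exists (3 * (11 * (48 * D.+1) ^ 2))%N => P L T HL irrT TQ [chainT nchainT] nflat degT LT.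
apply: leq_trans (incidences_sum P L) _.
pose cls k (l : set 'rV[R]_3) := `[< transverse k l >].
have imT l : l \in L -> plucker_image l `<=` T.
  by move=> Ll v lv; apply: LT; exists l.
have ijk (s : 'I_3) : [\/ s = 0, s = 1 | s = 2].
  by case: s => -[|[|[|//]]] lt_s; [apply: Or31|apply: Or32|apply: Or33]; apply: val_inj.
have bound k : (\sum_(l <- [seq l <- enum_fset L | cls k l]) count (mem l) (enum_fset P)
    <= 11 * (48 * D.+1) ^ 2 * (#|` P| + #|` L|))%N.
  apply: (@leq_trans (11 * (48 * D.+1) ^ 2 *
      (size (enum_fset P) + size [seq l <- enum_fset L | cls k l]))); last first.
    by rewrite leq_mul2l leq_add2l size_filter count_size orbT.
  have uL : uniq [seq l <- enum_fset L | cls k l] by rewrite filter_uniq // fset_uniq.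
  have clsP l : l \in [seq l <- enum_fset L | cls k l] ->
      transverse k l /\ plucker_image l `<=` T.
    by rewrite mem_filter => /andP[/asboolP tl Ll]; split=> //; apply: imT.
  have uP : uniq (enum_fset P) by exact: fset_uniq.
  have [kE|kE|kE] := ijk k; rewrite kE in uL clsP *.
  - apply: (@transverse_incidences R T irrT chainT nchainT nflat D degT 1 2 0 1 2 0 4 5 3) => //.
    + by move=> s; have [] := ijk s; [apply: Or33|apply: Or31|apply: Or32].
    + by move=> v /TQ [_ <-]; ring.
    + by move=> a u; split; rewrite plucker_line.
  - apply: (@transverse_incidences R T irrT chainT nchainT nflat D degT 2 0 1 2 0 1 5 3 4) => //.
    + by move=> s; have [] := ijk s; [apply: Or32|apply: Or33|apply: Or31].
    + by move=> v /TQ [_ <-]; ring.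
    + by move=> a u; split; rewrite plucker_line.
  - apply: (@transverse_incidences R T irrT chainT nchainT nflat D degT 0 1 2 0 1 2 3 4 5) => //.
    + by move=> v /TQ [_ <-]; ring.
    + by move=> a u; split; rewrite plucker_line.
apply: (@leq_trans (\sum_(k < 3) \sum_(l <- [seq l <- enum_fset L | cls k l])
    count (mem l) (enum_fset P))%N); last first.
  apply: (@leq_trans (\sum_(k < 3) 11 * (48 * D.+1) ^ 2 * (#|` P| + #|` L|))%N).
    by apply: leq_sum => k _; exact: bound.
  by rewrite sum_nat_const card_ord mulnA.
rewrite (eq_bigr (fun k => \sum_(l <- enum_fset L | cls k l) count (mem l) (enum_fset P))%N);
  last by move=> k _; rewrite big_filter.
rewrite (exchange_big_dep predT) //= big_seq [in X in (_ <= X)%N]big_seq.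
apply: leq_sum => l /HL /line_transverse Hl.
have [k kl] : exists k, cls k l.
  by case: Hl => Hl; [exists 0|exists 1|exists 2]; apply/asboolP.
by rewrite (bigD1 k) //= leq_addr.
Qed.
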